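(* Let $u\in H_0^1(\Omega)$ be the solution of the exact interface problem $$(\kappa\nabla u,\nabla v)_\Omega=(f,v)_\Omega\qquad\forall v\in H_0^1(\Omega),$$ and let $u_{0h}\in V_h^0(\Omega)$ be the solution of the discrete defeatured (coarsened-interface) problem $$(\kappa_0\nabla u_{0h},\nabla v_h)_\Omega=(f,v_h)_\Omega\qquad\forall v_h\in V_h^0(\Omega).$$ Let $\boldsymbol{\sigma}_h\in H(\mathrm{div},\Omega)$ be the equilibrated flux reconstructed patch-wise from $u_{0h}$ (as defined in the context), let $\boldsymbol{s}_0:=\kappa_0^{-1/2}\boldsymbol{\sigma}_h+\kappa_0^{1/2}\nabla u_{0h}$, let $\rho:=\kappa_2/\kappa_1$, let $e:=u-u_{0h}$, and let $\mathcal{W}_h:=\{K\in\mathcal{T}_h^0:\ |K\cap\omega|\neq 0\}$. Then $$\|e\|_a\le \mathcal{E}_{\mathrm d}+\mathcal{E}_{\mathrm n},$$ where $\|v\|_a:=(\kappa\nabla v,\nabla v)_\Omega^{1/2}$ and $$\mathcal{E}_{\mathrm d}=C(\kappa)\Big(\sum_{K\in\mathcal{W}_h}\|\boldsymbol{\sigma}_h\|_{K\cap\omega}^2\Big)^{1/2},$$ $$\mathcal{E}_{\mathrm n}=\Big(\sum_{K\in\mathcal{T}_h^0}\|\boldsymbol{s}_0\|_K^2\Big)^{1/2}+\widetilde C(\kappa)\Big(\sum_{K\in\mathcal{W}_h}\|\boldsymbol{s}_0\|_{K\cap\omega}^2\Big)^{1/2},$$ with $C(\kappa)=|\rho-1|\,\kappa_2^{-1/2}$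 and $\widetilde C(\kappa)=|\rho^{1/2}-1|$.
   Context: **Notation.** For a domain $D\subset\mathbb{R}^d$, $|D|$ is its measure, $(\cdot,\cdot)_D$ the $L^2(D)$ inner product (scalar or vector valued), and $\|\cdot\|_D$ the $L^2(D)$ norm. $\mathcal{P}_p(K)$ is the space of polynomials of degree at most $p$ on $K$. **Geometry.** Let $d\in\{2,3\}$ and let $\Omega\subset\mathbb{R}^d$ be a bounded Lipschitz domain with $\Omega=\mathrm{int}(\overline{\Omega_1}\cup\overline{\Omega_2})$, where $\Omega_1,\Omega_2$ are (disjoint) bounded Lipschitz domains, with interface $\Gamma:=\overline{\Omega_1}\cap\overline{\Omega_2}$. A coarsened interface $\Gamma_0$, with $\Gamma\cap\Gamma_0\neq\emptyset$, separates $\Omega$ into two (disjoint) components $\Omega_{0,1},\Omega_{0,2}$ with $\Omega=\mathrm{int}(\overline{\Omega_{0,1}}\cup\overline{\Omega_{0,2}})$. Set $\gamma:=\Gamma\setminus\overline{\Gamma_0}$ and $\gamma_0:=\Gamma_0\setminus\overline{\Gamma}$. It is assumed that $\overline{\gamma}\cup\overline{\gamma_0}$ is the closed boundary $\partial\omega$ of an open (Lipschitz) domain $\omega$, called the feature. The feature lies in $\Omega_2$ and is reassigned to the first component by the coarsening: $\Omega_{0,1}=\mathrm{int}(\overline{\Omega_1}\cup\overline{\omega})$ and $\Omega_{0,2}=\Omega_2\setminus\overline{\omega}$. **Coefficients.** $\kappa_1,\kappa_2>0$ are constants. The exact coefficient is $\kappa=\kappa_i$ in $\Omega_i$, $i=1,2$,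 and the defeatured coefficient is $\kappa_0=\kappa_i$ in $\Omega_{0,i}$, $i=1,2$. Hence $\kappa/\kappa_0=1$ in $\Omega\setminus\omega$ and $\kappa/\kappa_0=\rho$ in $\omega$. **Discretization.** $\mathcal{T}_h^0$ is a non-degenerate simplicial mesh of $\Omega$, $\overline\Omega=\bigcup_{K\in\mathcal{T}_h^0}K$, conforming to $\Gamma_0$ (so $\kappa_0$ is constant on each $K$); no assumption is made on how it intersects $\omega$ and $\partial\omega$. For an integer $p\ge1$, $$Q_h(\Omega):=\{q_h\in L^2(\Omega): q_h|_K\in\mathcal{P}_p(K)\ \forall K\in\mathcal{T}_h^0\},\qquad V_h^0(\Omega):=\{v\in\mathcal{C}^0(\overline\Omega)\cap Q_h(\Omega): v|_{\partial\Omega}=0\},$$ and the source satisfies $f\in Q_h(\Omega)$. **Equilibrated flux.** Let $$\boldsymbol{M}_h(\Omega):=\{\boldsymbol v_h\in H(\mathrm{div},\Omega): \boldsymbol v_h|_K\in[\mathcal{P}_p(K)]^d+\boldsymbol{x}\,\mathcal{P}_p(K)\ \forall K\in\mathcal{T}_h^0\}$$ be the Raviart–Thomas space of order $p$. Let $\mathscr{N}_h$ be the set of mesh vertices, split into those interior to $\Omega$ ($\mathscr{N}_h^{\mathrm{int}}$) and those on $\partial\Omega$ ($\mathscr{N}_h^{\partial}$). For $\boldsymbol a\in\mathscr{N}_h$ let $\pi_{\boldsymbol a}$ be the patch of elements sharing $\boldsymbol a$, $\psi_{\boldsymbol a}$ the hat function (continuous, piecewise affine, equal to $1$ at $\boldsymbol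 a$ and $0$ at all other vertices), and $\partial\pi_{\boldsymbol a}^0:=\{\boldsymbol x\in\partial\pi_{\boldsymbol a}:\psi_{\boldsymbol a}(\boldsymbol x)=0\}$. With $\boldsymbol M_h(\pi_{\boldsymbol a})$, $Q_h(\pi_{\boldsymbol a})$ the restrictions of $\boldsymbol M_h(\Omega)$, $Q_h(\Omega)$ to $\pi_{\boldsymbol a}$, and $\boldsymbol n_{\pi_{\boldsymbol a}}$ the unit outward normal of $\pi_{\boldsymbol a}$, let $$\boldsymbol M_{h}^{\boldsymbol a}:=\{\boldsymbol v_h\in\boldsymbol M_h(\pi_{\boldsymbol a}):\boldsymbol v_h\cdot\boldsymbol n_{\pi_{\boldsymbol a}}=0\text{ on }\partial\pi_{\boldsymbol a}^0\},$$ $$Q_h^{\boldsymbol a}:=\{q_h\in Q_h(\pi_{\boldsymbol a}):(q_h,1)_{\pi_{\boldsymbol a}}=0\}\ \text{ if }\boldsymbol a\in\mathscr{N}_h^{\mathrm{int}},\qquad Q_h^{\boldsymbol a}:=Q_h(\pi_{\boldsymbol a})\ \text{ if }\boldsymbol a\in\mathscr{N}_h^{\partial}.$$ For each $\boldsymbol a$, $(\boldsymbol\sigma_h^{\boldsymbol a},\lambda_h^{\boldsymbol a})\in\boldsymbol M_h^{\boldsymbol a}\times Q_h^{\boldsymbol a}$ is the solution of $$(\kappa_0^{-1}\boldsymbol\sigma_h^{\boldsymbol a},\boldsymbol v_h)_{\pi_{\boldsymbol a}}-(\lambda_h^{\boldsymbol a},\nabla\cdot\boldsymbol v_h)_{\pi_{\boldsymbol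 a}}=-(\psi_{\boldsymbol a}\nabla u_{0h},\boldsymbol v_h)_{\pi_{\boldsymbol a}}\quad\forall\boldsymbol v_h\in\boldsymbol M_h^{\boldsymbol a},$$ $$(\nabla\cdot\boldsymbol\sigma_h^{\boldsymbol a},q_h)_{\pi_{\boldsymbol a}}=(\psi_{\boldsymbol a}f,q_h)_{\pi_{\boldsymbol a}}-(\nabla\psi_{\boldsymbol a}\cdot\kappa_0\nabla u_{0h},q_h)_{\pi_{\boldsymbol a}}\quad\forall q_h\in Q_h^{\boldsymbol a},$$ and $\boldsymbol\sigma_h:=\sum_{\boldsymbol a\in\mathscr{N}_h}\boldsymbol\sigma_h^{\boldsymbol a}$, each $\boldsymbol\sigma_h^{\boldsymbol a}$ being extended by zero outside $\pi_{\boldsymbol a}$. It is a known result (Ern–Vohralík 2015, Lemma 3.5) that $\boldsymbol\sigma_h\in H(\mathrm{div},\Omega)$ and $$(\nabla\cdot\boldsymbol\sigma_h,v_h)_K=(f,v_h)_K\qquad\forall v_h\in\mathcal{P}_p(K),\ \forall K\in\mathcal{T}_h^0.$$ *)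

(* Defs.v *)
From HB Require Import structures.
From mathcomp Require Import all_boot all_order all_algebra.
(* The notations of mpoly are incompatible with those of MathComp-Analysis. *)
From mathcomp Require Import -(notations) mpoly.
From mathcomp Require Import all_classical all_reals all_analysis.
Set Implicit Arguments.
Unset Strict Implicit.
Unset Printing Implicit Defensive.
Import Order.TTheory GRing.Theory Num.Theory numFieldNormedType.Exports.
Local Open Scope classical_set_scope.
Local Open Scope ring_scope.

(* The sigma-algebra on ['rV[T]_n] is the product one; for [T := R] it is the
   Borel sigma-algebra. *)
Definition measure_rV_display : measure_display -> measure_display.
Proof. exact. Qed.

Section measurable_rV.
Context {d : measure_display} {T : measurableType d} (n : nat).

Definition cylinders : set_system 'rV[T]_n :=
  [set A | exists (i : 'I_n) (B : set T),
             measurable B /\ A = [set x : 'rV[T]_n | B (x ord0 i)]].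

HB.instance Definition _ := @isMeasurable.Build (measure_rV_display d)
  'rV[T]_n <<s cylinders >> (@sigma_algebra0 _ _ _) (@sigma_algebraC _ _)
  (@sigma_algebra_bigcup _ _ _).

Lemma measurable_coord (i : 'I_n) :
  measurable_fun [set: 'rV[T]_n] (fun x : 'rV[T]_n => x ord0 i).
Proof.
move=> _ B mB; rewrite setTI; apply: sub_sigma_algebra.
by exists i, B.
Qed.

Lemma measurable_fun_rVP d' (T' : measurableType d') (f : T' -> 'rV[T]_n) :
  (forall i, measurable_fun setT (fun x => f x ord0 i)) -> measurable_fun setT f.
Proof.
move=> mf; apply: (@measurability _ _ _ _ _ _ cylinders) => //.
by move=> _ [_ [i [B [mB ->]] <-]]; exact: mf.
Qed.

End measurable_rV.

Section lebesgue_rV.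
Context {R : realType}.

Section step.
Variable (n : nat) (mu : {sigma_finite_measure set 'rV[R]_n -> \bar R}).

Definition rV_cons (xt : R * 'rV[R]_n) : 'rV[R]_n.+1 :=
  row_mx (xt.1%:M : 'rV_1) xt.2.

Lemma measurable_rV_cons : measurable_fun setT rV_cons.
Proof.
apply: measurable_fun_rVP => i; have [j ->|j ->] := split_ordP (i : 'I_(1 + n)).
  rewrite (_ : (fun _ => _) = fst) //; apply/funext => x.
  by apply: etrans (row_mxEl _ _ _ _) _; rewrite mxE !ord1 eqxx.
rewrite (_ : (fun _ => _) = (fun t : 'rV[R]_n => t ord0 j) \o snd).
  exact: measurableT_comp (measurable_coord j) measurable_snd.
by apply/funext => x; exact: (row_mxEr _ _ _ _).
Qed.

Definition lebesgue_cons : set 'rV[R]_n.+1 -> \bar R :=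
  pushforward (lebesgue_measure \x mu)%E rV_cons.

Let lebesgue_cons0 : lebesgue_cons set0 = 0%E.
Proof. by rewrite /lebesgue_cons /pushforward preimage_set0 measure0. Qed.

Let lebesgue_cons_ge0 A : (0 <= lebesgue_cons A)%E.
Proof. exact: (measure_ge0 (lebesgue_measure \x mu)%E). Qed.

Let lebesgue_cons_sigma_additive : semi_sigma_additive lebesgue_cons.
Proof.
pose m := measure_function_pushforward__canonical__measure_function_Measure
  (lebesgue_measure \x mu)%E measurable_rV_cons.
exact: (@measure_semi_sigma_additive _ _ _ m).
Qed.

HB.instance Definition _ := isMeasure.Build _ _ _ lebesgue_cons
  lebesgue_cons0 lebesgue_cons_ge0 lebesgue_cons_sigma_additive.

Let lebesgue_cons_sigma_finite : sigma_finite setT lebesgue_cons.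
Proof.
have /sigma_finiteP[F [TF ndF Foo]] := sigma_finiteT (@lebesgue_measure R).
have /sigma_finiteP[G [TG ndG Goo]] := sigma_finiteT mu.
pose u (y : 'rV[R]_n.+1) := (y ord0 ord0, rsubmx (y : 'rV_(1 + n))).
have mu_ : measurable_fun setT u.
  apply/measurable_fun_pairP; split; first exact: measurable_coord.
  apply: measurable_fun_rVP => i; under eq_fun do rewrite mxE.
  exact: measurable_coord.
have uK x : u (rV_cons x) = x.
  case: x => a t; congr (_, _); last by rewrite row_mxKr.
  have -> : ord0 = lshift n (ord0 : 'I_1) by exact/val_inj.
  by apply: etrans (row_mxEl _ _ _ _) _; rewrite mxE eqxx.
exists (fun k => u @^-1` (F k `*` G k)).
  apply/esym; rewrite -subTset => y _.
  have [i _ Fi] : (\bigcup_i F i) (u y).1 by rewrite -TF.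
  have [j _ Gj] : (\bigcup_i G i) (u y).2 by rewrite -TG.
  exists (maxn i j) => //; split.
  - by move: Fi; exact/subsetPset/ndF/leq_maxl.
  - by move: Gj; exact/subsetPset/ndG/leq_maxr.
move=> k; have [mF Fk] := Foo k; have [mG Gk] := Goo k; split.
  by rewrite -[X in measurable X]setTI; apply: mu_ => //; exact: measurableX.
suff -> : lebesgue_cons (u @^-1` (F k `*` G k)) =
    (lebesgue_measure \x mu)%E (F k `*` G k).
  by rewrite product_measure1E// lte_mul_pinfty// ge0_fin_numE.
rewrite /lebesgue_cons /pushforward -comp_preimage.
by rewrite (_ : u \o rV_cons = id) ?preimage_id//; apply/funext.
Qed.

HB.instance Definition _ := Measure_isSigmaFinite.Build _ _ _ lebesgue_cons
  lebesgue_cons_sigma_finite.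

End step.

Fixpoint lebesgue_rV (n : nat) : {sigma_finite_measure set 'rV[R]_n -> \bar R} :=
  if n is m.+1 then lebesgue_cons (lebesgue_rV m) else \d_(0 : 'rV[R]_0).

End lebesgue_rV.

Section sobolev.
Context {R : realType} {d : nat}.
Local Notation E := 'rV[R]_d.
Local Notation mu := (@lebesgue_rV R d).
Implicit Types (D : set E) (v phi : E -> R) (w : E -> E).

Definition boundary D : set E := closure D `\` D°.

Definition dotp (x y : E) : R := \sum_i x ord0 i * y ord0 i.

Definition inner D (f g : E -> R) : R := \int[mu]_(x in D) (f x * g x).
Definition innerv D (f g : E -> E) : R := \int[mu]_(x in D) dotp (f x) (g x).
Definition normv D w : R := Num.sqrt (innerv D w w).

Definition L2 D v : Prop :=
  measurable_fun D v /\ mu.-integrable D (fun x => (v x ^+ 2)%:E).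
Definition L2v D w : Prop := forall i, L2 D (fun x => w x ord0 i).

(* Near each boundary point, [D] is the strict epigraph, in some unit direction
   [nu], of a Lipschitz function of the coordinates orthogonal to [nu], that is,
   of a Lipschitz function on the whole space that is invariant along [nu]. *)
Definition lipschitz_boundary D : Prop :=
  forall x, boundary D x -> exists (nu : E) (g : E -> R) (r : R),
    [/\ dotp nu nu = 1, lipschitz g, forall y t, g (y + t *: nu) = g y,
        0 < r & forall y, ball x r y -> (D y <-> g y < dotp y nu)].

Definition bounded_lipschitz_domain D : Prop :=
  [/\ open D, D !=set0, connected D, bounded_set D & lipschitz_boundary D].

Definition partial (i : 'I_d) phi : E -> R :=
  fun x => 'D_(delta_mx ord0 i) phi x.

Definition classical_grad phi : E -> E := fun x => \row_i partial i phi x.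

Definition smooth phi : Prop := forall s : seq 'I_d,
  let g := foldr partial phi s in
  continuous g /\ forall i x, derivable g x (delta_mx ord0 i).

Definition test_function D phi : Prop :=
  let supp := closure [set x | phi x != 0] in
  [/\ smooth phi, compact supp & supp `<=` D].

Definition is_wgrad D v w : Prop :=
  L2v D w /\ forall phi, test_function D phi ->
    forall i, inner D v (partial i phi) = - inner D (fun x => w x ord0 i) phi.

(* A square integrable weak gradient of [v] on [D], unique up to null sets, or
   the zero field if there is none. *)
Definition wgrad D v : E -> E := xget (fun=> 0) [set w | is_wgrad D v w].

Definition H1 D v : Prop := L2 D v /\ exists w, is_wgrad D v w.

Definition H1norm D v : R :=
  Num.sqrt (inner D v v + innerv D (wgrad D v) (wgrad D v)).

Definition H10 D v : Prop := H1 D v /\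
  forall eps, 0 < eps -> exists phi, test_function D phi /\
    H1norm D (fun x => v x - phi x) < eps.

Definition is_wdiv D w v : Prop :=
  L2 D v /\ forall phi, test_function D phi ->
    innerv D w (classical_grad phi) = - inner D v phi.

Definition wdiv D w : E -> R := xget (fun=> 0) [set v | is_wdiv D w v].

Definition Hdiv D w : Prop := L2v D w /\ exists v, is_wdiv D w v.

(* The condition [w \cdot n = 0] on a part [S] of the boundary of [D], for [w]
   in [Hdiv D]: as usual in H(div), the normal trace is understood through
   the Green formula, tested here with functions that vanish on the rest of the
   boundary. *)
Definition normal_trace0 D (S : set E) w : Prop :=
  forall phi, smooth phi ->
    (forall x, (boundary D `\` S) x -> phi x = 0) ->
    innerv D w (classical_grad phi) + inner D (wdiv D w) phi = 0.

End sobolev.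

Section geometry.
Context {R : realType} {d : nat}.
Local Notation E := 'rV[R]_d.

Record defeatured_geometry
    (Omega Omega1 Omega2 Gamma Gamma0 Omega01 Omega02 omega : set E) : Prop := {
  geo_domain : bounded_lipschitz_domain Omega ;
  geo_domain1 : bounded_lipschitz_domain Omega1 ;
  geo_domain2 : bounded_lipschitz_domain Omega2 ;
  geo_disjoint : Omega1 `&` Omega2 = set0 ;
  geo_union : Omega = (closure Omega1 `|` closure Omega2)° ;
  geo_interface : Gamma = closure Omega1 `&` closure Omega2 ;
  geo_meet : Gamma `&` Gamma0 !=set0 ;
  geo_separate : Omega `\` Gamma0 = Omega01 `|` Omega02 ;
  geo_disjoint0 : Omega01 `&` Omega02 = set0 ;
  geo_union0 : Omega = (closure Omega01 `|` closure Omega02)° ;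
  geo_feature : bounded_lipschitz_domain omega ;
  geo_feature_boundary :
    closure (Gamma `\` closure Gamma0) `|` closure (Gamma0 `\` closure Gamma) =
      boundary omega ;
  geo_feature2 : omega `<=` Omega2 ;
  geo_domain01 : Omega01 = (closure Omega1 `|` closure omega)° ;
  geo_domain02 : Omega02 = Omega2 `\` closure omega }.

(* The coefficient equal to [k1] on the first subdomain [A] and to [k2] on the
   second one; its value on the interface, a null set, is immaterial. *)
Definition coefficient (k1 k2 : R) (A : set E) : E -> R :=
  fun x => if x \in A then k1 else k2.

End geometry.

Section discretization.
Context {R : realType} {d : nat}.
Local Notation E := 'rV[R]_d.
Local Notation mu := (@lebesgue_rV R d).

Record mesh := Mesh {
  nvertices : nat ;
  vertex : 'I_nvertices -> E ;
  cells : {set {set 'I_nvertices}} }.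

Definition simplex (Th : mesh) (T : {set 'I_(nvertices Th)}) : set E :=
  [set x | exists l : 'I_(nvertices Th) -> R,
    [/\ forall i, 0 <= l i, forall i, i \notin T -> l i = 0, \sum_i l i = 1
      & x = \sum_i l i *: vertex i]].

Record simplicial_mesh (Omega : set E) (Th : mesh) : Prop := {
  mesh_vertex_inj : injective (@vertex Th) ;
  mesh_vertex_used : forall a, exists2 T, T \in cells Th & a \in T ;
  mesh_card : forall T, T \in cells Th -> #|T| = d.+1 ;
  mesh_nondegenerate : forall T, T \in cells Th ->
    forall l : 'I_(nvertices Th) -> R, (forall i, i \notin T -> l i = 0) ->
      \sum_i l i = 0 -> \sum_i l i *: vertex i = 0 -> forall i, l i = 0 ;
  mesh_matching : forall T T', T \in cells Th -> T' \in cells Th ->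
    simplex T `&` simplex T' = simplex (T :&: T') ;
  mesh_cover : closure Omega = \bigcup_(T in [set` cells Th]) simplex T }.

Definition conforming_to (Gamma0 : set E) (Th : mesh) : Prop :=
  forall T, T \in cells Th -> (simplex T)° `&` Gamma0 = set0.

Definition peval (P : mpoly d R) (x : E) : R := meval (fun i => x ord0 i) P.

(* [mmeasure mdeg P] is [msize P], i.e. 1 + the total degree of [P]. *)
Definition deg_le (p : nat) (P : mpoly d R) : Prop := (mmeasure mdeg P <= p.+1)%N.

Definition poly_on (p : nat) (K : set E) (v : E -> R) : Prop :=
  exists2 P, deg_le p P & \forall x \ae mu, K x -> v x = peval P x.

Definition raviart_thomas_on (p : nat) (K : set E) (w : E -> E) : Prop :=
  exists (P : 'I_d -> mpoly d R) (Q : mpoly d R),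
    [/\ forall i, deg_le p (P i), deg_le p Q
      & \forall x \ae mu, K x ->
          w x = \row_i peval (P i) x + peval Q x *: x].

Section spaces.
Variables (Omega : set E) (Th : mesh) (p : nat).

Definition Qh (q : E -> R) : Prop :=
  L2 Omega q /\ forall T, T \in cells Th -> poly_on p (simplex T) q.

Definition Vh0 (v : E -> R) : Prop :=
  [/\ {within closure Omega, continuous v}, Qh v
    & forall x, boundary Omega x -> v x = 0].

Definition Mh (w : E -> E) : Prop :=
  Hdiv Omega w /\
  forall T, T \in cells Th -> raviart_thomas_on p (simplex T) w.

Definition patch (a : 'I_(nvertices Th)) : set E :=
  (\bigcup_(T in [set T | T \in cells Th /\ a \in T]) simplex T)°.

Definition hat_function (a : 'I_(nvertices Th)) (psi : E -> R) : Prop :=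
  [/\ {within closure Omega, continuous psi},
      forall T, T \in cells Th -> poly_on 1 (simplex T) psi
    & forall b, psi (vertex b) = (b == a)%:R].

Definition restrictions {F : Type} (X : set (E -> F)) (D : set E) : set (E -> F) :=
  [set f | exists2 g, X g & \forall x \ae mu, D x -> f x = g x].

Variables (f : E -> R) (kappa0 : E -> R) (u0h : E -> R)
  (psi : 'I_(nvertices Th) -> E -> R).

Definition Mha (a : 'I_(nvertices Th)) (w : E -> E) : Prop :=
  restrictions Mh (patch a) w /\
  normal_trace0 (patch a) [set x | boundary (patch a) x /\ psi a x = 0] w.

Definition Qha (a : 'I_(nvertices Th)) (q : E -> R) : Prop :=
  restrictions Qh (patch a) q /\
  (Omega (vertex a) -> inner (patch a) q (fun=> 1) = 0).

Definition local_flux_problem (a : 'I_(nvertices Th))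
    (sigma : E -> E) (lambda : E -> R) : Prop :=
  [/\ Mha a sigma, Qha a lambda,
      forall w, Mha a w ->
        innerv (patch a) (fun x => (kappa0 x)^-1 *: sigma x) w
        - inner (patch a) lambda (wdiv (patch a) w) =
        - innerv (patch a) (fun x => psi a x *: wgrad Omega u0h x) w
    & forall q, Qha a q ->
        inner (patch a) (wdiv (patch a) sigma) q =
        inner (patch a) (fun x => psi a x * f x) q
        - inner (patch a) (fun x =>
            dotp (wgrad Omega (psi a) x) (kappa0 x *: wgrad Omega u0h x)) q].

Definition sum_patches (sigma : 'I_(nvertices Th) -> E -> E) : E -> E :=
  fun x => \sum_a (\1_(patch a) x *: sigma a x).

End spaces.

Definition exact_solution (Omega : set E) (kappa f u : E -> R) : Prop :=
  H10 Omega u /\ forall v, H10 Omega v ->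
    innerv Omega (fun x => kappa x *: wgrad Omega u x) (wgrad Omega v) =
    inner Omega f v.

Definition discrete_solution (Omega : set E) (Th : mesh) (p : nat)
    (kappa0 f u0h : E -> R) : Prop :=
  Vh0 Omega Th p u0h /\ forall v, Vh0 Omega Th p v ->
    innerv Omega (fun x => kappa0 x *: wgrad Omega u0h x) (wgrad Omega v) =
    inner Omega f v.

Definition energy_norm (Omega : set E) (kappa v : E -> R) : R :=
  Num.sqrt (innerv Omega (fun x => kappa x *: wgrad Omega v x) (wgrad Omega v)).

Definition feature_cells (Th : mesh) (omega : set E) :
    {set {set 'I_(nvertices Th)}} :=
  [set T in cells Th | mu (simplex T `&` omega) != 0%E].

End discretization.
Arguments mesh : clear implicits.

(* Main.v *)
(* The reconstructed flux satisfies div sigma_h = f, so that sigma_h + kappa grad u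
   is orthogonal to grad v for v = u and for v = u_0h, hence for v = e, and
     ||e||_a^2 = - (sigma_h + kappa grad u_0h, grad e)
               = - (S, kappa^(1/2) grad e),
   where S = kappa^(-1/2) sigma_h + kappa^(1/2) grad u_0h. Almost everywhere,
   kappa = kappa_0 outside omega, while kappa = kappa_2 and kappa_0 = kappa_1 on
   omega, so that
     S = s_0 + 1_omega ((rho^(1/2) - 1) s_0 + kappa_2^(-1/2) (1 - rho) sigma_h)
   and the Cauchy-Schwarz inequality gives the bound.

   For the equilibration, the divergences of the local fluxes are piecewise
   polynomials of degree at most p. Summing the local problems and using that the
   hat functions form a partition of unity, the sum D of these divergences
   satisfies (D, q) = (f, q) for every q in Q_h; thus D = f by taking q = D - f.
   The contributions of the patch boundaries vanish since the hat function is zero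
   on the part of the boundary of its patch that lies inside Omega.

   That u_0h belongs to H^1_0, the closure of the test functions, follows by
   mollifying truncations of this Lipschitz function. The sets to be neglected
   (faces of the mesh, Lipschitz boundaries, noncritical level sets) are null as
   they are locally disjoint from their translates in one direction. *)

(* The data are determined only up to null sets: a local flux agrees almost everywhere on its patch
   with a Raviart-Thomas field, [wgrad] and [wdiv] pick some representative, and the Borel
   sigma-algebra is not complete. Hence [sum_patches sigma] need not be measurable, and its
   integrals are moved to a measurable representative by an equality of integrals valid for
   arbitrary functions. Weak derivatives are obtained from classical ones by translation invariance:
   the difference quotients of a compactly supported Lipschitz function have integral zero, and
   dominated convergence passes to the limit. Applied to [v * phi] this is integration by parts,
   kinks across the faces of the mesh included. Truncation is what brings the supports inside
   [Omega]: if [v] vanishes off [Omega], the set where [|v|] is at least a positive level is compact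
   in [Omega]. The price is that the gradients must still converge where [v = 0], which is why the
   zero sets of polynomials have to be examined. *)
Require Import Defs.
From HB Require Import structures.
From mathcomp Require Import all_boot all_order all_algebra.
From mathcomp Require Import -(notations) mpoly.
From mathcomp Require Import all_classical all_reals all_analysis.
From mathcomp Require Import measurable_realfun ring lra.
Set Implicit Arguments.
Unset Strict Implicit.
Unset Printing Implicit Defensive.
Import Order.TTheory GRing.Theory Num.Theory numFieldNormedType.Exports.
Local Open Scope classical_set_scope.
Local Open Scope ring_scope.

(** * Integrals and Lebesgue measure on row vectors *)

Section integral_off_null.
Context d {T : measurableType d} {R : realType} (mu : {measure set T -> \bar R}).
Implicit Types (f g : T -> \bar R) (D N : set T).

Import HBNNSimple.

(* The integral of an arbitrary nonnegative function is the supremum of those of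
   the simple functions below it, which may be cut off on [N]. *)
Lemma ge0_le_integral_off_null N f g : measurable N -> mu N = 0%E ->
  (forall x, 0 <= f x)%E -> (forall x, 0 <= g x)%E ->
  (forall x, ~ N x -> (f x <= g x)%E) ->
  (\int[mu]_x f x <= \int[mu]_x g x)%E.
Proof.
move=> mN N0 f0 g0 fg; rewrite ge0_integralTE//.
apply: ge_ereal_sup => /= _ [h hf <-].
have mNC : measurable (~` N) by exact: measurableC.
pose k := proj_nnsfun h mNC.
have -> : sintegral mu h = sintegral mu k.
  rewrite -!integralT_nnsfun; apply: ae_eq_integral => //.
  - exact/measurable_EFinP.
  - exact/measurable_EFinP.
  exists N; split => // x /=; apply: contra_notP => nN _.
  by rewrite /k/= mindicE mem_set ?mulr1.
rewrite ge0_integralTE//; apply: ereal_sup_ubound; exists k => // x.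
rewrite /k/= mindicE; have [Nx|nN] := pselect (N x).
  by rewrite memNset/= ?mulr0//; apply/not_notP.
by rewrite mem_set//= mulr1 (le_trans (hf x))// fg.
Qed.

(** The positive and negative parts are compared separately by the previous inequality, in both
    directions, so that [f] and [g] may fail to be measurable. The reconstructed flux, known only up
    to a null set, calls for this generality. *)
Lemma integral_eq_off_null D N f g : measurable N -> mu N = 0%E ->
  (forall x, D x -> ~ N x -> f x = g x) ->
  (\int[mu]_(x in D) f x = \int[mu]_(x in D) g x)%E.
Proof.
move=> mN N0 fg; rewrite integral_mkcond [RHS]integral_mkcond.
have {}fg x : ~ N x -> (f \_ D) x = (g \_ D) x.
  by move=> Nx; rewrite /patch; case: ifPn => // /[!inE] Dx; exact: fg.
rewrite integralE [RHS]integralE.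
congr (_ - _)%E; apply/eqP; rewrite eq_le; apply/andP; split;
  apply: (ge0_le_integral_off_null mN N0) => // x /fg;
  by rewrite ?funeposE ?funenegE => ->.
Qed.

Lemma integral_eq_ae D f g : {ae mu, forall x, D x -> f x = g x} ->
  (\int[mu]_(x in D) f x = \int[mu]_(x in D) g x)%E.
Proof.
move=> [N [mN N0 sN]]; apply: (integral_eq_off_null mN N0) => x Dx Nx.
by apply: contrapT => fgx; apply/Nx/sN => /(_ Dx).
Qed.

Lemma Rintegral_eq_ae D (f g : T -> R) : {ae mu, forall x, D x -> f x = g x} ->
  \int[mu]_(x in D) f x = \int[mu]_(x in D) g x.
Proof.
move=> fg; congr fine; apply: integral_eq_ae.
by apply: filterS fg => x fg /fg ->.
Qed.

End integral_off_null.

Section lebesgue_rV_theory.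
Context {R : realType}.

Lemma ball_rVP n (x y : 'rV[R]_n) (r : R) :
  ball x r y <-> 0 < r /\ forall i, `|x ord0 i - y ord0 i| < r.
Proof.
split=> [[r0 xy]|[r0 xy]]; split=> //; first by move=> i; exact: xy.
by move=> i j; rewrite ord1; exact: xy.
Qed.

Definition cube n (c : 'rV[R]_n) (r : R) : set 'rV[R]_n :=
  [set x | forall i, `|c ord0 i - x ord0 i| < r].

Lemma measurable_coord_set n (i : 'I_n) (B : set R) : measurable B ->
  measurable [set x : 'rV[R]_n | B (x ord0 i)].
Proof.
move=> mB; rewrite -[X in measurable X]setTI.
exact: (@measurable_coord _ R n i measurableT B).
Qed.

Lemma measurable_cube n (c : 'rV[R]_n) r : measurable (cube c r).
Proof.
rewrite (_ : cube c r =
    \bigcap_(i in [set: 'I_n]) [set x | ball (c ord0 i) r (x ord0 i)]).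
  apply: fin_bigcap_measurable => // i _.
  exact: (measurable_coord_set i (measurable_ball (c ord0 i) r)).
by apply/seteqP; split=> [x cx i _|x cx i]; [exact: cx|exact: (cx i I)].
Qed.

(* A countable base of the topology. *)
Definition rcube n (k : nat) : set 'rV[R]_n :=
  if @unpickle ('rV[rat]_n * nat)%type k is Some (q, m)
  then cube (map_mx ratr q : 'rV[R]_n) m.+1%:R^-1 else set0.

Lemma measurable_rcube n k : measurable (rcube k : set 'rV[R]_n).
Proof.
by rewrite /rcube; case: unpickle => [[q m]|]//; exact: measurable_cube.
Qed.

Lemma rcubeP n (x : 'rV[R]_n) e : 0 < e ->
  exists2 k, rcube k x & rcube k `<=` ball x e.
Proof.
move=> e0; have [m me] : exists m : nat, m.+1%:R^-1 < e / 2.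
  have e20 : 0 < e / 2 by rewrite divr_gt0.
  by have [m _ Hm] := near_infty_natSinv_lt (PosNum e20); exists m; apply: Hm => /=.
have qx i : {q : rat | `|ratr q - x ord0 i| < m.+1%:R^-1}.
  have : x ord0 i < x ord0 i + m.+1%:R^-1 by rewrite ltrDl.
  move=> /rat_in_itvoo/cid[q]; rewrite in_itv/= => /andP[xq qx].
  by exists q; rewrite ger0_norm ?subr_ge0 ?(ltW xq)// ltrBlDl.
pose q : 'rV[rat]_n := \row_i sval (qx i).
exists (pickle (q, m)); rewrite /rcube pickleK.
  by move=> i; rewrite !mxE; case: (qx i).
move=> y yF; apply/ball_rVP; split => // i.
have := yF i; rewrite !mxE; case: (qx i) => r /= rx ry.
rewrite -(subrK (ratr r) (x _ _)) -addrA (le_lt_trans (ler_normD _ _))//.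
by rewrite (splitr e) ltrD// ?(lt_trans _ me)// distrC.
Qed.

Lemma open_bigcup_rcube n (U : set 'rV[R]_n) : open U ->
  U = \bigcup_(k in [set k | rcube k `<=` U]) rcube k.
Proof.
move=> oU; apply/seteqP; split=> [x Ux|x [k]]; last exact.
have /nbhs_ballP[e /= e0 xeU] : nbhs x U by exact: open_nbhs_nbhs.
by have [k kx kU] := rcubeP x e0; exists k => //; exact: subset_trans xeU.
Qed.

Lemma rV_open_measurable n (U : set 'rV[R]_n) : open U -> measurable U.
Proof.
move=> /open_bigcup_rcube ->; apply: bigcup_measurable => k _.
exact: measurable_rcube.
Qed.

Lemma rV_closed_measurable n (U : set 'rV[R]_n) : closed U -> measurable U.
Proof.
by move=> /closed_openC/rV_open_measurable/measurableC; rewrite setCK.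
Qed.

Lemma rV_open_continuous_measurable n (D : set 'rV[R]_n) (f : 'rV[R]_n -> R) :
  open D -> (forall x, D x -> {for x, continuous f}) -> measurable_fun D f.
Proof.
move=> oD cf mD; apply: (measurability _ (RGenOpens.measurableE R)) => //.
move=> _ [_ [a [b ->]] <-]; apply: rV_open_measurable.
rewrite openE => x [Dx fx]; apply: filterI; first exact: open_nbhs_nbhs.
by apply: (cf x Dx); apply: open_nbhs_nbhs; split => //; exact: interval_open.
Qed.

Lemma rV_continuous_measurable n (f : 'rV[R]_n -> R) : continuous f ->
  measurable_fun setT f.
Proof. by move=> cf; apply: rV_open_continuous_measurable => [|x _]; [exact: openT|exact: cf]. Qed.

Lemma measurable_rV_addr n (v : 'rV[R]_n) :
  measurable_fun setT (fun x : 'rV[R]_n => x + v).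
Proof.
apply: measurable_fun_rVP => i; under eq_fun do rewrite mxE.
by apply: measurable_funD => //; exact: measurable_coord.
Qed.

(** The pushforward by the translation gives each half-open interval its length, and this
    characterizes Lebesgue measure. *)
Lemma lebesgue_measure_addr (v : R) (A : set R) : measurable A ->
  lebesgue_measure ((fun x => x + v) @^-1` A) = lebesgue_measure A.
Proof.
move=> mA.
have mf : measurable_fun setT (fun x : measurableTypeR R => (x + v : measurableTypeR R)).
  exact: measurable_funD.
pose m := measure_function_pushforward__canonical__measure_function_Measure
  lebesgue_measure mf.
rewrite [RHS](@lebesgue_measure_unique R m)//.
move=> _ [[a b] _ <-]; rewrite /= /pushforward.
rewrite (_ : _ @^-1` _ = `](a - v), (b - v)]%classic); last first.
  by apply/seteqP; split => x /=; rewrite !in_itv/= ltrBlDr lerBrDr.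
by rewrite !lebesgue_measure_itv/= !lte_fin ltrBlDr subrK -!EFinB; congr (if _ then (_)%:E else _); ring.
Qed.

Local Notation mu := (@lebesgue_rV R _).

Lemma rV_cons0 n (s : R) (t : 'rV[R]_n) : rV_cons (s, t) ord0 ord0 = s.
Proof.
have -> : ord0 = lshift n (ord0 : 'I_1) by exact/val_inj.
by rewrite /rV_cons [LHS]row_mxEl mxE eqxx.
Qed.

Lemma rV_consS n (s : R) (t : 'rV[R]_n) (i : 'I_n) :
  rV_cons (s, t) ord0 (rshift 1 i) = t ord0 i.
Proof. by rewrite /rV_cons [LHS]row_mxEr. Qed.

Lemma rV_ordP n (i : 'I_n.+1) : i = ord0 \/ exists j : 'I_n, i = rshift 1 j.
Proof.
have [k ->|k ->] := split_ordP (i : 'I_(1 + n)); last by right; exists k.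
by left; apply/val_inj; rewrite /= ord1.
Qed.

(** Slicing along the first coordinate: the section at [s] of the shifted set is a shift, by the
    remaining coordinates of [v], of the section of [A] at [s + v ord0 ord0]. The induction
    hypothesis removes the inner shift, one-dimensional invariance the outer one. *)
Lemma lebesgue_rV_addr n (v : 'rV[R]_n) (A : set 'rV[R]_n) : measurable A ->
  mu ((fun x => x + v) @^-1` A) = mu A.
Proof.
elim: n => [|n IH] in v A *.
  by move=> mA; congr (lebesgue_rV 0 _); apply/seteqP; split => x /=;
    rewrite (_ : x + v = x)//; apply/rowP => -[].
move=> mA; rewrite /= /lebesgue_cons /pushforward /product_measure1.
pose v' : 'rV[R]_n := rsubmx (v : 'rV_(1 + n)).
pose phi s := mu (xsection (@rV_cons R n @^-1` A) s).
have mcA : measurable (@rV_cons R n @^-1` A).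
  by rewrite -[X in measurable X]setTI; exact: measurable_rV_cons.
pose shift (s : measurableTypeR R) : measurableTypeR R := s + v ord0 ord0.
have mshift : measurable_fun setT shift by exact: measurable_funD.
transitivity (\int[lebesgue_measure]_x (phi \o shift) x)%E.
  apply: eq_integral => s _ /=; rewrite /phi.
  rewrite -(IH v' (xsection (@rV_cons R n @^-1` A) (shift s))); last first.
    exact: measurable_xsection.
  have E t : rV_cons (s, t) + v = rV_cons (shift s, t + v').
    apply/rowP => i; rewrite mxE; have [->|[k ->]] := rV_ordP i.
      by rewrite !rV_cons0.
    by rewrite !rV_consS !mxE.
  congr (lebesgue_rV n _); apply/seteqP; split=> t; rewrite /xsection/= !inE/=;
    by rewrite E.
have mphi : measurable_fun setT phi by exact: measurable_fun_xsection.
have := @ge0_integral_pushforward _ _ _ _ R shift mshift lebesgue_measure setT phi measurableT mphi.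
rewrite preimage_setT => <-//.
apply: eq_measure_integral => B mB _; exact: lebesgue_measure_addr.
Qed.

Lemma lebesgue_rV_cube n (c : 'rV[R]_n) (r : R) : 0 < r ->
  mu (cube c r) = ((r + r) ^+ n)%:E.
Proof.
move=> r0; elim: n => [|n IH] in c *.
  rewrite /= diracE (_ : _ \in _) ?expr0//.
  by apply/mem_set => -[].
pose c' : 'rV[R]_n := rsubmx (c : 'rV_(1 + n)).
rewrite /= /lebesgue_cons /pushforward.
rewrite (_ : _ @^-1` _ = ball (c ord0 ord0) r `*` cube c' r); last first.
  apply/seteqP; split=> [[s t] /= cr|[s t] /= [sr tr] i].
    split; first by have := cr ord0; rewrite rV_cons0.
    by move=> i; have := cr (rshift 1 i); rewrite rV_consS !mxE.
  have [->|[k ->]] := rV_ordP i; first by rewrite rV_cons0.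
  by rewrite rV_consS; have := tr k; rewrite !mxE.
rewrite product_measure1E//; last exact: measurable_cube.
  rewrite /= IH lebesgue_measure_ball ?ltW//= -EFinM exprS mulr2n.
  by [].
exact: measurable_ball.
Qed.

Lemma lebesgue_rV_cube_lty n (c : 'rV[R]_n) r : (mu (cube c r) < +oo)%E.
Proof.
apply: (@le_lt_trans _ _ (mu (cube c (`|r| + 1)))); last first.
  by rewrite lebesgue_rV_cube ?ltry// ltr_wpDl.
apply: le_measure; rewrite ?inE; [exact: measurable_cube..|].
move=> x cx i; rewrite (lt_le_trans (cx i))// (le_trans (ler_norm r))//.
by rewrite lerDl.
Qed.

Lemma bounded_set_cube n (A : set 'rV[R]_n) : bounded_set A ->
  exists2 r, 0 < r & A `<=` cube 0 r.
Proof.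
move=> [M [Mr MA]]; have rM : M < `|M| + 1.
  by rewrite (le_lt_trans (ler_norm _))// ltrDl.
exists (`|M| + 1 + 1); first by rewrite ltr_wpDl.
move=> x Ax i; rewrite mxE sub0r normrN (@le_lt_trans _ _ (`|M| + 1)) ?ltrDl//.
apply: le_trans (MA _ rM x Ax); rewrite [leRHS]mx_normrE.
by apply: (le_bigmax _ (fun ij => `|x ij.1 ij.2|) (ord0, i)).
Qed.

Lemma lebesgue_rV_bounded_lty n (A : set 'rV[R]_n) : measurable A ->
  bounded_set A -> (mu A < +oo)%E.
Proof.
move=> mA /bounded_set_cube[r r0 Ar].
apply: le_lt_trans (lebesgue_rV_cube_lty (0 : 'rV[R]_n) r).
by apply: le_measure; rewrite ?inE//; exact: measurable_cube.
Qed.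

Lemma lebesgue_rV_open_gt0 n (U : set 'rV[R]_n) : open U -> U !=set0 ->
  mu U != 0%E.
Proof.
move=> oU [x Ux]; have /nbhs_ballP[e /= e0 xeU] : nbhs x U by exact: open_nbhs_nbhs.
apply/eqP => U0; have : (mu (cube x e) <= mu U)%E.
  apply: le_measure; rewrite ?inE; [exact: measurable_cube|exact: rV_open_measurable|].
  by move=> y xy; apply: xeU; apply/ball_rVP; split.
by rewrite U0 lebesgue_rV_cube// lee_fin leNgt exprn_gt0// addr_gt0.
Qed.

(** The translates of [S] by [- t k *: v], with [t k = 1/(k+1)], are pairwise disjoint, have the
    same measure and stay in one bounded cube; so [N * mu S] is bounded uniformly in [N]. *)
Lemma shiftfree_null n (S : set 'rV[R]_n) (c v : 'rV[R]_n) r : measurable S ->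
  S `<=` cube c r -> (forall y t, 0 < t -> S y -> ~ S (y + t *: v)) ->
  mu S = 0%E.
Proof.
move=> mS Sr Sv; pose t (k : nat) : R := k.+1%:R^-1.
pose F k := (fun x => x + t k *: v) @^-1` S.
have mF k : measurable (F k).
  by rewrite -[X in measurable X]setTI; exact: measurable_rV_addr.
have muF k : mu (F k) = mu S by exact: lebesgue_rV_addr.
have Fdisj j k x : t j < t k -> F j x -> ~ F k x.
  move=> jk Fj; rewrite /F/= (_ : x + _ = (x + t j *: v) + (t k - t j) *: v).
    by apply: Sv => //; rewrite subr_gt0.
  by rewrite scalerBl (addrC (t k *: v)) addrA addrK.
have tF : trivIset setT F.
  move=> j k _ _ [x [Fj Fk]]; apply/eqP; case: ltngtP => // jk.
  - by have /Fdisj/(_ Fk)/(_ Fj) : t k < t j by rewrite ltf_pV2 ?posrE// ltr_nat ltnS.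
  - by have /Fdisj/(_ Fj)/(_ Fk) : t j < t k by rewrite ltf_pV2 ?posrE// ltr_nat ltnS.
(* Since [t k <= 1], enlarging the radius by the norm of [v] is enough for every translate. *)
pose B := cube c (r + `|v|).
have FB k : F k `<=` B.
  move=> x /Sr xr i; have := xr i; rewrite !mxE => xr'.
  rewrite -(addrK (t k * v ord0 i) (x _ _)) opprB addrA addrAC.
  rewrite (le_lt_trans (ler_normD _ _))// ltr_leD// normrM gtr0_norm ?invr_gt0//.
  rewrite (@le_trans _ _ `|v ord0 i|) ?ler_piMl ?invf_le1 ?ler1n//.
  rewrite [leRHS]mx_normrE.
  by apply: (le_bigmax _ (fun ij => `|v ij.1 ij.2|) (ord0, i)).
have mB : measurable B by exact: measurable_cube.
have NS N : (N%:R%:E * mu S <= mu B)%E.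
  apply: (@le_trans _ _ (mu (\big[setU/set0]_(k < N) F k))).
    rewrite measure_bigsetU//= (eq_bigr (fun=> mu S)) => [|k _]; last exact: muF.
    elim: N => [|N IH]; first by rewrite mul0e big_ord0.
    by rewrite big_ord_recr/= -natr1 EFinD ge0_muleDl ?lee_fin// mul1e leeD2r.
  apply: le_measure; rewrite ?inE//; first exact: bigsetU_measurable.
  by elim/big_ind : _ => // X Y XB YB x [/XB|/YB].
have Boo : (mu B < +oo)%E by exact: lebesgue_rV_cube_lty.
apply/eqP; apply: contraT; rewrite -measure_gt0 => S0.
have Sfin : mu S \is a fin_num.
  rewrite ge0_fin_numE//; apply: le_lt_trans Boo.
  by rewrite -[leLHS]mul1e; exact: (NS 1).
have Bfin : mu B \is a fin_num by rewrite ge0_fin_numE.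
have {}S0 : (0%:E < mu S)%E by exact: S0.
move: NS; case: (mu S) Sfin S0 => // m _; rewrite lte_fin => m0.
case: (mu B) Bfin => // b _ /(_ (Num.truncn (b / m)).+1).
by rewrite -EFinM lee_fin leNgt -ltr_pdivrMr// truncnS_gt.
Qed.

(** Every point of [S] lies in a rational cube inside its own ball, where [shiftfree_null] applies,
    and there are countably many such cubes. The direction may change from point to point, as is
    needed for a curved boundary. *)
Lemma locally_shiftfree_null n (S : set 'rV[R]_n) : measurable S ->
  (forall x, S x -> exists r (v : 'rV[R]_n), 0 < r /\
     forall y t, 0 < t -> ball x r y -> ball x r (y + t *: v) -> S y ->
       ~ S (y + t *: v)) ->
  mu S = 0%E.
Proof.
move=> mS Sv; pose G := [set k : nat | mu (S `&` rcube k) = 0%E].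
(* Cubes on which [S] is not null are replaced by the empty set, so that the union over all indices
   is a countable union of null sets. *)
pose F k := if `[< G k >] then S `&` rcube k else set0.
have mF k : measurable (F k).
  rewrite /F; case: ifP => // _; apply: measurableI => //.
  exact: measurable_rcube.
suff SF : S `<=` \bigcup_k F k.
  have : mu.-negligible (\bigcup_k F k).
    apply: negligible_bigcup => k; exists (F k); split => //.
    by rewrite /F; case: asboolP => // _; rewrite measure0.
  by move=> /(negligibleS SF)/negligibleP; exact.
move=> x Sx; have [r [v [r0 xv]]] := Sv x Sx; have [k kx kr] := rcubeP x r0.
exists k => //; rewrite /F; case: asboolP => // -[]; rewrite /G/=.
apply: (@shiftfree_null _ _ x v r).
- by apply: measurableI => //; exact: measurable_rcube.
- by move=> y [_ /kr/ball_rVP[]].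
- move=> y t t0 [Sy ky] [Syt kyt].
  by apply: (xv y t t0 _ _ Sy Syt); exact: kr.
Qed.

(** * Open boxes as a pi-system generating the Borel sets *)

Definition box n (a b : 'rV[R]_n) : set 'rV[R]_n :=
  [set x | forall i, a ord0 i < x ord0 i < b ord0 i].

Lemma rV_coord_continuous n (i : 'I_n) : continuous (fun x : 'rV[R]_n => x ord0 i).
Proof. exact: coord_continuous. Qed.

Lemma open_box n (a b : 'rV[R]_n) : open (box a b).
Proof.
rewrite openE => x xab; rewrite /interior.
apply: (@filter_forall _ _ (fun i (y : 'rV[R]_n) => a ord0 i < y ord0 i < b ord0 i) (nbhs x)) => i.
have xi : nbhs (x ord0 i) `]a ord0 i, b ord0 i[%classic.
  by apply: open_nbhs_nbhs; split; [exact: interval_open|rewrite /= in_itv; exact: xab].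
apply: (@filterS _ (nbhs x) _ _ _ _ (@rV_coord_continuous n i x _ xi)) => y /=.
by rewrite in_itv.
Qed.

Lemma measurable_box n (a b : 'rV[R]_n) : measurable (box a b).
Proof. by apply: rV_open_measurable; exact: open_box. Qed.

Lemma boxI n (a b c e : 'rV[R]_n) : box a b `&` box c e =
  box (\row_i Num.max (a ord0 i) (c ord0 i)) (\row_i Num.min (b ord0 i) (e ord0 i)).
Proof.
apply/seteqP; split => [x [xab xce] i|x h].
  by rewrite !mxE gt_max lt_min; move: (xab i) (xce i) => /andP[-> ->] /andP[-> ->].
by split=> i; have := h i; rewrite !mxE gt_max lt_min -andbA => /and4P[? ? ? ?]; apply/andP.
Qed.

Lemma cube_box n (c : 'rV[R]_n) r :
  cube c r = box (\row_i (c ord0 i - r)) (\row_i (c ord0 i + r)).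
Proof.
apply/seteqP; split=> x xr i; have := xr i;
  by rewrite !mxE ltr_norml => /andP[? ?]; apply/andP; split; lra.
Qed.

Lemma measurable_rV_boxE n :
  @measurable _ 'rV[R]_n = <<s [set A | exists a b, A = box a b] >>.
Proof.
set G := [set A | _]; apply/seteqP; split; last first.
  apply: smallest_sub; first exact: sigma_algebra_measurable.
  by move=> _ [a [b ->]]; exact: measurable_box.
apply: smallest_sub; first exact: smallest_sigma_algebra.
move=> _ [i [B [mB ->]]].
pose T : measurableType _ := g_sigma_algebraType G.
have openG (U : set 'rV[R]_n) : open U -> <<s G >> U.
  move=> /open_bigcup_rcube ->.
  apply: (@bigcup_measurable _ T) => k _; rewrite /rcube; case: unpickle => [[q m]|].
    apply: sub_sigma_algebra; rewrite cube_box; by eexists; eexists.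
  exact: (@measurable0 _ T).
suff mf : @measurable_fun _ _ T R setT (fun x => x ord0 i).
  by have := mf measurableT B mB; rewrite setTI.
apply: (measurability _ (RGenOpens.measurableE R)).
move=> _ [_ [a [b ->]] <-]; rewrite setTI; apply: openG.
by apply: open_comp; [move=> x _; exact: rV_coord_continuous|exact: interval_open].
Qed.

(** The Borel sets over whose intersection with the box [w] has zero integral form a Dynkin system;
    it contains the boxes, which are stable under intersection and generate. Hence [w] has zero
    integral over every Borel subset of the box. *)
Lemma integral_box_eq0_ae n (a b : 'rV[R]_n) (w : 'rV[R]_n -> R) :
  mu.-integrable (box a b) (EFin \o w) ->
  (forall c e, box c e `<=` box a b -> \int[mu]_(x in box c e) (w x)%:E = 0%E)%E ->
  {ae mu, forall x, box a b x -> w x = 0}.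
Proof.
move=> iw w0; set Q := box a b.
have mQ : measurable Q by exact: measurable_box.
pose G := [set A | exists c e : 'rV[R]_n, A = box c e].
have H : forall A, <<s G >> A -> (\int[mu]_(x in Q `&` A) (w x)%:E = 0)%E.
  apply: (dynkin_induction (measurable_rV_boxE n)).
  - by move=> _ _ [c [e ->]] [c' [e' ->]]; rewrite boxI; eexists; eexists.
  - by rewrite setIT; apply: w0.
  - by move=> _ [c [e ->]]; have := w0; rewrite /Q boxI; apply; rewrite -boxI.
  - move=> A mA A0.
    have := @integral_setU _ _ _ mu (Q `&` A) (Q `&` ~` A) (EFin \o w).
    rewrite -setIUr setUv setIT A0 add0e (w0 a b)//= => ->//.
    - exact: measurableI.
    - by apply: measurableI => //; exact: measurableC.
    - exact: measurable_int iw.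
    - by apply/disj_setPS => x [[_ ?] []].
  - move=> F mF tF F0; rewrite setI_bigcupr integral_bigcup.
    + by rewrite eseries0// => k _ _; exact: F0.
    + exact: trivIset_setIl.
    + by move=> k; exact: measurableI.
    + rewrite -setI_bigcupr; apply: integrableS iw => //.
      by apply: measurableI => //; exact: bigcupT_measurable.
have : ae_eq mu Q (EFin \o w) (cst 0%E).
  apply: integral_ae_eq => // A AQ mA; rewrite integral0.
  by rewrite -(setIidr AQ); apply: H; rewrite -measurable_rV_boxE.
by apply: filterS => x /= wx Qx; have /= [] := wx Qx.
Qed.

End lebesgue_rV_theory.

(** * Smooth functions *)

Section flat_function.
Context {R : realType}.
Implicit Types (P : {poly R}) (s t : R).

(** The functions [P(1/t) exp(-1/t)], extended by 0, form a family stable under differentiation: [P]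
    becomes [X^2 (P - P')]. Smoothness of the profile [exp(-1/t)], the case [P = 1], is thus one
    induction carried out for all [P] at once. *)
Definition flat P t : R := if 0 < t then P.[t^-1] * expR (- t^-1) else 0.

(** The exponential series gives [s^(k+1) <= (k+1)! exp(s)], which bounds every monomial. The outer
    case analysis isolates the constant term, and the inner induction on the size strips the top
    coefficient. *)
Lemma poly_expRN_bounded P : exists2 C, 0 <= C &
  forall s, 0 < s -> `|P.[s] * expR (- s)| <= C.
Proof.
elim/poly_ind: P => [|P c [C C0 PC]].
  by exists 0 => // s _; rewrite horner0 mul0r normr0.
suff [D D0 PD] : exists2 D, 0 <= D & forall s, 0 < s -> `|P.[s] * s * expR (- s)| <= D.
  exists (D + `|c|); first exact: addr_ge0.
  move=> s s0; rewrite !hornerE mulrDl (le_trans (ler_normD _ _))// lerD ?PD//.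
  rewrite normrM ler_piMr// ger0_norm ?expR_ge0// -expR0 ler_expR oppr_le0.
  exact: ltW.
clear C C0 PC c; have [k kP] : exists k, (size P <= k)%N by exists (size P).
elim: k P kP => [|k IH] P; first rewrite leqn0 size_poly_eq0 => /eqP ->.
  by exists 0 => // s _; rewrite horner0 !mul0r normr0.
move=> Pk; pose Q := P - (P`_k)%:P * 'X^k.
have [C C0 QC] : exists2 C, 0 <= C & forall s, 0 < s -> `|Q.[s] * s * expR (- s)| <= C.
  apply: IH; apply/leq_sizeP => j kj; rewrite coefB coefCM coefXn.
  have [->|jk] := eqVneq j k; first by rewrite mulr1 subrr.
  rewrite mulr0 subr0; move/leq_sizeP: Pk; apply.
  by rewrite ltn_neqAle eq_sym jk.
exists (C + `|P`_k| * (k.+1)`!%:R).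
  by rewrite addr_ge0// mulr_ge0.
move=> s s0; have -> : P.[s] = Q.[s] + P`_k * s ^+ k.
  by rewrite /Q !hornerE subrK.
rewrite 2!mulrDl (le_trans (ler_normD _ _))// lerD ?QC//.
rewrite -!mulrA (mulrA (s ^+ k)) -exprSr normrM ler_wpM2l// ger0_norm; last first.
  by rewrite mulr_ge0 ?expR_ge0// exprn_ge0// ltW.
rewrite expRN ler_pdivrMr ?expR_gt0// mulrC -ler_pdivrMr ?ltr0n ?fact_gt0//.
by apply: le_trans (expR_ge1Dxn k (ltW s0)); rewrite lerDr.
Qed.

(** The bound for ['X * P] has one spare factor [1/t], which turns into linear decay at 0. *)
Lemma flat_le P : exists2 C, 0 <= C & forall t, `|flat P t| <= C * `|t|.
Proof.
have [C C0 PC] := poly_expRN_bounded ('X * P).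
exists C => // t; rewrite /flat; case: ltP => t0; last by rewrite normr0 mulr_ge0.
have := PC t^-1; rewrite invr_gt0 => /(_ t0); rewrite hornerM hornerX -mulrA normrM.
by rewrite (gtr0_norm t0) gtr0_norm ?invr_gt0// mulrC ler_pdivrMr.
Qed.

Lemma is_derive_flat P t : is_derive t 1 (flat P) (flat ('X^2 * (P - P^`())) t).
Proof.
have [t0|t0|<-] := ltgtP 0 t.
- have : is_derive t 1 (fun t => P.[t^-1] * expR (- t^-1)) (flat ('X^2 * (P - P^`())) t).
    have iV : is_derive t 1 (fun t : R => t^-1) (- t ^- 2).
      rewrite (_ : - _ = - t ^- 2 *: (1 : R)); last by rewrite /GRing.scale/= mulr1.
      by apply: (@is_deriveV _ id) => //; exact: lt0r_neq0.
    have iP := @is_derive1_comp _ (horner P) _ _ _ _ (is_derive_poly P t^-1) iV.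
    have iE := @is_derive1_comp _ expR _ _ _ _ (is_derive_expR _) (is_deriveN iV).
    apply: is_derive_eq (is_deriveM iP iE) _.
    rewrite /flat t0 !hornerE/= /GRing.scale/= -exprVn; ring.
  apply: near_eq_is_derive; near=> s; rewrite /flat.
  by rewrite ifT//; near: s; exact: lt_nbhsr.
- have : is_derive t 1 (cst 0 : R -> R) (flat ('X^2 * (P - P^`())) t).
    by rewrite /flat ltNge (ltW t0)/=; exact: is_derive_cst.
  apply: near_eq_is_derive; near=> s; rewrite /flat.
  by rewrite ifF//; apply/negbTE; rewrite -leNgt ltW//; near: s; exact: lt_nbhsl.
(* At 0 the difference quotient of [flat P] is [flat ('X * P)], whose linear decay makes the
   derivative vanish. *)
have [C C0 PC] := flat_le ('X * P).
have cv : (fun h : R => h^-1 *: (flat P (h *: 1 + 0) - flat P 0)) @ 0^' --> (0 : R).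
  have E h : h^-1 *: (flat P (h *: 1 + 0) - flat P 0) = flat ('X * P) h.
    rewrite /flat ltxx subr0 /GRing.scale/= mulr1 addr0; case: ifP => _; last by rewrite mulr0.
    by rewrite hornerM hornerX mulrA.
  under eq_fun do rewrite E.
  apply/cvgr0Pnorm_lt => e e0; near=> h.
  apply: (le_lt_trans (PC h)).
  have hC : `|h| < e / (C + 1).
    near: h; apply: dnbhs0_lt; by rewrite divr_gt0// ltr_wpDl.
  rewrite (@le_lt_trans _ _ ((C + 1) * `|h|))//; first by rewrite ler_wpM2r// lerDl.
  by rewrite mulrC -ltr_pdivlMr// ltr_wpDl.
apply: DeriveDef; first by apply/cvg_ex; exists 0.
by rewrite /flat ltxx; exact: cvg_lim.
Unshelve. all: end_near.
Qed.

End flat_function.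

Section smooth_functions.
Context {R : realType}.

Fixpoint Ck1 (k : nat) (f : R -> R) : Prop :=
  if k is l.+1 then exists2 g, (forall t : R, is_derive t 1 f (g t)) & Ck1 l g
  else continuous f.

Lemma is_derive1_continuous (f : R -> R) (g : R -> R) :
  (forall t : R, is_derive t 1 f (g t)) -> continuous f.
Proof.
by move=> fg t; apply/differentiable_continuous/derivable1_diffP; have [] := fg t.
Qed.

Lemma Ck1_flat k (P : {poly R}) : Ck1 k (flat P).
Proof.
elim: k P => [|k IH] P /=; last by exists (flat ('X^2 * (P - P^`()))) => // t; exact: is_derive_flat.
by apply: is_derive1_continuous => t; exact: is_derive_flat.
Qed.

Lemma Ck1_affine k (f : R -> R) (a b c : R) : Ck1 k f ->
  Ck1 k (fun t => c * f (a * t + b)).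
Proof.
have iA (t : R) : is_derive t 1 (fun t => a * t + b) a.
  have := is_deriveD (is_deriveZ a (is_derive_id t 1)) (is_derive_cst b t 1).
  by move/is_derive_eq; apply; rewrite addr0 /GRing.scale/= mulr1.
have cA : continuous (fun t => a * t + b) by exact: is_derive1_continuous iA.
elim: k f c => [|k IH] f c /=.
  move=> cf t; apply: (@continuousM _ _ (cst c)); first exact: cst_continuous.
  by apply: continuous_comp; [exact: cA|exact: cf].
move=> [g fg cg]; exists (fun t => (c * a) * g (a * t + b)); last exact: IH.
move=> t; have := is_deriveZ c (@is_derive1_comp _ f _ t _ _ (fg _) (iA t)).
by move/is_derive_eq; apply; rewrite /GRing.scale/=; ring.
Qed.

Context {d : nat}.
Local Notation E := 'rV[R]_d.
Local Notation e_ i := (delta_mx ord0 i : 'rV[R]_d).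
Implicit Types (f g phi : E -> R).

(** Continuity is demanded separately at each order because, in several variables, the existence of
    partial derivatives does not imply it. The partial derivatives are given as witnesses, so that
    sums and products are handled by plain induction. *)
Fixpoint Ck (k : nat) (f : E -> R) : Prop := continuous f /\
  if k is l.+1 then exists g : 'I_d -> E -> R,
    forall i, (forall x, is_derive x (e_ i) f (g i x)) /\ Ck l (g i)
  else True.

Lemma Ck_continuous k f : Ck k f -> continuous f.
Proof. by case: k => [|k] []. Qed.

Lemma CkS k f : Ck k.+1 f -> Ck k f.
Proof.
elim: k f => [|k IH] f [cf [g fg]]; split=> //.
by exists g => i; have [? /IH] := fg i.
Qed.

Lemma Ck_partial k f i : Ck k.+1 f -> Ck k (partial i f).
Proof.
move=> [cf [g /(_ i)[fg cg]]]; suff -> : partial i f = g i by [].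
by apply/funext => x; rewrite /partial; have [_ ->] := fg x.
Qed.

Lemma Ck_is_derive k f i x : Ck k.+1 f -> is_derive x (e_ i) f (partial i f x).
Proof.
by move=> [cf [g /(_ i)[fg _]]]; apply: DeriveDef => //; have [] := fg x.
Qed.

Lemma Ck_smooth f : (forall k, Ck k f) -> smooth f.
Proof.
move=> Cf s /=; have Cs : forall k, Ck k (foldr (@partial R d) f s).
  elim: s => [|i s IH] //= k; apply: Ck_partial; exact: IH.
split; first exact: Ck_continuous (Cs 0).
by move=> i x; have [] := @Ck_is_derive 0 _ i x (Cs 1).
Qed.

Lemma Ck_cst k (a : R) : Ck k (cst a).
Proof.
have ca (b : R) : continuous (cst b : E -> R) by exact: cst_continuous.
elim: k a => [|k IH] a; split=> //.
exists (fun=> cst 0) => i; split; last exact: IH.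
by move=> x; exact: is_derive_cst.
Qed.

Lemma Ck_add k f g : Ck k f -> Ck k g -> Ck k (fun x => f x + g x).
Proof.
elim: k f g => [|k IH] f g [cf Cf] [cg Cg]; split=> //; try by
  move=> x; apply: continuousD; [exact: cf|exact: cg].
case: Cf Cg => [f' Cf] [g' Cg]; exists (fun i x => f' i x + g' i x) => i.
have [if' ?] := Cf i; have [ig' ?] := Cg i.
by split; [move=> x; exact: is_deriveD|exact: IH].
Qed.

Lemma Ck_mul k f g : Ck k f -> Ck k g -> Ck k (fun x => f x * g x).
Proof.
elim: k f g => [|k IH] f g Cf Cg.
  by split=> // x; apply: continuousM; [exact: Cf.1|exact: Cg.1].
have [cf [f' Cf']] := Cf; have [cg [g' Cg']] := Cg; split.
  by move=> x; apply: continuousM; [exact: cf|exact: cg].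
exists (fun i x => f x * g' i x + g x * f' i x) => i.
have [if' ?] := Cf' i; have [ig' ?] := Cg' i; split.
  by move=> x; have := is_deriveM (if' x) (ig' x).
by apply: Ck_add; apply: IH => //; exact: CkS.
Qed.

Lemma is_derive_coord (f : R -> R) (j i : 'I_d) (x : E) (df : R) :
  is_derive (x ord0 j) 1 f df ->
  is_derive x (e_ i) (fun y : E => f (y ord0 j)) ((i == j)%:R * df).
Proof.
move=> [ef vf]; have E0 h : h^-1 *: (f ((h *: e_ i + x) ord0 j) - f (x ord0 j)) =
    if i == j then h^-1 *: (f (h *: 1 + x ord0 j) - f (x ord0 j)) else 0.
  rewrite !mxE eqxx/=; have [_|_] := eqVneq i j => //.
  by rewrite mulr0 add0r subrr scaler0.
have cv : (fun h => h^-1 *: (f ((h *: e_ i + x) ord0 j) - f (x ord0 j))) @ 0^' -->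
    (i == j)%:R * df.
  under eq_fun do rewrite E0.
  case: (i == j); last by rewrite mul0r; exact: cvg_cst.
  by rewrite mul1r -vf; exact: ef.
apply: DeriveDef; first by apply/cvg_ex; eexists; exact: cv.
exact: cvg_lim cv.
Qed.

Lemma Ck_coord k (f : R -> R) (j : 'I_d) : (forall l, Ck1 l f) ->
  Ck k (fun x : E => f (x ord0 j)).
Proof.
move=> Cf; have : Ck1 k f by []; elim: k f {Cf} => [|k IH] f Cf.
  by split=> // x; apply: continuous_comp; [exact: rV_coord_continuous|exact: Cf].
case: Cf => g fg Cg; split.
  move=> x; apply: continuous_comp; first exact: rV_coord_continuous.
  exact: is_derive1_continuous fg _.
exists (fun i x => (i == j)%:R * g (x ord0 j)) => i; split.
  by move=> x; apply: is_derive_coord.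
by apply: Ck_mul; [exact: Ck_cst|exact: IH].
Qed.

Lemma Ck_prod k (I : Type) (s : seq I) (F : I -> E -> R) :
  (forall i, Ck k (F i)) -> Ck k (fun x => \prod_(i <- s) F i x).
Proof.
move=> CF; elim: s => [|i s IH].
  by under eq_fun do rewrite big_nil; exact: Ck_cst.
by under eq_fun do rewrite big_cons; exact: Ck_mul.
Qed.

End smooth_functions.

(** * Bump functions and the fundamental lemma of the calculus of variations *)

Section Rintegral_limits.
Context d {T : measurableType d} {R : realType} (mu : {measure set T -> \bar R}).

Lemma Rintegral_dominated_cvg (D : set T) (f_ : nat -> T -> R) (f g : T -> R) :
  measurable D -> (forall n, measurable_fun D (f_ n)) -> measurable_fun D f ->
  {ae mu, forall x, D x -> f_ ^~ x @ \oo --> f x} ->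
  mu.-integrable D (EFin \o g) ->
  (forall n x, D x -> `|f_ n x| <= g x) ->
  mu.-integrable D (EFin \o f) /\
  \int[mu]_(x in D) f_ n x @[n --> \oo] --> \int[mu]_(x in D) f x.
Proof.
move=> mD mf_ mf cf ig fg.
have [|||||intf _ cv] := @dominated_convergence _ _ R mu D mD
  (fun n x => (f_ n x)%:E) (EFin \o f) (EFin \o g).
- by move=> n; exact/measurable_EFinP.
- exact/measurable_EFinP.
- by apply: filterS cf => x cx Dx; apply: cvg_EFin; [exact: nearW|exact: cx].
- exact: ig.
- by apply: aeW => x n Dx; rewrite /= lee_fin fg.
split=> //; apply: fine_cvg; rewrite /Rintegral fineK//.
exact: integrable_fin_num.
Qed.

End Rintegral_limits.

Section bumps.
Context {R : realType} {d : nat}.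
Local Notation E := 'rV[R]_d.
Local Notation mu := (@lebesgue_rV R d).

Lemma flat1_ge0 (t : R) : 0 <= flat 1 t.
Proof. by rewrite /flat; case: ifP => // _; rewrite hornerC mul1r expR_ge0. Qed.

Lemma flat1_le1 (t : R) : flat 1 t <= 1.
Proof.
rewrite /flat; case: ifP => // t0.
by rewrite hornerC mul1r -expR0 ler_expR oppr_le0 invr_ge0 ltW.
Qed.

Lemma flat1_gt0 (t : R) : (0 < flat 1 t) = (0 < t).
Proof. by rewrite /flat; case: ifP; rewrite ?ltxx// hornerC mul1r expR_gt0. Qed.

Lemma flat1_cvg1 (t : R) : 0 < t -> flat 1 (k.+1%:R * t) @[k --> \oo] --> (1 : R).
Proof.
move=> t0; have E0 k : flat 1 (k.+1%:R * t) = expR (- (t^-1 * k.+1%:R^-1)).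
  by rewrite /flat mulr_gt0// hornerC mul1r invfM mulrC.
under eq_fun do rewrite E0.
suff : expR (- (t^-1 * k.+1%:R^-1)) @[k --> \oo] --> expR (- (t^-1 * 0)).
  by rewrite mulr0 oppr0 expR0.
apply: continuous_cvg; first exact: continuous_expR.
by apply: cvgN; apply: cvgMr; exact: cvg_harmonic.
Qed.

(** Each factor tends to the indicator of an open half-line as [k] grows, so the bumps converge to
    the indicator of the open box while vanishing off it. The case [k = 0] also serves as
    mollification kernel. *)
Definition bump (k : nat) (a b x : E) : R :=
  \prod_i (flat 1 (k.+1%:R * (x ord0 i - a ord0 i)) *
           flat 1 (k.+1%:R * (b ord0 i - x ord0 i))).

Lemma Ck_bump l k a b : Ck l (bump k a b).
Proof.
apply: Ck_prod => i; apply: Ck_mul.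
  apply: (@Ck_coord _ _ l (fun t => flat 1 (k.+1%:R * (t - a ord0 i)))) => m.
  have := Ck1_affine k.+1%:R (- (k.+1%:R * a ord0 i)) 1 (Ck1_flat m 1).
  by congr Ck1; apply/funext => t; rewrite mul1r mulrBr.
apply: (@Ck_coord _ _ l (fun t => flat 1 (k.+1%:R * (b ord0 i - t)))) => m.
have := Ck1_affine (- k.+1%:R) (k.+1%:R * b ord0 i) 1 (Ck1_flat m 1).
by congr Ck1; apply/funext => t; rewrite mul1r mulrBr mulNr addrC.
Qed.

Lemma bump_ge0 k a b x : 0 <= bump k a b x.
Proof. by apply: prodr_ge0 => i _; rewrite mulr_ge0// flat1_ge0. Qed.

Lemma bump_le1 k a b x : bump k a b x <= 1.
Proof.
rewrite -[leRHS](@big1 _ 1 *%R _ (index_enum 'I_d) xpredT (fun=> 1))//.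
by apply: ler_prod => i _; rewrite mulr_ge0 ?flat1_ge0//= mulr_ile1 ?flat1_ge0 ?flat1_le1.
Qed.

Lemma bump_gt0 k a b x : box a b x -> 0 < bump k a b x.
Proof.
move=> abx; apply: prodr_gt0 => i _; move/andP: (abx i) => [? ?].
by rewrite mulr_gt0// flat1_gt0 mulr_gt0// subr_gt0.
Qed.

Lemma bump_out k a b x : ~ box a b x -> bump k a b x = 0.
Proof.
move=> /existsNP[i /negP abx]; apply/eqP/prodf_eq0; exists i => //.
rewrite mulf_eq0; move: abx; rewrite negb_and -!leNgt => /orP[] h; apply/orP; [left|right];
  by rewrite eq_le flat1_ge0 leNgt flat1_gt0 -leNgt mulr_ge0_le0// subr_le0.
Qed.

Lemma bump_cvg1 a b x : box a b x -> bump k a b x @[k --> \oo] --> (1 : R).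
Proof.
move=> abx; rewrite -[X in _ --> X](@big1 _ 1 *%R _ (index_enum 'I_d) xpredT (fun=> 1))//.
rewrite /bump; elim: (index_enum _) => [|i s IH].
  by under eq_fun do rewrite big_nil; rewrite big_nil; exact: cvg_cst.
under eq_fun do rewrite big_cons; rewrite big_cons; apply: cvgM => //.
move/andP: (abx i) => [? ?]; rewrite -[X in _ --> X](mulr1 1).
by apply: cvgM; apply: flat1_cvg1; rewrite subr_gt0.
Qed.

Definition ccube (c : E) (r : R) : set E :=
  [set x | forall i, `|c ord0 i - x ord0 i| <= r].

Lemma coord_le_norm (x : E) i : `|x ord0 i| <= `|x|.
Proof.
rewrite [leRHS]mx_normrE.
by apply: (le_bigmax _ (fun ij => `|x ij.1 ij.2|) (ord0, i)).
Qed.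

Lemma norm_le_coord (x : E) r : 0 <= r -> (forall i, `|x ord0 i| <= r) -> `|x| <= r.
Proof.
move=> r0 xr; rewrite [leLHS]mx_normrE; apply/bigmax_leP; split=> // -[i j] _.
by rewrite ord1.
Qed.

Lemma ccube_norm (c x : E) r : 0 <= r -> ccube c r x <-> `|c - x| <= r.
Proof.
move=> r0; split=> [xr|xr i].
  by apply: norm_le_coord => // i; rewrite !mxE.
by have := le_trans (coord_le_norm (c - x) i) xr; rewrite !mxE.
Qed.

Lemma closed_ccube c r : closed (ccube c r).
Proof.
rewrite (_ : ccube c r = \bigcap_(i in [set: 'I_d])
    (fun x : E => x ord0 i) @^-1` `[c ord0 i - r, c ord0 i + r]%classic).
  apply: closed_bigI => i _; apply: closed_comp; last exact: interval_closed.
  by move=> x _; exact: rV_coord_continuous.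
have E0 (x : E) i : (x ord0 i \in `[c ord0 i - r, c ord0 i + r]) =
    (`|c ord0 i - x ord0 i| <= r).
  by rewrite in_itv/= ler_norml; apply/andP/andP => -[? ?]; split; lra.
apply/seteqP; split=> [x h i _|x h i]; first by rewrite /= E0; exact: h.
by rewrite -E0; exact: h.
Qed.

Lemma compact_ccube c r : compact (ccube c r).
Proof.
apply: bounded_closed_compact; last exact: closed_ccube.
exists (`|c| + `|r|); split; first exact: num_real.
move=> M rM x xr; apply: ltW; apply: le_lt_trans rM.
rewrite -(subKr c x) (le_trans (ler_normB _ _))// lerD2l norm_le_coord// => i.
by rewrite !mxE (le_trans (xr i))// ler_norm.
Qed.

(** Countability of the rational cubes turns a local almost everywhere statement into a global
    one. *)
Lemma ae_rcube (D : set E) (P : E -> Prop) :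
  (forall x, D x -> exists2 k, rcube k x & {ae mu, forall y, rcube k y -> P y}) ->
  {ae mu, forall x, D x -> P x}.
Proof.
move=> DP; pose F k := if `[< {ae mu, forall y, rcube k y -> P y} >]
  then [set y | ~ (rcube k y -> P y)] else set0.
have : mu.-negligible (\bigcup_k F k).
  apply: negligible_bigcup => k; rewrite /F; case: asboolP => // _.
  exact: negligible_set0.
apply: negligibleS => x /= /not_implyP[Dx nPx].
have [k kx kP] := DP x Dx; exists k => //; rewrite /F; case: asboolP => // _ /=.
by move=> /(_ kx).
Qed.

Lemma test_function_intro (D K : set E) (phi : E -> R) : (forall k, Ck k phi) ->
  compact K -> K `<=` D -> (forall x, phi x != 0 -> K x) -> test_function D phi.
Proof.
move=> Cphi cK KD phiK; have KK : closure [set x | phi x != 0] `<=` K.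
  rewrite (closure_id K).1; last exact: compact_closed.
  exact: closure_subset.
split; [exact: Ck_smooth| |exact: subset_trans KD].
apply: subclosed_compact KK => //; exact: closed_closure.
Qed.

(** The bumps on a small box converge to its indicator and their products with [w] are dominated by
    [|w|], so [w] has zero integral over every box inside a suitable rational cube. Such cubes cover
    [D]. *)
Lemma fundamental_lemma (D : set E) (w : E -> R) : open D ->
  mu.-integrable D (EFin \o w) ->
  (forall phi, test_function D phi -> \int[mu]_(x in D) (w x * phi x) = 0) ->
  {ae mu, forall x, D x -> w x = 0}.
Proof.
move=> oD iw w0; have mD : measurable D by exact: rV_open_measurable.
have mw : measurable_fun D w by apply/measurable_EFinP; exact: (measurable_int mu iw).
(* The closed cube is inserted between the rational cube and [D] as a compact set outside which the
   bumps vanish. *)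
have key k x r : rcube k `<=` ccube x r -> ccube x r `<=` D ->
    {ae mu, forall y, rcube k y -> w y = 0}.
  move=> kx xD; have [->|[a [b kab]]] : rcube k = set0 :> set E \/
      exists a b : E, rcube k = box a b.
  - rewrite /rcube; case: unpickle => [[q m]|]; last by left.
    by right; rewrite cube_box; eexists; eexists.
  - exact: aeW.
  rewrite kab; apply: integral_box_eq0_ae.
    apply: integrableS iw => //; first exact: measurable_box.
    by rewrite -kab; exact: subset_trans xD.
  move=> c e ce.
  have tb l : test_function D (bump l c e).
    apply: (@test_function_intro D (ccube x r)) => //.
    - by move=> m; exact: Ck_bump.
    - exact: compact_ccube.
    - move=> y; apply: contra_neqP => /= ny; apply: bump_out.
      by move=> /ce; rewrite -kab => /kx.
  have ceD : box c e `<=` D.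
    by apply: subset_trans xD; apply: subset_trans kx; rewrite kab.
  have [|||||iwc cv] := @Rintegral_dominated_cvg _ _ R mu D
    (fun l y => w y * bump l c e y) (w \* \1_(box c e)) (fun y => `|w y|) mD.
  - move=> l; apply: measurable_funM => //.
    apply: measurable_funTS; apply: rV_continuous_measurable.
    exact: (Ck_continuous (Ck_bump 0 _ _ _)).
  - apply: measurable_funM => //; apply: measurable_funTS.
    by apply: measurable_indic; exact: measurable_box.
  - apply: aeW => y Dy; apply: cvgMr; rewrite indicE.
    have [yce|nyce] := pselect (box c e y); first by rewrite mem_set//; exact: bump_cvg1.
    rewrite memNset//; under eq_fun do rewrite bump_out//; exact: cvg_cst.
  - exact: (integrable_abse iw).
  - move=> l y Dy; rewrite normrM ler_piMr// ger0_norm ?bump_ge0 ?bump_le1//.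
  have {cv} : \int[mu]_(y in D) (w \* \1_(box c e)) y = 0.
    rewrite -(cvg_lim _ cv)//; under eq_fun do rewrite w0//.
    exact: lim_cst.
  rewrite /Rintegral => w1.
  have : (\int[mu]_(y in D) ((w \* \1_(box c e)) y)%:E)%E = 0%E.
    by rewrite -[LHS]fineK ?w1//; exact: integrable_fin_num.
  rewrite -[in X in _ -> X](setIidr ceD) integral_mkcondr => <-.
  apply: eq_integral => y _; rewrite patchE /= indicE.
  by case: ifPn; rewrite ?(mulr1, mulr0).
apply: ae_rcube => x Dx.
have /nbhs_ballP[e /= e0 xeD] : nbhs x D by exact: open_nbhs_nbhs.
have e20 : 0 < e / 2 by rewrite divr_gt0.
have [k kx ke] := rcubeP x e20; exists k => //; apply: (key k x (e / 2)).
  by move=> y /ke/ball_rVP[_ xy] i; apply: ltW.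
move=> y xy; apply: xeD; apply/ball_rVP; split=> // i; apply: (le_lt_trans (xy i)).
by rewrite ltr_pdivrMr// ltr_pMr// ltr1n.
Qed.

End bumps.

(** * Lipschitz functions *)

Section lipschitz_functions.
Context {R : realType} {d : nat}.
Local Notation E := 'rV[R]_d.
Local Notation mu := (@lebesgue_rV R d).
Local Notation e_ i := (delta_mx ord0 i : 'rV[R]_d).
Implicit Types (f g : E -> R).

Definition lip_on (F : set E) (L : R) g :=
  forall x y, F x -> F y -> `|g x - g y| <= L * `|x - y|.

Lemma ball_norm_rV (x y : E) r : ball x r y <-> `|x - y| < r.
Proof. by rewrite -ball_normE. Qed.

Lemma rV_continuous_atP f (x : E) : {for x, continuous f} <->
  forall e, 0 < e -> exists2 r, 0 < r & forall y, `|x - y| < r -> `|f x - f y| < e.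
Proof.
split=> [cf e e0|h].
  have /nbhs_ballP[r /= r0 xr] : nbhs x (f @^-1` ball (f x) e).
    by apply: cf; exact: nbhsx_ballx.
  by exists r => // y xy; apply: xr; apply/ball_norm_rV.
move=> A /nbhs_ballP[e /= e0 eA]; have [r r0 xr] := h e e0.
apply/nbhs_ballP; exists r => // y /ball_norm_rV /xr xy; exact: eA.
Qed.

Lemma rV_continuous_addr f (v : E) : continuous f -> continuous (fun x : E => f (x + v)).
Proof.
move=> cf x; apply/rV_continuous_atP => e e0.
have [r r0 xr] := (rV_continuous_atP f (x + v)).1 (cf _) e e0.
by exists r => // y xy; apply: xr; rewrite opprD addrACA subrr addr0.
Qed.

Lemma rV_continuous_subl f (v : E) : continuous f -> continuous (fun x : E => f (v - x)).
Proof.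
move=> cf x; apply/rV_continuous_atP => e e0.
have [r r0 xr] := (rV_continuous_atP f (v - x)).1 (cf _) e e0.
by exists r => // y xy; apply: xr; rewrite opprD opprK addrACA subrr add0r addrC distrC.
Qed.

Lemma lip_on_continuous L g : lip_on setT L g -> continuous g.
Proof.
move=> gL x; apply/rV_continuous_atP => e e0.
have L1 : 0 < `|L| + 1 by rewrite ltr_wpDl.
exists (e / (`|L| + 1)); first by rewrite divr_gt0.
move=> y xy; apply: (le_lt_trans (gL _ _ I I)).
apply: (@le_lt_trans _ _ ((`|L| + 1) * `|x - y|)).
  by rewrite ler_wpM2r// (le_trans (ler_norm L))// lerDl.
by rewrite mulrC -ltr_pdivlMr.
Qed.

(* On a segment, the largest time up to which the Lipschitz bound from the
   starting point holds can be increased inside a piece of the cover. *)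
Lemma lip_on_glue (J : finType) (F : J -> set E) L g : 0 <= L ->
  continuous g -> (forall j, closed (F j)) -> (forall x, exists j, F j x) ->
  (forall j, lip_on (F j) L g) -> lip_on setT L g.
Proof.
move=> L0 cg cF FT gF x y _ _; rewrite distrC (distrC x).
pose c (t : R) := x + t *: (y - x).
have cc : continuous c.
  by move=> t; apply: cvgD; [exact: cvg_cst|apply: cvgZr_tmp; exact: cvg_id].
have cgc : continuous (g \o c) by move=> t; apply: continuous_comp; [exact: cc|exact: cg].
pose A := [set t : R | 0 <= t <= 1 /\ `|g (c t) - g x| <= L * (t * `|y - x|)].
have A0 : A 0 by split; rewrite ?lexx ?ler01// /c scale0r addr0 subrr normr0 mul0r mulr0.
have supA : has_sup A.
  by split; [exists 0|exists 1 => t [/andP[]]].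
pose s := sup A.
have s0 : 0 <= s by exact: ub_le_sup supA.2 _ A0.
have s1 : s <= 1 by apply: ge_sup => [|t [/andP[]//]]; exists 0.
have As : A s.
  split; first exact/andP.
  rewrite leNgt; apply/negP => h.
  pose q t := `|g (c t) - g x| - L * (t * `|y - x|).
  have cq : {for s, continuous q}.
    apply: cvgB; last by apply: cvgMr; apply: cvgMl; exact: cvg_id.
    by apply: cvg_norm; apply: cvgB; [exact: cgc|exact: cvg_cst].
  have k : \forall t \near s, 0 < q t by apply: cvgr_gt cq _ _; rewrite subr_gt0.
  have [e /= e0 ke] := (nbhs_ballP _ _).1 k.
  have [t [t01 At] st] := sup_adherent e0 supA.
  suff : 0 < q t by rewrite subr_gt0 ltNge At.
  apply: ke; rewrite /ball/= ger0_norm ?ltrBlDr -?ltrBlDl//.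
  by rewrite subr_ge0 (ub_le_sup supA.2).
have [s1'|s1'] := ltP s 1; last first.
  have {}s1 : s = 1 by apply/eqP; rewrite eq_le s1 s1'.
  have c1 : c 1 = y by rewrite /c scale1r addrC subrK.
  by move: As => []; rewrite s1 mul1r c1.
(* The pieces are closed and finitely many, so near [s] any piece met by the segment also contains
   [c s]. A piece through a slightly later [c t] then contains both points, and its own Lipschitz
   bound extends the estimate. *)
have k : \forall t \near s, forall j, F j (c t) -> F j (c s).
  apply: (@filter_forall R J (fun j t => F j (c t) -> F j (c s)) (nbhs s)
    (nbhs_filter s)) => j.
  have [Fs|nFs] := pselect (F j (c s)); first exact: nearW.
  have : nbhs s (c @^-1` (~` F j)).
    by apply: cc; apply: open_nbhs_nbhs; split => //; exact: closed_openC.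
  by apply: filterS => t.
have [e /= e0 ke] := (nbhs_ballP _ _).1 k.
pose t := Num.min 1 (s + e / 2).
have st : s < t by rewrite lt_min s1' ltrDl divr_gt0.
have [j Fjt] := FT (c t).
have Fjs : F j (c s).
  apply: ke Fjt; rewrite /ball/= distrC gtr0_norm ?subr_gt0// ltrBlDl.
  by rewrite gt_min ltrD2l ltr_pdivrMr// ltr_pMr// ltr1n orbT.
have : A t.
  split; first by rewrite (le_trans s0 (ltW st)) ge_min lexx.
  rewrite -(subrK (g (c s)) (g (c t))) -addrA (le_trans (ler_normD _ _))//.
  rewrite -{2}(subrK s t) mulrDl mulrDr lerD//; last exact: As.2.
  apply: (le_trans (gF j _ _ Fjt Fjs)).
  rewrite /c opprD addrACA subrr add0r -scalerBl normrZ gtr0_norm ?subr_gt0//.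
by move=> /(ub_le_sup supA.2); rewrite leNgt st.
Qed.

Lemma is_derive_line f i z (df : E -> R) (t : R) :
  is_derive (z + t *: e_ i) (e_ i) f (df (z + t *: e_ i)) ->
  is_derive t 1 (fun t => f (z + t *: e_ i)) (df (z + t *: e_ i)).
Proof.
move=> [ef vf].
have cv : (fun h : R => h^-1 *: (f (z + (h *: 1 + t) *: e_ i) - f (z + t *: e_ i))) @ 0^' -->
    df (z + t *: e_ i).
  have -> : (fun h : R => h^-1 *: (f (z + (h *: 1 + t) *: e_ i) - f (z + t *: e_ i))) =
      (fun h : R => h^-1 *: (f (h *: e_ i + (z + t *: e_ i)) - f (z + t *: e_ i))).
    apply/funext => h; have -> : h *: (1 : R) = h by rewrite /GRing.scale/= mulr1.
    by rewrite scalerDl addrCA.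
  by rewrite -vf; exact: ef.
apply: DeriveDef; first by apply/cvg_ex; eexists; exact: cv.
exact: cvg_lim cv.
Qed.

(** The mean value theorem is applied on [[0, 1]] to the rescaled line, so that [h] may have any
    sign or be zero. *)
Lemma line_MVT f i z (h : R) (df : E -> R) :
  (forall x, is_derive x (e_ i) f (df x)) ->
  exists2 s, 0 <= s <= 1 & f (z + h *: e_ i) - f z = h * df (z + (s * h) *: e_ i).
Proof.
move=> fdf; pose g (t : R) := f (z + t *: (h *: e_ i)).
have ig (t : R) : is_derive t 1 g (h * df (z + (t * h) *: e_ i)).
  have := @is_derive_line f i z df (t * h) (fdf _).
  have iA : is_derive t 1 (fun t : R => t * h) h.
    have := is_deriveZ h (is_derive_id t 1).
    rewrite /GRing.scale/= mulr1 => H; move: H; congr is_derive.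
    by apply/funext => ?; rewrite mulrC.
  move=> /(fun H => @is_derive1_comp _ _ _ _ _ _ H iA); rewrite mulrC.
  by congr is_derive; apply/funext => r; rewrite /g/= scalerA.
have [s /[!in_itv]/= /andP[s0 s1] Es] := @MVT _ g (fun t => h * df (z + (t * h) *: e_ i)) 0 1 ltr01
  (fun x _ => ig x) (continuous_subspaceT (is_derive1_continuous ig)).
exists s; first by rewrite !ltW.
by move: Es; rewrite subr0 mulr1 /g scale1r scale0r addr0.
Qed.

(* Going from [x] to [y] one coordinate at a time. *)
Definition mixed (x y : E) (k : nat) : E :=
  \row_j (if (j < k)%N then y ord0 j else x ord0 j).

(** Each of the [d] coordinate steps stays in the cube and costs at most [M] times the distance in
    the maximum norm, whence the factor [d]. *)
Lemma lip_on_partial f (df : 'I_d -> E -> R) r M : 0 <= M ->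
  (forall i x, is_derive x (e_ i) f (df i x)) ->
  (forall i x, ccube 0 r x -> `|df i x| <= M) ->
  lip_on (ccube 0 r) (d%:R * M) f.
Proof.
move=> M0 fdf dfM x y xr yr.
suff H k : (k <= d)%N -> `|f x - f (mixed x y k)| <= k%:R * M * `|x - y|.
  have := H d (leqnn d); rewrite (_ : mixed x y d = y)//.
  by apply/rowP => j; rewrite mxE ltn_ord.
elim: k => [_|k IH kd].
  rewrite (_ : mixed x y 0 = x) ?subrr ?normr0 ?mulr_ge0//.
  by apply/rowP => j; rewrite mxE.
rewrite -(subrKA (f (mixed x y k))) (le_trans (ler_normD _ _))//.
rewrite -natr1 mulrDl mul1r mulrDl lerD ?IH ?(ltnW kd)//.
pose i := Ordinal kd; pose h := y ord0 i - x ord0 i.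
have E1 s : mixed x y k + (s * h) *: e_ i =
    \row_j (if (j == i) then x ord0 i + s * h else mixed x y k ord0 j).
  apply/rowP => j; rewrite !mxE eqxx/=; have [->|ji] := eqVneq j i.
    by rewrite /= ltnn mulr1.
  by rewrite mulr0 addr0.
have E2 : mixed x y k.+1 = mixed x y k + h *: e_ i.
  rewrite -[h in RHS]mul1r E1; apply/rowP => j; rewrite !mxE ltnS.
  have [->|ji] := eqVneq j i; first by rewrite leqnn mul1r subrKC.
  by rewrite leq_eqVlt (_ : (j == k :> nat) = false)//; apply: contra_neqF ji => /eqP jk; exact/val_inj.
have [s /andP[s0 s1] Es] := @line_MVT f i (mixed x y k) h (df i) (fdf i).
rewrite E2 -normrN opprB Es normrM mulrC ler_pM//.
  apply: dfM => j; rewrite E1 !mxE sub0r normrN.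
  have xj := xr j; have yj := yr j.
  rewrite !mxE !sub0r !normrN in xj yj.
  case: eqP => [_|_]; last by case: ifP.
  have -> : x ord0 i + s * h = (1 - s) * x ord0 i + s * y ord0 i by rewrite /h; ring.
  rewrite (le_trans (ler_normD _ _))// !normrM (ger0_norm s0) ger0_norm ?subr_ge0//.
  have xi := xr i; have yi := yr i.
  rewrite !mxE !sub0r !normrN in xi yi.
  have -> : r = (1 - s) * r + s * r by ring.
  by rewrite lerD// ler_wpM2l// subr_ge0.
by rewrite distrC; have := coord_le_norm (x - y) i; rewrite !mxE.
Qed.

Lemma continuous_bounded_ccube f c r : continuous f ->
  exists2 M, 0 <= M & forall x, ccube c r x -> `|f x| <= M.
Proof.
move=> cf; have : bounded_set (f @` ccube c r).
  apply: (@compact_bounded _ R^o); apply: continuous_compact; last exact: compact_ccube.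
  exact: continuous_subspaceT.
move=> [M [Mr MA]]; exists (`|M| + 1); first by rewrite ler_wpDl.
by move=> x xr; apply: (MA (`|M| + 1)); [rewrite (le_lt_trans (ler_norm _))// ltrDl|exists x].
Qed.

Lemma measurable_ccube (c : E) r : measurable (ccube c r).
Proof. by apply: rV_closed_measurable; exact: closed_ccube. Qed.

Lemma ccube_cube (c : E) r s : r < s -> ccube c r `<=` cube c s.
Proof. by move=> rs x xr i; exact: le_lt_trans (xr i) rs. Qed.

Lemma lebesgue_rV_ccube_lty (c : E) r : (mu (ccube c r) < +oo)%E.
Proof.
apply: le_lt_trans (lebesgue_rV_cube_lty c (r + 1)).
by apply: le_measure; rewrite ?inE; [exact: measurable_ccube|exact: measurable_cube|
  apply: ccube_cube; rewrite ltrDl].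
Qed.

Lemma bounded_support_integrable f M r : measurable_fun setT f ->
  (forall x, ccube 0 r x -> `|f x| <= M) -> (forall x, ~ ccube 0 r x -> f x = 0) ->
  mu.-integrable setT (EFin \o f).
Proof.
move=> mf fM f0; have mK := measurable_ccube 0 r.
have : mu.-integrable (ccube 0 r) (EFin \o f).
  apply: measurable_bounded_integrable => //; first exact: lebesgue_rV_ccube_lty.
    exact: measurable_funTS.
  exists M; split; first exact: num_real.
  by move=> x Mx y /fM yM /=; exact: le_trans yM (ltW Mx).
rewrite integrable_mkcond//; congr integrable; apply/funext => x; rewrite patchE.
by case: ifPn => //= /negP nx; rewrite f0// => /mem_set.
Qed.

Lemma Rintegral_addr (g : E -> R) (v : E) : measurable_fun setT g ->
  \int[mu]_x g (x + v) = \int[mu]_x g x.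
Proof.
move=> mg; congr fine; rewrite integralE [RHS]integralE.
have mv := @measurable_rV_addr R d v.
have H (h : E -> \bar R) : measurable_fun setT h -> (forall x, 0 <= h x)%E ->
    (\int[mu]_x h (x + v)%R = \int[mu]_x h x)%E.
  move=> mh h0; have := @ge0_integral_pushforward _ _ _ _ R _ mv mu setT h measurableT mh.
  rewrite preimage_setT => <-//; apply: eq_measure_integral => A mA _.
  by rewrite /= /pushforward lebesgue_rV_addr.
congr (_ - _)%E.
  have /H <-// : measurable_fun setT (fun x => (g x)%:E)^\+%E.
    by apply: measurable_funepos; exact/measurable_EFinP.
  by apply: eq_integral => x _; rewrite !funeposE.
have /H <-// : measurable_fun setT (fun x => (g x)%:E)^\-%E.
  by apply: measurable_funeneg; exact/measurable_EFinP.
by apply: eq_integral => x _; rewrite !funenegE.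
Qed.

(** The steps run through [1/(n+1)] because dominated convergence deals with sequences. *)
Definition dquot (i : 'I_d) (g : E -> R) (n : nat) (x : E) : R :=
  n.+1%:R * (g (x + n.+1%:R^-1 *: e_ i) - g x).

Lemma dquot_cvg i g x (l : R) : is_derive x (e_ i) g l ->
  dquot i g n x @[n --> \oo] --> l.
Proof.
move=> [eg <-]; have hn : (fun n : nat => n.+1%:R^-1 : R) @ \oo --> 0^'.
  move=> A [e /= e0 eA]; have [m _ me] := near_infty_natSinv_lt (PosNum e0).
  exists m => // n mn; apply: eA; last by rewrite /= gt_eqF// invr_gt0.
  by rewrite /= sub0r normrN gtr0_norm ?invr_gt0//; exact: me.
have := cvg_comp _ _ hn eg; rewrite /comp => H.
rewrite (_ : (fun n => _) = (fun n : nat => (n.+1%:R^-1 : R)^-1 *: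
   (g (n.+1%:R^-1 *: e_ i + x) - g x)))//.
by apply: funext => n; rewrite /dquot invrK (addrC x).
Qed.

Lemma norm_scale_delta (h : R) i : `|h *: e_ i| <= `|h|.
Proof.
apply: norm_le_coord => // j; rewrite !mxE normrM ler_piMr// eqxx/=.
by case: eqP; rewrite ?normr1 ?normr0.
Qed.

(** Translation invariance makes the integral of each difference quotient vanish; the quotients are
    bounded by [L] and vanish off one cube, so dominated convergence carries this over to [dg]. The
    integrations by parts below rest on this. *)
Lemma lip_integral_derive (g dg : E -> R) i L r : 0 <= L -> lip_on setT L g ->
  (forall x, ~ ccube 0 r x -> g x = 0) -> measurable_fun setT dg ->
  {ae mu, forall x, dquot i g n x @[n --> \oo] --> dg x} ->
  mu.-integrable setT (EFin \o dg) /\ \int[mu]_x dg x = 0.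
Proof.
move=> L0 gL gr mdg gdg; have cg := lip_on_continuous gL.
have mg : measurable_fun setT g by exact: rV_continuous_measurable.
pose v n : E := n.+1%:R^-1 *: e_ i.
have vi n j : `|v n ord0 j| <= 1.
  apply: (le_trans (coord_le_norm _ _)); apply: (le_trans (norm_scale_delta _ _)).
  by rewrite gtr0_norm ?invr_gt0// invf_le1// ler1n.
have mgs n : measurable_fun setT (fun x : E => g (x + v n)).
  by apply: measurableT_comp => //; exact: measurable_rV_addr.
have mq n : measurable_fun setT (dquot i g n).
  by apply: measurable_funM => //; apply: measurable_funB; [exact: mgs|exact: mg].
(* The steps are at most 1, so a margin of 1 is enough for all the quotients. *)
pose K := ccube (0 : E) (r + 1).
have out x : ~ K x -> ~ ccube 0 r x.
  by apply: contra_not => xr j; rewrite (le_trans (xr j))// lerDl.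
have outv n x : ~ K x -> ~ ccube 0 r (x + v n).
  apply: contra_not => xr j; have := xr j; rewrite !mxE !sub0r !normrN => xj.
  rewrite -(addrK (v n ord0 j) (x ord0 j)) (le_trans (ler_normB _ _))// lerD//.
  by rewrite !mxE.
have mK : measurable K by exact: measurable_ccube.
have [|||int cv] := @Rintegral_dominated_cvg _ _ R mu setT (dquot i g) dg
    (fun x => L * \1_K x) measurableT mq mdg.
- by apply: filterS gdg => x.
- apply: (@bounded_support_integrable _ L (r + 1)).
  + by apply: measurable_funM => //; exact: measurable_indic.
  + move=> x xK; rewrite indicE; case: (_ \in _); rewrite ?mulr1 ?mulr0 ?normr0//.
    by rewrite ger0_norm.
  + by move=> x xK; rewrite indicE memNset ?mulr0.
- move=> n x _; rewrite indicE; have [xK|nxK] := pselect (K x); last first.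
    by rewrite /dquot gr ?gr//; [rewrite subrr mulr0 normr0 mulr_ge0|exact: out|exact: outv].
  rewrite mem_set// mulr1 normrM gtr0_norm// mulrC -ler_pdivlMr//.
  apply: (le_trans (gL _ _ I I)); rewrite ler_wpM2l// addrC addKr.
  by apply: (le_trans (norm_scale_delta _ _)); rewrite gtr0_norm ?invr_gt0.
split=> //; rewrite -(cvg_lim _ cv)//.
have [M M0 gM] := continuous_bounded_ccube 0 (r + 1) cg.
have ig : mu.-integrable setT (EFin \o g).
  by apply: (@bounded_support_integrable _ M (r + 1)) => // x /out /gr.
have igs n : mu.-integrable setT (EFin \o (fun x : E => g (x + v n))).
  apply: (@bounded_support_integrable _ (L + M) (r + 1)) => // x.
    move=> xK; rewrite -(subrK (g x) (g _)) (le_trans (ler_normD _ _))// lerD ?gM//.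
    rewrite (le_trans (gL _ _ I I))// ler_piMr// addrC addKr.
    exact: norm_le_coord.
  by move=> /outv /gr.
rewrite (_ : (fun n => _) = cst 0); first exact: lim_cst.
apply/funext => n /=; rewrite /dquot RintegralZl//; last first.
  by have := integrableB measurableT (igs n) ig.
have := RintegralB measurableT (igs n) ig; rewrite Rintegral_addr// subrr /v => ->.
by rewrite mulr0.
Qed.

End lipschitz_functions.

(** * Square integrable functions and weak derivatives *)

Section square_integrable.
Context {R : realType} {d : nat}.
Local Notation E := 'rV[R]_d.
Local Notation mu := (@lebesgue_rV R d).
Implicit Types (D : set E) (f g h : E -> R) (v w : E -> E).

Lemma L2_mul_integrable D f g : measurable D -> L2 D f -> L2 D g ->
  mu.-integrable D (EFin \o (fun x => f x * g x)).
Proof.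
move=> mD [mf f2] [mg g2]; apply: le_integrable (integrableD mD f2 g2) => //.
  by apply/measurable_EFinP; exact: measurable_funM.
move=> x _ /=; rewrite lee_fin normrM [leRHS]ger0_norm ?addr_ge0 ?sqr_ge0//.
rewrite -(real_normK (num_real (f x))) -(real_normK (num_real (g x))).
have := sqr_ge0 (`|f x| - `|g x|); have := normr_ge0 (f x); have := normr_ge0 (g x); nra.
Qed.

Lemma L2_sub D D' f : measurable D -> measurable D' -> D' `<=` D -> L2 D f -> L2 D' f.
Proof.
by move=> mD mD' DD [mf f2]; split; [exact: measurable_funS mf|exact: integrableS f2].
Qed.

Lemma L2_eq D f g : measurable D -> (forall x, D x -> f x = g x) -> L2 D f -> L2 D g.
Proof.
move=> mD fg [mf f2]; split.
  by apply: eq_measurable_fun mf => x /[!inE] Dx; rewrite fg.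
by apply: eq_integrable f2 => // x /[!inE] Dx; rewrite fg.
Qed.

Lemma L2D D f g : measurable D -> L2 D f -> L2 D g -> L2 D (fun x => f x + g x).
Proof.
move=> mD Lf Lg; have ifg := L2_mul_integrable mD Lf Lg.
move: Lf Lg => [mf f2] [mg g2]; split; first exact: measurable_funD.
have := integrableD mD (integrableD mD f2 g2) (integrableD mD ifg ifg).
by apply: eq_integrable => // x _ /=; rewrite -!EFinD; congr (_%:E); ring.
Qed.

Lemma L2_mulb D f h M : measurable D -> measurable_fun D h ->
  (forall x, D x -> `|h x| <= M) -> L2 D f -> L2 D (fun x => h x * f x).
Proof.
move=> mD mh hM [mf f2]; have mhf := measurable_funM mh mf; split=> //.
apply: le_integrable (integrableZl mD (M ^+ 2) f2) => //.
  by apply/measurable_EFinP; apply: measurable_funX.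
move=> x Dx /=; have hM2 : h x ^+ 2 <= M ^+ 2.
  rewrite -(real_normK (num_real (h x))).
  by rewrite ler_pXn2r ?nnegrE ?hM// (le_trans _ (hM x Dx)).
rewrite lee_fin exprMn 2?ger0_norm; first by rewrite ler_wpM2r// sqr_ge0.
  by apply: mulr_ge0; exact: sqr_ge0.
by apply: mulr_ge0; exact: sqr_ge0.
Qed.

Lemma L2Z D f a : measurable D -> L2 D f -> L2 D (fun x => a * f x).
Proof. by move=> mD; apply: (@L2_mulb D f (cst a) `|a|) => // x _. Qed.

Lemma L2N D f : measurable D -> L2 D f -> L2 D (fun x => - f x).
Proof. by move=> mD /(L2Z (-1) mD); apply: L2_eq => // x _; rewrite mulN1r. Qed.

Lemma L2B D f g : measurable D -> L2 D f -> L2 D g -> L2 D (fun x => f x - g x).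
Proof. by move=> mD Lf /(L2N mD); exact: L2D. Qed.

Lemma L2_bounded D f M : measurable D -> (mu D < +oo)%E -> measurable_fun D f ->
  (forall x, D x -> `|f x| <= M) -> L2 D f.
Proof.
move=> mD Doo mf fM; split=> //.
apply: measurable_bounded_integrable => //; first exact: measurable_funX.
exists (M ^+ 2); split; first exact: num_real.
move=> x Mx y Dy /=; apply: le_trans (ltW Mx); rewrite normrX.
by rewrite ler_pXn2r ?nnegrE ?fM// (le_trans _ (fM y Dy)).
Qed.

Lemma L2_cst D (a : R) : measurable D -> (mu D < +oo)%E -> L2 D (cst a).
Proof. by move=> mD Doo; apply: (@L2_bounded _ _ `|a|). Qed.

Lemma L2_integrable D f : measurable D -> (mu D < +oo)%E -> L2 D f ->
  mu.-integrable D (EFin \o f).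
Proof.
move=> mD Doo Lf; have := L2_mul_integrable mD Lf (L2_cst 1 mD Doo).
by apply: eq_integrable => // x _ /=; rewrite mulr1.
Qed.

Lemma L2_sum D (I : Type) (s : seq I) (F : I -> E -> R) : measurable D ->
  (forall i, L2 D (F i)) -> L2 D (fun x => \sum_(i <- s) F i x).
Proof.
move=> mD LF; elim: s => [|i s IH].
  apply: (@L2_eq _ (cst 0)) => // [x _|]; first by rewrite big_nil.
  split=> //; apply: eq_integrable (integrable0 mu D) => // x _ /=.
  by rewrite expr0n.
by apply: L2_eq (L2D mD (LF i) IH) => // x _; rewrite big_cons.
Qed.

Lemma L2_restrict D D' f : measurable D -> measurable D' ->
  L2 (D `&` D') f -> L2 D (f \_ D').
Proof.
move=> mD mD' [mf f2]; split.
  exact/(measurable_restrict _ mD' mD).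
apply/(integrable_mkcond _ mD).
move/(integrable_mkcond _ (measurableI _ _ mD mD')): f2.
congr integrable; apply/funext => x; rewrite !patchE in_setI.
by do 2 case: (_ \in _); rewrite //= expr0n.
Qed.

Lemma innerDl D f g h : measurable D -> L2 D f -> L2 D g -> L2 D h ->
  inner D (fun x => f x + g x) h = inner D f h + inner D g h.
Proof.
move=> mD Lf Lg Lh; rewrite /inner -RintegralD//; try exact: L2_mul_integrable.
by apply: eq_Rintegral => x _; rewrite mulrDl.
Qed.

Lemma innerZl D f h a : measurable D -> L2 D f -> L2 D h ->
  inner D (fun x => a * f x) h = a * inner D f h.
Proof.
move=> mD Lf Lh; rewrite /inner -RintegralZl//; last exact: L2_mul_integrable.
by apply: eq_Rintegral => x _; rewrite mulrA.
Qed.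

Lemma innerC D f g : inner D f g = inner D g f.
Proof. by apply: eq_Rintegral => x _; rewrite mulrC. Qed.

Lemma dotpC (x y : E) : dotp x y = dotp y x.
Proof. by apply: eq_bigr => i _; rewrite mulrC. Qed.

Lemma dotpDl (x y z : E) : dotp (x + y) z = dotp x z + dotp y z.
Proof. by rewrite /dotp -big_split/=; apply: eq_bigr => i _; rewrite mxE mulrDl. Qed.

Lemma dotpZl a (x z : E) : dotp (a *: x) z = a * dotp x z.
Proof. by rewrite /dotp mulr_sumr; apply: eq_bigr => i _; rewrite mxE mulrA. Qed.

Lemma dotp_ge0 (x : E) : 0 <= dotp x x.
Proof. by apply: sumr_ge0 => i _; rewrite -expr2 sqr_ge0. Qed.

Lemma innervC D v w : innerv D v w = innerv D w v.
Proof. by apply: eq_Rintegral => x _; rewrite dotpC. Qed.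

Lemma innerv_ge0 D v : 0 <= innerv D v v.
Proof. by apply: Rintegral_ge0 => x _; exact: dotp_ge0. Qed.

Lemma dotp_integrable D v w : measurable D -> L2v D v -> L2v D w ->
  mu.-integrable D (EFin \o (fun x => dotp (v x) (w x))).
Proof.
move=> mD Lv Lw; rewrite /dotp; elim: (index_enum _) => [|i s IH].
  by apply: eq_integrable (integrable0 mu D) => // x _; rewrite /= big_nil.
apply: eq_integrable (integrableD mD (L2_mul_integrable mD (Lv i) (Lw i)) IH) => //.
by move=> x _; rewrite /= big_cons EFinD.
Qed.

Lemma innervE D v w : measurable D -> L2v D v -> L2v D w ->
  innerv D v w = \sum_i inner D (fun x => v x ord0 i) (fun x => w x ord0 i).
Proof.
move=> mD Lv Lw; rewrite /innerv /dotp /inner.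
have H i : mu.-integrable D (EFin \o (fun x => v x ord0 i * w x ord0 i)).
  exact: L2_mul_integrable.
suff [] : mu.-integrable D
      (EFin \o (fun x => \sum_i v x ord0 i * w x ord0 i)) /\
    \int[mu]_(x in D) (\sum_i v x ord0 i * w x ord0 i) =
    \sum_i \int[mu]_(x in D) (v x ord0 i * w x ord0 i) by [].
elim: (index_enum _) => [|i s [IH1 IH2]].
  rewrite big_nil; split.
    by apply: eq_integrable (integrable0 mu D) => // x _; rewrite /= big_nil.
  by under eq_Rintegral do rewrite big_nil; rewrite Rintegral_cst// mul0r.
rewrite big_cons -IH2 -RintegralD//; split; last first.
  by apply: eq_Rintegral => x _; rewrite big_cons.
apply: eq_integrable (integrableD mD (H i) IH1) => // x _.
by rewrite /= big_cons EFinD.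
Qed.

Lemma L2vD D v w : measurable D -> L2v D v -> L2v D w -> L2v D (fun x => v x + w x).
Proof.
by move=> mD Lv Lw i; apply: L2_eq (L2D mD (Lv i) (Lw i)) => // x _; rewrite mxE.
Qed.

Lemma L2vZ D v a : measurable D -> L2v D v -> L2v D (fun x => a *: v x).
Proof.
by move=> mD Lv i; apply: L2_eq (L2Z a mD (Lv i)) => // x _; rewrite mxE.
Qed.

Lemma L2v_mulb D h v M : measurable D -> measurable_fun D h ->
  (forall x, D x -> `|h x| <= M) -> L2v D v -> L2v D (fun x => h x *: v x).
Proof.
move=> mD mh hM Lv i; apply: L2_eq (L2_mulb mD mh hM (Lv i)) => // x _.
by rewrite mxE.
Qed.

Lemma L2v_sub D D' v : measurable D -> measurable D' -> D' `<=` D -> L2v D v -> L2v D' v.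
Proof. by move=> mD mD' DD Lv i; exact: L2_sub (Lv i). Qed.

Lemma innervDl D u v w : measurable D -> L2v D u -> L2v D v -> L2v D w ->
  innerv D (fun x => u x + v x) w = innerv D u w + innerv D v w.
Proof.
move=> mD Lu Lv Lw; rewrite /innerv -RintegralD//; try exact: dotp_integrable.
by apply: eq_Rintegral => x _; rewrite dotpDl.
Qed.

Lemma innervZl D v w a : measurable D -> L2v D v -> L2v D w ->
  innerv D (fun x => a *: v x) w = a * innerv D v w.
Proof.
move=> mD Lv Lw; rewrite /innerv -RintegralZl//; last exact: dotp_integrable.
by apply: eq_Rintegral => x _; rewrite dotpZl.
Qed.

Lemma sqr_normv D v : normv D v ^+ 2 = innerv D v v.
Proof. by rewrite sqr_sqrtr// innerv_ge0. Qed.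

Lemma normv_ge0 D v : 0 <= normv D v.
Proof. exact: sqrtr_ge0. Qed.

Lemma cauchy_schwarz_innerv D v w : measurable D -> L2v D v -> L2v D w ->
  `|innerv D v w| <= normv D v * normv D w.
Proof.
move=> mD Lv Lw; set a := innerv D v v; set b := innerv D w w; set c := innerv D v w.
have H (s t : R) : 0 <= s ^+ 2 * a + 2 * s * t * c + t ^+ 2 * b.
  have := innerv_ge0 D (fun x => s *: v x + t *: w x).
  have Lsv := L2vZ s mD Lv; have Ltw := L2vZ t mD Lw.
  rewrite innervDl//; last exact: L2vD.
  rewrite !innervZl//; try exact: L2vD.
  rewrite (innervC D v) (innervC D w) !innervDl// !innervZl// (innervC D w v) -/a -/b -/c.
  by congr (0 <= _); ring.
have a0 : 0 <= a by exact: innerv_ge0.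
have b0 : 0 <= b by exact: innerv_ge0.
have cab : c ^+ 2 <= a * b.
  have [b1|b1] := leP b 0.
    have b2 : b = 0 by apply/eqP; rewrite eq_le b1.
    (* With [b = 0], the pair [c], [-(a + 1)] gives [- c^2 (a + 2) >= 0], hence [c = 0]. *)
    have := H 1 (- c); have := H c (- (a + 1)); rewrite b2; nra.
  have := H b (- c).
  have -> : b ^+ 2 * a + 2 * b * - c * c + (- c) ^+ 2 * b = b * (a * b - c ^+ 2) by ring.
  by rewrite pmulr_rge0// subr_ge0.
rewrite /normv -/a -/b -sqrtrM// -sqrtr_sqr ler_sqrt//.
by rewrite mulr_ge0.
Qed.

End square_integrable.

(** * Test functions, and uniqueness and existence of weak derivatives *)

Section test_functions.
Context {R : realType} {d : nat}.
Local Notation E := 'rV[R]_d.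
Local Notation mu := (@lebesgue_rV R d).
Local Notation e_ i := (delta_mx ord0 i : 'rV[R]_d).
Implicit Types (D : set E) (f g phi v : E -> R) (w : E -> E).

Lemma smooth_continuous phi : smooth phi -> continuous phi.
Proof. by move=> /(_ [::])[]. Qed.

Lemma smooth_partial_continuous phi i : smooth phi -> continuous (partial i phi).
Proof. by move=> /(_ [:: i])[]. Qed.

Lemma smooth_is_derive phi i (x : E) : smooth phi ->
  is_derive x (e_ i) phi (partial i phi x).
Proof. by move=> /(_ [::])[_ dphi]; apply: DeriveDef => //; exact: dphi. Qed.

Lemma is_derive_locally0 v i (x : E) : (\forall y \near x, v y = 0) ->
  is_derive x (e_ i) v 0.
Proof.
move=> v0; apply: (@near_eq_is_derive _ _ _ (cst 0) v _ _ _ _ (is_derive_cst (0 : R) x (e_ i))).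
by apply: filterS v0 => y ->.
Qed.

Lemma test_near0 D phi x : test_function D phi ->
  ~ closure [set x | phi x != 0] x -> \forall y \near x, phi y = 0.
Proof.
move=> _ nx; have : nbhs x (~` closure [set x | phi x != 0]).
  by apply: open_nbhs_nbhs; split=> //; exact/closed_openC/closed_closure.
apply: filterS => y ny; apply: contrapT => /eqP py; apply: ny.
exact: subset_closure.
Qed.

Lemma test_out D phi x : test_function D phi -> ~ D x ->
  phi x = 0 /\ forall i, partial i phi x = 0.
Proof.
move=> tphi nDx; have nx : ~ closure [set x | phi x != 0] x.
  by apply: contra_not nDx; case: tphi => _ _; exact.
have ph0 := test_near0 tphi nx; split; first exact: nbhs_singleton ph0.
by move=> i; have [] := is_derive_locally0 i ph0.
Qed.

Lemma test_support D phi : test_function D phi ->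
  exists r, forall x, ~ ccube 0 r x -> phi x = 0 /\ forall i, partial i phi x = 0.
Proof.
move=> tphi; have [_ cs _] := tphi; have [r r0 sr] := bounded_set_cube (compact_bounded cs).
exists r => x nx; have nsx : ~ closure [set x | phi x != 0] x.
  by apply: contra_not nx => /sr xr i; apply: ltW; exact: xr.
have ph0 := test_near0 tphi nsx; split; first exact: nbhs_singleton ph0.
by move=> i; have [] := is_derive_locally0 i ph0.
Qed.

Lemma test_bounded D phi : test_function D phi -> exists2 M, 0 <= M &
  forall x, `|phi x| <= M /\ forall i, `|partial i phi x| <= M.
Proof.
move=> tphi; have [sphi _ _] := tphi; have [r Hr] := test_support tphi.
have [M M0 HM] := continuous_bounded_ccube 0 r (smooth_continuous sphi).
have /choice[N HN] i : exists N, 0 <= N /\ forall x, ccube 0 r x -> `|partial i phi x| <= N.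
  by have [N ? ?] := continuous_bounded_ccube 0 r (@smooth_partial_continuous phi i sphi); exists N.
have N0 : 0 <= \sum_i N i by apply: sumr_ge0 => i _; have [] := HN i.
exists (M + \sum_i N i) => [|x]; first exact: addr_ge0.
have [xr|/Hr[-> p0]] := pselect (ccube 0 r x); last first.
  by split=> [|i]; rewrite ?p0 normr0 addr_ge0.
split=> [|i]; first by rewrite (le_trans (HM x xr))// lerDl.
rewrite (le_trans ((HN i).2 x xr))// (bigD1 i)//= addrCA lerDl.
by rewrite addr_ge0// sumr_ge0// => j _; have [] := HN j.
Qed.

Lemma test_lip D phi : test_function D phi ->
  exists2 L, 0 <= L & lip_on setT L phi.
Proof.
move=> tphi; have [M M0 HM] := test_bounded tphi; exists (d%:R * M); first exact: mulr_ge0.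
move=> x y _ _; have r0 : 0 <= Num.max `|x| `|y| by rewrite le_max normr_ge0.
apply: (@lip_on_partial _ _ _ (fun i => partial i phi) (Num.max `|x| `|y|) M) => //.
- by move=> i z; apply: smooth_is_derive; case: tphi.
- by move=> i z _; have [_] := HM z.
- by apply/(ccube_norm _ _ r0); rewrite sub0r normrN le_max lexx.
- by apply/(ccube_norm _ _ r0); rewrite sub0r normrN le_max lexx orbT.
Qed.

Lemma test_measurable D D' phi : test_function D phi -> measurable_fun D' phi.
Proof.
move=> [sphi _ _]; apply: measurable_funTS; apply: rV_continuous_measurable.
exact: smooth_continuous.
Qed.

Lemma test_partial_measurable D D' phi i : test_function D phi ->
  measurable_fun D' (partial i phi).
Proof.
move=> [sphi _ _]; apply: measurable_funTS; apply: rV_continuous_measurable.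
exact: smooth_partial_continuous.
Qed.

Lemma test_L2 D D' phi : measurable D' -> (mu D' < +oo)%E -> test_function D phi ->
  L2 D' phi /\ forall i, L2 D' (partial i phi).
Proof.
move=> mD' Doo tphi; have [M M0 HM] := test_bounded tphi; split=> [|i].
  by apply: (@L2_bounded _ _ _ _ M) => //; [exact: test_measurable tphi|move=> x _; have [] := HM x].
apply: (@L2_bounded _ _ _ _ M) => //; first exact: test_partial_measurable tphi.
by move=> x _; have [_] := HM x.
Qed.

Lemma test_function_sub D D' phi : D `<=` D' -> test_function D phi -> test_function D' phi.
Proof. by move=> DD [? ? sD]; split=> //; exact: subset_trans DD. Qed.

Lemma inner_test_sub D D' (f phi : E -> R) : measurable D -> measurable D' -> D' `<=` D ->
  (forall x, ~ D' x -> phi x = 0) -> inner D f phi = inner D' f phi.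
Proof.
move=> mD mD' DD p0; rewrite /inner Rintegral_mkcond [RHS]Rintegral_mkcond.
apply: eq_Rintegral => x _; rewrite !patchE.
have [xD'|nxD'] := pselect (D' x); first by rewrite !mem_set//; exact: DD.
by rewrite (memNset nxD') p0// mulr0; case: ifP.
Qed.

Lemma innerv_test_sub D D' (f phi : E -> E) : measurable D -> measurable D' -> D' `<=` D ->
  (forall x, ~ D' x -> phi x = 0) -> innerv D f phi = innerv D' f phi.
Proof.
move=> mD mD' DD p0; rewrite /innerv Rintegral_mkcond [RHS]Rintegral_mkcond.
apply: eq_Rintegral => x _; rewrite !patchE.
have [xD'|nxD'] := pselect (D' x); first by rewrite !mem_set//; exact: DD.
rewrite (memNset nxD') p0// (_ : dotp _ _ = 0); first by case: ifP.
by rewrite /dotp big1// => i _; rewrite mxE mulr0.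
Qed.

Lemma inner_test_unique D f g : open D -> (mu D < +oo)%E -> L2 D f -> L2 D g ->
  (forall phi, test_function D phi -> inner D f phi = inner D g phi) ->
  {ae mu, forall x, D x -> f x = g x}.
Proof.
move=> oD Doo Lf Lg fg; have mD := rV_open_measurable oD.
have H : {ae mu, forall x, D x -> f x - g x = 0}.
  apply: fundamental_lemma => //; first by apply: L2_integrable => //; exact: L2B.
  move=> phi tphi; have [Lphi _] := test_L2 mD Doo tphi.
  rewrite -[LHS]/(inner D (fun x => f x - g x) phi) innerDl//; last exact: L2N.
  under [X in _ + inner _ X _]eq_fun do rewrite -mulN1r.
  by rewrite innerZl// fg// mulN1r subrr.
by apply: filterS H => x Hx Dx; apply/eqP; rewrite -subr_eq0 Hx.
Qed.

Lemma wgrad_unique D v w1 w2 : open D -> (mu D < +oo)%E ->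
  is_wgrad D v w1 -> is_wgrad D v w2 -> {ae mu, forall x, D x -> w1 x = w2 x}.
Proof.
move=> oD Doo [Lw1 H1] [Lw2 H2].
have H i : {ae mu, forall x, D x -> w1 x ord0 i = w2 x ord0 i}.
  apply: inner_test_unique => // phi tphi; apply: oppr_inj.
  by rewrite -(H1 _ tphi) -(H2 _ tphi).
apply: filterS (filter_forall _ H) => x Hx Dx.
by apply/rowP => i; exact: Hx.
Qed.

Lemma wgradP D v w : is_wgrad D v w -> is_wgrad D v (wgrad D v).
Proof. by move=> vw; apply: (@xgetPex _ (fun=> 0) [set w | is_wgrad D v w]); exists w. Qed.

Lemma wgrad_ae D v w : open D -> (mu D < +oo)%E -> is_wgrad D v w ->
  {ae mu, forall x, D x -> wgrad D v x = w x}.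
Proof. by move=> oD Doo vw; exact: wgrad_unique (wgradP vw) vw. Qed.

Lemma wdiv_unique D w v1 v2 : open D -> (mu D < +oo)%E ->
  is_wdiv D w v1 -> is_wdiv D w v2 -> {ae mu, forall x, D x -> v1 x = v2 x}.
Proof.
move=> oD Doo [Lw1 H1] [Lw2 H2]; apply: inner_test_unique => // phi tphi.
by apply: oppr_inj; rewrite -H1// H2.
Qed.

Lemma wdivP D w v : is_wdiv D w v -> is_wdiv D w (wdiv D w).
Proof. by move=> vw; apply: (@xgetPex _ (fun=> 0) [set v | is_wdiv D w v]); exists v. Qed.

(** The product [v * phi] is Lipschitz with compact support, and its derivative is almost everywhere
    given by the product rule; that this derivative has zero integral is the identity defining the
    weak gradient. Only a Lipschitz bound on products is asked for, so [v] may have kinks. *)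
Lemma is_wgrad_intro D v w : open D -> bounded_set D -> measurable_fun D v ->
  L2v D w ->
  (forall phi, test_function D phi ->
     exists2 L, 0 <= L & lip_on setT L (fun x => v x * phi x)) ->
  (forall i, {ae mu, forall x, D x -> is_derive x (e_ i) v (w x ord0 i)}) ->
  is_wgrad D v w.
Proof.
move=> oD bD mv Lw vL vw; split=> // phi tphi i.
have mD := rV_open_measurable oD; have Doo := lebesgue_rV_bounded_lty mD bD.
have [L L0 gL] := vL phi tphi; have [r Hr] := test_support tphi.
have [Lphi Lpphi] := test_L2 mD Doo tphi.
pose dg := (fun x => w x ord0 i * phi x + v x * partial i phi x) \_ D.
have mdgD : measurable_fun D (fun x => w x ord0 i * phi x + v x * partial i phi x).
  apply: measurable_funD; apply: measurable_funM => //.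
  - by have [] := Lw i.
  - exact: test_measurable tphi.
  - exact: test_partial_measurable tphi.
have mdg : measurable_fun setT dg.
  by apply/(measurable_restrict _ mD measurableT); rewrite setTI.
have [||idg I0] := @lip_integral_derive _ _ (fun x => v x * phi x) dg i L r L0 gL _ mdg.
- by move=> x /Hr[-> _]; rewrite mulr0.
- apply: filterS (vw i) => x vx; apply: dquot_cvg; rewrite /dg patchE.
  have [xD|nxD] := pselect (D x).
    rewrite mem_set//; apply: is_derive_eq (is_deriveM (vx xD) _ ) _.
      by apply: smooth_is_derive; case: tphi.
    by rewrite addrC /GRing.scale/= (mulrC (phi x)).
  (* Points outside [D] are off the closed support of [phi], so the product vanishes nearby and has
     derivative 0, which is the value of [dg] there. *)
  rewrite (memNset nxD); apply: is_derive_locally0.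
  have : \forall y \near x, phi y = 0.
    by apply: (test_near0 tphi); apply: contra_not nxD; case: tphi => _ _; exact.
  by apply: filterS => y ->; rewrite mulr0.
have iwp := L2_mul_integrable mD (Lw i) Lphi.
have ih : mu.-integrable D (EFin \o (fun x => w x ord0 i * phi x + v x * partial i phi x)).
  apply/(integrable_mkcond _ mD); move: idg; congr integrable.
  by apply/funext => x; rewrite /dg /= !patchE; case: ifP.
have ivp : mu.-integrable D (EFin \o (fun x => v x * partial i phi x)).
  apply: eq_integrable (integrableB mD ih iwp) => // x _.
  by rewrite /= -EFinB addrAC subrr add0r.
apply/eqP; rewrite -addr_eq0 addrC -RintegralD//.
by rewrite -I0 Rintegral_mkcond.
Qed.

Lemma is_wgrad_C1 D v w : open D -> bounded_set D ->
  (forall i x, is_derive x (e_ i) v (w x ord0 i)) ->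
  (forall i, continuous (fun x => w x ord0 i)) -> continuous v ->
  is_wgrad D v w.
Proof.
move=> oD bD dv cw cv; have mD := rV_open_measurable oD.
have bounded (h : E -> R) r : continuous h -> exists M, 0 <= M /\
    forall x, ccube 0 r x -> `|h x| <= M.
  by move=> /(continuous_bounded_ccube 0 r)[M M0 HM]; exists M.
apply: is_wgrad_intro => //.
- by apply: measurable_funTS; exact: rV_continuous_measurable.
- move=> i; have [r r0 Dr] := bounded_set_cube bD.
  have [M [M0 HM]] := bounded _ r (cw i).
  apply: (@L2_bounded _ _ _ _ M) => //; first exact: lebesgue_rV_bounded_lty.
    by apply: measurable_funTS; exact: rV_continuous_measurable.
  by move=> x /Dr xr; apply: HM => j; exact: ltW.
- move=> phi tphi; have [sphi _ _] := tphi; have [r Hr] := test_support tphi.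
  have dg i x := is_deriveM (dv i x) (smooth_is_derive i x sphi).
  have /choice[M HM] i : exists M, 0 <= M /\ forall x,
      `|v x *: partial i phi x + phi x *: w x ord0 i| <= M.
    have [M M0 HM] := test_bounded tphi.
    have [N [N0 HN]] := bounded _ r cv; have [K [K0 HK]] := bounded _ r (cw i).
    exists (N * M + M * K); split=> [|x]; first by rewrite addr_ge0 ?mulr_ge0.
    have [xr|nxr] := pselect (ccube 0 r x); last first.
      by have [-> /(_ i) ->] := Hr x nxr; rewrite scaler0 scale0r addr0 normr0 addr_ge0 ?mulr_ge0.
    apply: (le_trans (ler_normD _ _)); rewrite !normrM; have [h1 /(_ i) h2] := HM x.
    by apply: lerD; apply: ler_pM => //; [exact: HN|exact: HK].
  pose L := \sum_i M i; have L0 : 0 <= L by apply: sumr_ge0 => i _; exact: (HM i).1.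
  exists (d%:R * L); first exact: mulr_ge0.
  move=> x y _ _; have r0 : 0 <= Num.max `|x| `|y| by rewrite le_max normr_ge0.
  apply: (lip_on_partial (r := Num.max `|x| `|y|) L0 dg).
  + move=> i z _; apply: (le_trans ((HM i).2 z)).
    by rewrite /L (bigD1 i)//= lerDl; apply: sumr_ge0 => j _; exact: (HM j).1.
  + by apply/ccube_norm; rewrite // sub0r normrN le_max lexx.
  + by apply/ccube_norm; rewrite // sub0r normrN le_max lexx orbT.
- by move=> i; apply: aeW => x _; exact: dv.
Qed.

End test_functions.

(** * Mollification *)

Section mollification.
Context {R : realType} {d : nat}.
Local Notation E := 'rV[R]_d.
Local Notation mu := (@lebesgue_rV R d).
Local Notation e_ i := (delta_mx ord0 i : 'rV[R]_d).

Definition Cc_infty (phi : E -> R) : Prop :=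
  (forall k, Ck k phi) /\ exists r, forall x, ~ ccube 0 r x -> phi x = 0.

Lemma Cc_infty_test phi : Cc_infty phi -> test_function setT phi.
Proof.
move=> [Cphi [r Hr]]; apply: (@test_function_intro _ _ _ (ccube 0 r)) => //.
  exact: compact_ccube.
by move=> x; apply: contra_neqP => /= /Hr.
Qed.

Lemma Cc_infty_partial phi i : Cc_infty phi -> Cc_infty (partial i phi).
Proof.
move=> Cphi; have [r Hr] := test_support (Cc_infty_test Cphi); split.
  by move=> k; apply: Ck_partial; exact: Cphi.1.
by exists r => x /Hr[].
Qed.

Section convolution.
Variables (g : E -> R) (r : R).
Hypotheses (cg : continuous g) (gr : forall x, ~ ccube 0 r x -> g x = 0).

Definition conv (phi : E -> R) (x : E) : R := \int[mu]_z (g z * phi (x - z)).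

Let mg : measurable_fun setT g. Proof. exact: rV_continuous_measurable. Qed.

Lemma conv_measurable (phi : E -> R) (x : E) : continuous phi ->
  measurable_fun setT (fun z => g z * phi (x - z)).
Proof.
move=> cphi; apply: measurable_funM => //; apply: rV_continuous_measurable.
exact: rV_continuous_subl.
Qed.

Lemma conv_integrable phi x : Cc_infty phi ->
  mu.-integrable setT (EFin \o (fun z => g z * phi (x - z))).
Proof.
move=> Cphi; have [M M0 gM] := continuous_bounded_ccube 0 r cg.
have [N N0 HN] := test_bounded (Cc_infty_test Cphi).
apply: (@bounded_support_integrable _ _ _ (M * N) r).
- by apply: conv_measurable; exact: (Ck_continuous (Cphi.1 0)).
- by move=> z zr; rewrite normrM ler_pM// ?gM//; have [] := HN (x - z).
- by move=> z /gr ->; rewrite mul0r.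
Qed.

Lemma conv_continuous phi : Cc_infty phi -> continuous (conv phi).
Proof.
move=> Cphi; have [L L0 phiL] := test_lip (Cc_infty_test Cphi).
have ig : mu.-integrable setT (EFin \o (fun z => `|g z|)).
  have [M M0 gM] := continuous_bounded_ccube 0 r cg.
  apply: (@bounded_support_integrable _ _ _ M r) => //.
  - exact: measurableT_comp.
  - by move=> x xr; rewrite normr_id gM.
  - by move=> x /gr ->; rewrite normr0.
apply: (@lip_on_continuous _ _ (L * \int[mu]_z `|g z|)) => x y _ _.
rewrite /conv -RintegralB//; [|exact: conv_integrable..].
apply: (le_trans (le_normr_Rintegral measurableT _)).
  exact: (integrableB measurableT (conv_integrable x Cphi) (conv_integrable y Cphi)).
rewrite mulrAC -RintegralZl//; apply: le_Rintegral => //.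
- apply: (integrable_abse (integrableB measurableT (conv_integrable x Cphi) (conv_integrable y Cphi))).
- exact: (integrableZl measurableT _ ig).
move=> z _; rewrite -mulrBr normrM mulrC ler_wpM2r//.
by apply: (le_trans (phiL _ _ I I)); rewrite opprB addrA subrK.
Qed.

(** Differentiation under the integral sign along the line through [x]: the derivative falls on
    [phi], so continuity of [g] suffices. The dominating function is a bound of [|g|] times one of
    the derivatives of [phi], on the cube off which [g] vanishes. *)
Lemma conv_is_derive phi i x : Cc_infty phi ->
  is_derive x (e_ i) (conv phi) (conv (partial i phi) x).
Proof.
move=> Cphi; have tphi := Cc_infty_test Cphi.
have [M M0 gM] := continuous_bounded_ccube 0 r cg.
have [N N0 HN] := test_bounded tphi.
pose f (t : R) (z : E) := g z * phi (x + t *: e_ i - z).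
have fE t z : f t z = g z * phi ((x - z) + t *: e_ i) by rewrite /f addrAC.
have idf (t : R) z : is_derive t 1 (f^~ z) (g z * partial i phi (x - z + t *: e_ i)).
  have -> : f^~ z = (fun s => g z * phi (x - z + s *: e_ i)) by apply/funext => s; exact: fE.
  apply: is_deriveZ; apply: (@is_derive_line _ _ _ _ _ (partial i phi)).
  exact: (@Ck_is_derive _ _ 0 _ _ _ (Cphi.1 1)).
have pE t z : partial1of2 f t z = g z * partial i phi (x - z + t *: e_ i).
  by rewrite /partial1of2 derive1E; have [] := idf t z.
have x0 : `](-1), 1[%classic (0 : R) by rewrite /= in_itv/= ltrN10 ltr01.
have cv : h^-1 *: (\int[mu]_y f (h + 0) y - \int[mu]_y f 0 y) @[h --> 0^'] -->
    \int[mu]_y partial1of2 f 0 y.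
  apply: (@cvg_differentiation_under_integral R _ _ mu f setT measurableT 0 (-1) 1 x0
     _ _ (fun z => M * N * \1_(ccube 0 r) z)).
  - by move=> t _; exact: conv_integrable.
  - by move=> t z _ _; have [] := idf t z.
  - by move=> z; rewrite !mulr_ge0.
  - apply: (@bounded_support_integrable _ _ _ (M * N) r).
    + by apply: measurable_funM => //; apply: measurable_indic; exact: measurable_ccube.
    + move=> z zr; rewrite indicE mem_set// mulr1 ger0_norm//; exact: mulr_ge0.
    + by move=> z zr; rewrite indicE memNset// mulr0.
  - move=> t z _ _; rewrite pE indicE; have [zr|/[dup] zr /gr ->] := pselect (ccube 0 r z).
      by rewrite mem_set// mulr1 normrM ler_pM ?gM//; have [_] := HN (x - z + t *: e_ i).
    by rewrite mul0r normr0 memNset// mulr0.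
have {cv} : h^-1 *: (conv phi (h *: e_ i + x) - conv phi x) @[h --> 0^'] -->
    conv (partial i phi) x.
  have -> : conv (partial i phi) x = \int[mu]_y partial1of2 f 0 y.
    by apply: eq_Rintegral => z _; rewrite pE scale0r addr0.
  have E0 : conv phi x = \int[mu]_y f 0 y.
    by apply: eq_Rintegral => z _; rewrite fE scale0r addr0.
  rewrite [X in X @ _ --> _](_ : _ = (fun h : R => h^-1 *: (\int[mu]_y f (h + 0) y - \int[mu]_y f 0 y)))//.
  apply: funext => h; rewrite E0; congr (_ *: (_ - _)).
  by apply: eq_Rintegral => z _; rewrite addr0 /f (addrC x).
move=> cv; apply: DeriveDef; first by apply/cvg_ex; eexists; exact: cv.
exact: cvg_lim cv.
Qed.

Lemma Ck_conv k phi : Cc_infty phi -> Ck k (conv phi).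
Proof.
elim: k phi => [|k IH] phi Cphi; first by split=> //; exact: conv_continuous.
split; first exact: conv_continuous.
exists (fun i => conv (partial i phi)) => i; split.
  by move=> x; exact: conv_is_derive.
by apply: IH; exact: Cc_infty_partial.
Qed.

End convolution.

(** * Averages against a bump of radius [delta] *)

Section mollifier.
Variable (delta : R).
Hypothesis delta_gt0 : 0 < delta.

(** The norm on row vectors is the maximum norm, so the open ball of radius [delta] is a box and its
    bump is the kernel. Its integral is not normalized, whence the division by [eta_mass] in
    [mol]. *)
Definition eta : E -> R := bump 0 (const_mx (- delta)) (const_mx delta).

Lemma box_const_norm (x : E) : box (const_mx (- delta)) (const_mx delta) x <-> `|x| < delta.
Proof.
split=> [xd|xd i]; last first.
  by have := le_lt_trans (coord_le_norm x i) xd; rewrite !mxE ltr_norml.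
have : `|x| = 0 \/ exists i, `|x| = `|x ord0 i|.
  have [->|x0] := eqVneq x 0; first by left; rewrite normr0.
  right; have := @mx_norm_neq0 R 1 d x; have -> : mx_norm x = `|x| by [].
  rewrite normr_eq0 x0 => /(_ isT).
  by move=> [[a j] /= ->]; exists j; rewrite (ord1 a).
by move=> [->//|[j ->]]; have := xd j; rewrite !mxE ltr_norml.
Qed.

Lemma eta_ge0 x : 0 <= eta x. Proof. exact: bump_ge0. Qed.

Lemma eta_out (x : E) : delta <= `|x| -> eta x = 0.
Proof. by move=> dx; apply: bump_out => /box_const_norm; rewrite ltNge dx. Qed.

Lemma Cc_infty_eta : Cc_infty eta.
Proof.
split=> [k|]; first exact: Ck_bump.
exists delta => x nx; apply: eta_out; rewrite leNgt; apply/negP => xd.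
by apply/nx/ccube_norm; [exact: ltW|rewrite sub0r normrN ltW].
Qed.

Let eta_shift_integrable (x : E) : mu.-integrable setT (EFin \o (fun z => eta (x - z))).
Proof.
apply: (@bounded_support_integrable _ _ _ 1 (`|x| + delta)).
- apply: rV_continuous_measurable; apply: rV_continuous_subl.
  exact: Ck_continuous (Cc_infty_eta.1 0).
- by move=> z _; rewrite ger0_norm ?eta_ge0// bump_le1.
- move=> z nz; apply: eta_out; rewrite leNgt; apply/negP => xz; apply: nz.
  apply/ccube_norm; first by rewrite addr_ge0// ltW.
  rewrite sub0r normrN -(subKr x z) (le_trans (ler_normB _ _))// lerD2l.
  exact: ltW.
Qed.

Definition eta_mass : R := \int[mu]_z eta (- z).

Lemma eta_massE (x : E) : \int[mu]_z eta (x - z) = eta_mass.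
Proof.
rewrite -(Rintegral_addr x); last first.
  by have /measurable_int/measurable_EFinP := eta_shift_integrable x.
by apply: eq_Rintegral => z _; rewrite opprD addrCA subrr addr0.
Qed.

Lemma eta_mass_gt0 : 0 < eta_mass.
Proof.
rewrite lt_def Rintegral_ge0 ?andbT; last by move=> x _; exact: eta_ge0.
apply/eqP => m0; have ie := eta_shift_integrable 0.
have : (\int[mu]_z `|(eta (0 - z))%:E|)%E = 0%E.
  rewrite (eq_integral (fun z : E => (eta (0 - z))%:E)) => [|z _]; last first.
    by rewrite gee0_abs// lee_fin eta_ge0.
  rewrite -[LHS]fineK; last exact: integrable_fin_num.
  by rewrite -[fine _]/(Rintegral mu setT (fun z => eta (0 - z))) eta_massE m0.
move=> /(ae_eq_integral_abs mu measurableT (measurable_int mu ie)) H.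
have : {ae mu, forall z, ~ cube 0 delta z}.
  apply: filterS H => z /(_ I)[ez] zd; move: ez; apply/eqP.
  rewrite gt_eqF// bump_gt0// => i; rewrite !mxE add0r.
  by have := zd i; rewrite !mxE sub0r normrN ltr_norml ltrN2 ltrNl andbC.
move=> [N [mN N0 NC]].
have : mu (cube 0 delta) = 0%E.
  apply: (subset_measure0 (measurable_cube _ _) mN) => //.
  by move=> z zd; apply: NC => /(_ zd).
by rewrite lebesgue_rV_cube// => /eqP; rewrite eqe gt_eqF// exprn_gt0// addr_gt0.
Qed.

Section average.
Variables (g : E -> R) (r : R).
Hypotheses (cg : continuous g) (gr : forall x, ~ ccube 0 r x -> g x = 0).

Definition mol (x : E) : R := eta_mass^-1 * conv g eta x.

Lemma Ck_mol k : Ck k mol.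
Proof. by apply: Ck_mul; [exact: Ck_cst|apply: Ck_conv Cc_infty_eta; eassumption]. Qed.

(** A weighted average over the ball of radius [delta] inherits a bound that all the values there
    satisfy. It is applied both to the values of a function and to its difference quotients. *)
Lemma mol_average x a eps :
  (forall z, `|x - z| < delta -> `|g z - a| <= eps) -> `|mol x - a| <= eps.
Proof.
move=> ga; have iconv : mu.-integrable setT (EFin \o (fun z => g z * eta (x - z))).
  by apply: (@conv_integrable g r) => //; exact: Cc_infty_eta.
have ia := integrableZl measurableT a (eta_shift_integrable x).
have -> : mol x - a = eta_mass^-1 * \int[mu]_z ((g z - a) * eta (x - z)).
  have -> : \int[mu]_z ((g z - a) * eta (x - z)) = conv g eta x - a * eta_mass.
    rewrite -(eta_massE x) -RintegralZl// /conv -RintegralB//.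
    by apply: eq_Rintegral => z _; rewrite mulrBl.
  by rewrite mulrBr mulrCA mulVf ?mulr1// gt_eqF// eta_mass_gt0.
have m0 := eta_mass_gt0.
rewrite normrM gtr0_norm ?invr_gt0// mulrC ler_pdivrMr//.
have iga : mu.-integrable setT (EFin \o (fun z => (g z - a) * eta (x - z))).
  apply: eq_integrable (integrableB measurableT iconv ia) => // z _.
  by rewrite /= -EFinB mulrBl.
apply: (le_trans (le_normr_Rintegral measurableT iga)).
rewrite -(eta_massE x) -RintegralZl//; apply: le_Rintegral => //.
- exact: integrable_abse iga.
- exact: (integrableZl measurableT eps (eta_shift_integrable x)).
move=> z _; rewrite normrM (ger0_norm (eta_ge0 _)).
have [xz|xz] := ltP `|x - z| delta; first by rewrite ler_wpM2r ?eta_ge0 ?ga.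
by rewrite eta_out// !mulr0.
Qed.

Lemma mol_out x : (forall z, `|x - z| < delta -> g z = 0) -> mol x = 0.
Proof.
move=> g0; rewrite /mol /conv (_ : Rintegral _ _ _ = 0) ?mulr0//.
rewrite (_ : (fun z => _) = cst 0) ?Rintegral_cst// ?mul0r//.
apply/funext => z; have [/g0 ->|xz] := ltP `|x - z| delta; first by rewrite mul0r.
by rewrite eta_out ?mulr0.
Qed.

End average.

Section average_derivative.
Variables (g : E -> R) (r : R).
Hypotheses (cg : continuous g) (gr : forall x, ~ ccube 0 r x -> g x = 0).

Lemma mol_shift (x v : E) : mol g (x + v) = mol (fun z => g (z + v)) x.
Proof.
suff H : conv g eta (x + v) = conv (fun z => g (z + v)) eta x by rewrite /mol H.
rewrite /conv.
have mh := conv_measurable cg (x + v) (Ck_continuous (Cc_infty_eta.1 0)).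
transitivity (\int[mu]_z ((fun z => g z * eta (x + v - z)) (z + v))).
  by rewrite (Rintegral_addr v mh).
by apply: eq_Rintegral => z _; rewrite opprD addrACA subrr addr0.
Qed.

Lemma mol_partial x i a eps s : 0 < s ->
  (forall z h, `|x - z| < delta -> 0 < `|h| < s ->
    `|g (z + h *: e_ i) - g z - h * a| <= eps * `|h|) ->
  `|partial i (mol g) x - a| <= eps.
Proof.
move=> s0 H; have idm : is_derive x (e_ i) (mol g) (partial i (mol g) x).
  apply: (@Ck_is_derive _ _ 0); exact: (@Ck_mol g r cg gr 1).
have cv := dquot_cvg idm.
apply: (cvgr_to_le (cvg_norm (cvgB cv (cvg_cst a)))).
have [m _ Hm] := near_infty_natSinv_lt (PosNum s0).
exists m => // n mn.
rewrite (_ : _ n = dquot i (mol g) n x - a)//.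
have h0 : 0 < n.+1%:R^-1 :> R by rewrite invr_gt0.
have hs : n.+1%:R^-1 < s by exact: Hm.
have h1 : n.+1%:R^-1 <= 1 :> R by rewrite invf_le1// ler1n.
pose v : E := n.+1%:R^-1 *: e_ i.
have cgv : continuous (fun z : E => g (z + v)) by exact: rV_continuous_addr.
have grv z : ~ ccube 0 (r + 1) z -> g (z + v) = 0.
  move=> nz; apply: gr; apply: contra_not nz => zr j; have := zr j.
  rewrite !mxE !sub0r !normrN => zj.
  have vj : `|v ord0 j| <= 1.
    apply: (le_trans (coord_le_norm _ _)); apply: (le_trans (norm_scale_delta _ _)).
    by rewrite gtr0_norm.
  rewrite -(addrK (v ord0 j) (z ord0 j)) (le_trans (ler_normB _ _))// lerD//.
  by move: zj; rewrite !mxE.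
have gr1 z : ~ ccube 0 (r + 1) z -> g z = 0.
  move=> nz; apply: gr; apply: contra_not nz => zr j.
  by rewrite (le_trans (zr j))// lerDl.
pose G (z : E) := n.+1%:R * (g (z + v) - g z).
have cG : continuous G.
  move=> z; apply: (@continuousM _ E (cst _) (fun z => g (z + v) - g z)).
    exact: cst_continuous.
  by apply: continuousB; [exact: cgv|exact: cg].
have Gr z : ~ ccube 0 (r + 1) z -> G z = 0.
  by move=> nz; rewrite /G grv ?gr1// subrr mulr0.
have -> : dquot i (mol g) n x = mol G x.
  rewrite /dquot mol_shift -mulrBr mulrCA; congr (_ * _).
  have iv := conv_integrable cgv grv x Cc_infty_eta.
  have i1 := conv_integrable cg gr x Cc_infty_eta.
  rewrite /conv -RintegralB// -RintegralZl//; last exact: (integrableB measurableT iv i1).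
  by apply: eq_Rintegral => z _; rewrite /G -mulrBl mulrA.
apply: (@mol_average G (r + 1)) => // z xz.
have := H z (n.+1%:R^-1) xz; rewrite gtr0_norm// h0 hs => /(_ isT) Hz.
have -> : G z - a = n.+1%:R * (g (z + v) - g z - n.+1%:R^-1 * a).
  by rewrite /G; field; rewrite addrC natr1 pnatr_eq0.
by rewrite normrM gtr0_norm// mulrC -ler_pdivlMr.
Qed.

End average_derivative.

End mollifier.
End mollification.

(** * Lipschitz functions in the closure of the test functions *)

Section truncation.
Context {R : realType}.
Implicit Types t s : R.

(** Soft thresholding: the projection of [s] on the interval from [- t] to [t] is subtracted, which
    keeps the function 1-Lipschitz, unlike a cut-off that jumps. *)
Definition trunc t s : R := s - Num.max (- t) (Num.min t s).

Lemma trunc_small t s : `|s| <= t -> trunc t s = 0.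
Proof.
rewrite ler_norml => /andP[ts st]; rewrite /trunc min_r// max_r// subrr//.
Qed.

Lemma trunc_pos t s : 0 <= t -> t <= s -> trunc t s = s - t.
Proof. by move=> t0 ts; rewrite /trunc min_l// max_r//; lra. Qed.

Lemma trunc_neg t s : 0 <= t -> s <= - t -> trunc t s = s + t.
Proof. by move=> t0 ts; rewrite /trunc min_r ?max_l ?opprK//; lra. Qed.

Lemma trunc_dist t s : 0 <= t -> `|trunc t s - s| <= t.
Proof.
move=> t0; rewrite /trunc addrAC subrr add0r normrN ler_norml.
by rewrite le_max lexx ge_max ge_min lexx/=; lra.
Qed.

Lemma trunc_lip t s r : 0 <= t -> `|trunc t s - trunc t r| <= `|s - r|.
Proof.
move=> t0; have T x : (x <= - t /\ trunc t x = x + t) \/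
    (- t <= x <= t /\ trunc t x = 0) \/ (t <= x /\ trunc t x = x - t).
  have [x1|x1] := leP x (- t); first by left; rewrite trunc_neg.
  have [x2|x2] := leP t x; first by right; right; rewrite trunc_pos.
  by right; left; rewrite trunc_small ?ler_norml !ltW.
have [sr|sr] := leP r s; [rewrite [leRHS]ger0_norm ?subr_ge0//|
    rewrite [leRHS]ltr0_norm ?subr_lt0//];
  by move: (T s) (T r) => [[? ->]|[[/andP[? ?] ->]|[? ->]]]
     [[? ->]|[[/andP[? ?] ->]|[? ->]]]; rewrite ler_norml; apply/andP; split; lra.
Qed.

End truncation.

Section H10.
Context {R : realType} {d : nat}.
Local Notation E := 'rV[R]_d.
Local Notation mu := (@lebesgue_rV R d).
Local Notation e_ i := (delta_mx ord0 i : 'rV[R]_d).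
Implicit Types (D : set E) (phi v : E -> R) (w : E -> E).

Lemma inner_eq D (f g f' g' : E -> R) : (forall x, D x -> f x = f' x) ->
  (forall x, D x -> g x = g' x) -> inner D f g = inner D f' g'.
Proof. by move=> ff gg; apply: eq_Rintegral => x /[!inE] Dx; rewrite ff ?gg. Qed.

Lemma is_wgrad_ext D v v' : (forall x, D x -> v x = v' x) ->
  [set w | is_wgrad D v w] = [set w | is_wgrad D v' w].
Proof.
move=> vv'; apply/seteqP; split=> w [Lw H]; split=> // phi tphi i.
  by rewrite -H//; apply: inner_eq => // x /vv'.
by rewrite -H//; apply: inner_eq => // x /vv'.
Qed.

Lemma wgrad_ext D v v' : (forall x, D x -> v x = v' x) -> wgrad D v = wgrad D v'.
Proof. by move=> /is_wgrad_ext vv'; rewrite /wgrad vv'. Qed.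

Lemma H10_ext D v v' : measurable D -> (forall x, D x -> v x = v' x) ->
  H10 D v -> H10 D v'.
Proof.
move=> mD vv' [[Lv [w vw]] H]; split.
  split; first exact: L2_eq Lv.
  by exists w; have := is_wgrad_ext vv'; move=> /(congr1 (fun X => X w))/= <-.
move=> eps eps0; have [phi [tphi H1]] := H eps eps0; exists phi; split; first by [].
rewrite /H1norm -(@wgrad_ext D (fun x => v x - phi x)); last by move=> x /vv' ->.
rewrite -(@inner_eq D (fun x => v x - phi x) (fun x => v x - phi x))//;
  by move=> x /vv' ->.
Qed.

Lemma is_wgradB D v v' w w' : measurable D -> (mu D < +oo)%E -> L2 D v -> L2 D v' ->
  is_wgrad D v w -> is_wgrad D v' w' ->
  is_wgrad D (fun x => v x - v' x) (fun x => w x - w' x).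
Proof.
move=> mD Doo Lv Lv' [Lw H] [Lw' H']; split.
  by move=> i; apply: L2_eq (L2B mD (Lw i) (Lw' i)) => // x _; rewrite !mxE.
move=> phi tphi i; have [Lphi /(_ i) Lp] := test_L2 mD Doo tphi.
have HB f f' g : L2 D f -> L2 D f' -> L2 D g ->
    inner D (fun x => f x - f' x) g = inner D f g - inner D f' g.
  move=> Lf Lf' Lg; rewrite -mulN1r -innerZl// -innerDl//; last exact: L2Z.
  by apply: inner_eq => // x _; rewrite mulN1r.
have -> : inner D (fun x => (w x - w' x) ord0 i) phi =
    inner D (fun x => w x ord0 i) phi - inner D (fun x => w' x ord0 i) phi.
  by rewrite -HB//; apply: inner_eq => // x _; rewrite !mxE.
by rewrite HB// (H _ tphi) (H' _ tphi) opprB opprK addrC.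
Qed.

Lemma is_wgrad_test D phi : open D -> bounded_set D -> test_function D phi ->
  is_wgrad D phi (classical_grad phi).
Proof.
move=> oD bD [sphi _ _]; apply: is_wgrad_C1 => // [i x|i|].
- by rewrite mxE; exact: smooth_is_derive.
- by under eq_fun do rewrite mxE; exact: smooth_partial_continuous.
- exact: smooth_continuous.
Qed.

(* The increments of [v] along [e_ i] are uniformly close to [a] near [x], as
   for a function of class C1 near [x]. *)
Definition strict_partial v (i : 'I_d) (x : E) (a : R) : Prop :=
  forall eps, 0 < eps -> exists2 s, 0 < s & forall z h, `|x - z| < s ->
    0 < `|h| < s -> `|v (z + h *: e_ i) - v z - h * a| <= eps * `|h|.

(* Truncating [v] at a small level and then mollifying at a smaller scale gives
   test functions with bounded gradients that converge almost everywhere. *)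
Lemma H10_lipschitz D v w L : open D -> bounded_set D -> 0 <= L ->
  lip_on setT L v -> (forall x, ~ D x -> v x = 0) -> is_wgrad D v w ->
  {ae mu, forall x, D x -> forall i, strict_partial v i x (w x ord0 i)} ->
  {ae mu, forall x, D x -> v x = 0 -> w x = 0} ->
  H10 D v.
Proof.
move=> oD bD L0 vL v0 vw vs vz; have mD := rV_open_measurable oD.
have Doo := lebesgue_rV_bounded_lty mD bD.
have cv := lip_on_continuous vL.
have mv D' : measurable_fun D' v by apply: measurable_funTS; exact: rV_continuous_measurable.
have [r r0 Dr] := bounded_set_cube bD.
have vr x : ~ ccube 0 r x -> v x = 0.
  by move=> nx; apply: v0; apply: contra_not nx => /Dr xr i; exact: ltW.
have [M M0 vM] := continuous_bounded_ccube 0 r cv.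
have {}vM x : `|v x| <= M.
  by have [/vM//|/vr ->] := pselect (ccube 0 r x); rewrite normr0.
have Lv : L2 D v by apply: (@L2_bounded _ _ _ _ M).
split; first by split=> //; exists w.
pose t (n : nat) : R := n.+1%:R^-1.
have t0 n : 0 < t n by rewrite invr_gt0.
(* Over this distance [v] varies by at most [t n / 2]; [L + 1] in place of [L] keeps the denominator
   positive. *)
pose de (n : nat) : R := t n / (2 * (L + 1)).
have L1 : 0 < 2 * (L + 1) by rewrite mulr_gt0// ltr_wpDl.
have de0 n : 0 < de n by rewrite divr_gt0.
have Lde n : L * de n <= t n / 2.
  rewrite /de mulrA ler_pdivrMr//.
  have -> : t n / 2 * (2 * (L + 1)) = t n * (L + 1) by field.
  by rewrite mulrDr mulr1 (mulrC L) lerDl ltW.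
pose g n x := trunc (t n) (v x).
have gL n : lip_on setT L (g n).
  move=> x y _ _; apply: le_trans (vL x y I I); apply: trunc_lip; exact: ltW.
have cg n : continuous (g n) by exact: lip_on_continuous (gL n).
have gr n x : ~ ccube 0 r x -> g n x = 0.
  by move=> /vr vx; rewrite /g trunc_small// vx normr0 ltW.
pose phi n := mol (de n) (g n).
have Cphi n k : Ck k (phi n) by exact: (@Ck_mol _ _ _ (de0 n) (g n) r (cg n) (gr n)).
have tphi n : test_function D (phi n).
  (* This set is compact and inside [D], since [v] vanishes elsewhere. Off it, [|v|] is at most
     [t n] in the whole mollification ball, so the truncation and its average vanish. *)
  pose K := [set x | t n / 2 <= `|v x|].
  have KD : K `<=` D.
    move=> x; apply: contraPP => /v0 vx; rewrite /K/= vx normr0.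
    by apply/negP; rewrite -ltNge divr_gt0.
  apply: (@test_function_intro _ _ D K) => //.
    have KR : K `<=` ccube 0 r by move=> x /KD /Dr xr i; exact: ltW.
    apply: subclosed_compact KR; last exact: compact_ccube.
    rewrite (_ : K = (fun x => `|v x|) @^-1` [set y | t n / 2 <= y])//.
    apply: closed_comp; last exact: closed_ge.
    move=> x _; apply: (continuous_comp (f := v) (g := Num.norm)); first exact: cv.
    exact: norm_continuous.
  move=> x; apply: contra_neqP => /negP; rewrite -ltNge => vx.
  apply: (mol_out (de0 n)) => z xz; apply: trunc_small.
  rewrite -(subrK (v x) (v z)) (le_trans (ler_normD _ _))// (splitr (t n)).
  rewrite lerD ?(ltW vx)// (le_trans (vL _ _ I I))//.
  by apply: le_trans (Lde n); rewrite ler_wpM2l// distrC ltW.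
have phiv n x : `|phi n x - v x| <= t n + t n.
  apply: (@mol_average _ _ _ (de0 n) (g n) r (cg n) (gr n)) => z xz.
  rewrite -(subrKA (v z)) (le_trans (ler_normD _ _))// lerD//.
    by apply: trunc_dist; exact: ltW.
  apply: (le_trans (vL _ _ I I)); apply: (@le_trans _ _ (t n / 2)).
    by apply: le_trans (Lde n); rewrite ler_wpM2l// distrC ltW.
  by rewrite ler_pdivrMr// ler_peMr ?ltW// ltr1n.
(* Truncation does not enlarge increments, so [mol_partial] applies with [a = 0] and [eps = L]. *)
have pphi n x i : `|partial i (phi n) x| <= L.
  have := @mol_partial _ _ _ (de0 n) (g n) r (cg n) (gr n) x i 0 L 1 ltr01.
  rewrite subr0; apply => z h _ _; rewrite mulr0 subr0 (le_trans (gL n _ _ I I))//.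
  by rewrite ler_wpM2l// addrC addKr norm_scale_delta.
have cphi x : phi n x @[n --> \oo] --> v x.
  apply/cvgrPdist_le => e e0; have e20 : 0 < e / 2 by rewrite divr_gt0.
  have [m _ Hm] := near_infty_natSinv_lt (PosNum e20).
  exists m => // n mn; rewrite /= distrC (le_trans (phiv n x))// (splitr e).
  by rewrite lerD// ltW//; exact: Hm.
have cpart : {ae mu, forall x, D x -> forall i, partial i (phi n) x @[n --> \oo] --> w x ord0 i}.
  apply: filterS2 vs vz => x vs vz Dx i; apply/cvgrPdist_le => e e0.
  have [s s0 Hs] := vs Dx i e e0.
  (* Where [v x = 0] the limit is 0 and truncation only shrinks the increments. Elsewhere, as soon
     as [t n] is below a quarter of [|v x|], truncation subtracts a constant near [x] and leaves the
     increments unchanged. *)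
  have [s' s'0 Hs'] : exists2 s', 0 < s' & exists m, forall n, (m <= n)%N ->
      forall z h, `|x - z| < s' -> 0 < `|h| < s' ->
      `|g n (z + h *: e_ i) - g n z - h * w x ord0 i| <= e * `|h|.
    have [vx0|vx0] := eqVneq (v x) 0.
      exists s => //; exists 0%N => n _ z h xz hs; have := Hs z h xz hs.
      rewrite vz// mxE !mulr0 !subr0; apply: le_trans; apply: trunc_lip.
      exact: ltW.
    pose c := `|v x|; have c0 : 0 < c by rewrite normr_gt0.
    have c40 : 0 < c / 4 by rewrite divr_gt0.
    have L10 : 0 < L + 1 by rewrite ltr_wpDl.
    exists (Num.min s (c / 4 / (L + 1))); first by rewrite lt_min s0 divr_gt0.
    have [m _ Hm] := near_infty_natSinv_lt (PosNum c40).
    exists m => n mn z h; rewrite !lt_min => /andP[xz1 xz2] /and3P[h0 h1 h2].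
    (* Twice the radius, in order to cover both [z] and [z + h *: e_ i]. *)
    have near1 y : `|x - y| < 2 * (c / 4 / (L + 1)) -> `|v x - v y| <= c / 2.
      move=> xy; rewrite (le_trans (vL _ _ I I))// (@le_trans _ _ ((L + 1) * `|x - y|))//.
        by rewrite ler_wpM2r// lerDl.
      have -> : c / 2 = (L + 1) * (2 * (c / 4 / (L + 1))) by field; rewrite gt_eqF.
      by rewrite ler_wpM2l ?(ltW L10)// ltW.
    have vxz : `|v x - v z| <= c / 2.
      apply: near1; rewrite (lt_le_trans xz2)// ler_peMl// ?ler1n//.
      by rewrite ltW// divr_gt0.
    have vxh : `|v x - v (z + h *: e_ i)| <= c / 2.
      apply: near1; rewrite opprD addrA mulr2n mulrDl mul1r.
      rewrite (le_lt_trans (ler_normB _ _))// ltrD//.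
      exact: le_lt_trans (norm_scale_delta _ _) h2.
    have tn : t n < c / 4 by exact: Hm.
    suff -> : g n (z + h *: e_ i) - g n z = v (z + h *: e_ i) - v z.
      by apply: Hs => //; rewrite h0.
    rewrite /g; move: vxz vxh; rewrite !ler_norml => /andP[? ?] /andP[? ?].
    have := t0 n; have [vx|vx] := ltP 0 (v x).
      have cE : c = v x by rewrite /c gtr0_norm.
      by move=> tn0; rewrite !trunc_pos; lra.
    have cE : c = - v x by rewrite /c ler0_norm.
    by move=> tn0; rewrite !trunc_neg; lra.
  case: Hs' => m1 Hm1; have [m _ Hm] := near_infty_natSinv_lt (PosNum s'0).
  exists (maxn m m1) => // n /=; rewrite geq_max => /andP[mn m1n].
  rewrite distrC; apply: (@mol_partial _ _ _ (de0 n) (g n) r (cg n) (gr n) _ _ _ _ s') => //.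
  move=> z h xz hs; apply: (Hm1 n m1n) => //; apply: (lt_le_trans xz).
  apply: (@le_trans _ _ (t n)); last by apply: ltW; exact: Hm.
  rewrite /de ler_pdivrMr// ler_peMr// ?(ltW (t0 n))//.
  by rewrite mulrDr mulr1 -[X in X <= _]add0r lerD ?mulr_ge0// ler1n.
pose A n := inner D (fun x => v x - phi n x) (fun x => v x - phi n x).
pose B n := innerv D (fun x => w x - classical_grad (phi n) x)
  (fun x => w x - classical_grad (phi n) x).
have HE n : H1norm D (fun x => v x - phi n x) = Num.sqrt (A n + B n).
  rewrite /H1norm; congr (Num.sqrt (_ + _)); apply: Rintegral_eq_ae.
  have := is_wgradB mD Doo Lv (test_L2 mD Doo (tphi n)).1 vw (is_wgrad_test oD bD (tphi n)).
  by move=> /(wgrad_ae oD Doo); apply: filterS => x H Dx; rewrite H.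
have ic (a : R) : mu.-integrable D (EFin \o cst a).
  by apply: L2_integrable => //; exact: L2_cst.
have mphi n : measurable_fun D (phi n) by exact: test_measurable (tphi n).
have int0 : \int[mu]_(x in D) cst 0 x = 0 by rewrite Rintegral_cst// mul0r.
have cA : A n @[n --> \oo] --> 0.
  have [|||_ cv0] := @Rintegral_dominated_cvg _ _ R mu D
      (fun n x => (v x - phi n x) * (v x - phi n x)) (cst 0) (cst 4) mD _ (measurable_cst _) _ (ic 4).
  - by move=> n; apply: measurable_funM; apply: measurable_funB.
  - apply: aeW => x Dx; rewrite -[X in _ --> X](mulr0 (0 : R)) -(subrr (v x)).
    by apply: cvgM; apply: cvgB => //; exact: cvg_cst.
  - move=> n x _; rewrite normrM distrC.
    have tn1 : t n <= 1 by rewrite invf_le1// ler1n.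
    have := phiv n x; have := normr_ge0 (phi n x - v x); nra.
  by move: cv0; rewrite int0.
have cB : B n @[n --> \oo] --> 0.
  have [|||||_ cv0] := @Rintegral_dominated_cvg _ _ R mu D
      (fun n x => dotp (w x - classical_grad (phi n) x) (w x - classical_grad (phi n) x))
      (cst 0) (fun x => 2 * dotp (w x) (w x) + d%:R * (2 * L ^+ 2)) mD.
  - move=> n; apply: measurable_sum => i.
    suff mi : measurable_fun D (fun x => (w x - classical_grad (phi n) x) ord0 i).
      exact: measurable_funM.
    under eq_fun do rewrite !mxE; apply: measurable_funB; first by have [] := vw.1 i.
    exact: test_partial_measurable (tphi n).
  - exact: measurable_cst.
  - apply: filterS cpart => x cx Dx; rewrite /dotp.
    elim: (index_enum _) => [|i l IH].
      by under eq_fun do rewrite big_nil; exact: cvg_cst.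
    under eq_fun do rewrite big_cons; rewrite -(addr0 (cst 0 x)); apply: cvgD => //.
    rewrite -[X in _ --> X](mulr0 (0 : R)) -(subrr (w x ord0 i)).
    under eq_fun do rewrite !mxE.
    by apply: cvgM; apply: cvgB; [exact: cvg_cst|exact: cx|exact: cvg_cst|exact: cx].
  - have := integrableD mD (integrableZl mD 2 (dotp_integrable mD vw.1 vw.1)) (ic (d%:R * (2 * L ^+ 2))).
    by apply: eq_integrable => // x _; rewrite /= EFinD EFinM.
  - move=> n x _; rewrite ger0_norm ?dotp_ge0// /dotp mulr_sumr.
    have -> : d%:R * (2 * L ^+ 2) = \sum_(i < d) 2 * L ^+ 2.
      by rewrite sumr_const card_ord mulr_natl.
    rewrite -big_split/=; apply: ler_sum => i _; rewrite !mxE.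
    have := pphi n x i; rewrite ler_norml => /andP[p1 p2].
    set a := w x ord0 i; set b := partial i (phi n) x in p1 p2 *.
    have bL : b ^+ 2 <= L ^+ 2 by have := mulr_ge0 (_ : 0 <= L - b) (_ : 0 <= L + b); nra.
    have := sqr_ge0 (a + b); nra.
  by move: cv0; rewrite int0.
move=> eps eps0; have eps2 : 0 < eps ^+ 2 by rewrite exprn_gt0.
have cAB : A n + B n @[n --> \oo] --> 0 by rewrite -(addr0 0); exact: cvgD.
have [m _ Hm] := cvgr_lt _ cAB _ eps2.
exists (phi m); split; first exact: tphi.
rewrite HE -[eps]ger0_norm ?(ltW eps0)// -sqrtr_sqr ltr_sqrt//.
exact: (Hm m (leqnn m)).
Qed.

End H10.

(** * Barycentric coordinates on the mesh *)

Section mesh_geometry.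
Context {R : realType} {d : nat}.
Local Notation E := 'rV[R]_d.
Local Notation mu := (@lebesgue_rV R d).
Variables (Omega : set E) (Th : mesh R d).
Hypothesis hTh : simplicial_mesh Omega Th.
Local Notation I := 'I_(nvertices Th).
Local Notation vert := (@vertex R d Th).
Implicit Types (T : {set I}) (i a : I) (x y : E).

(** The coordinates are indexed by all the vertices of the mesh and vanish off [T]; sums then need
    no reindexing and the coordinates of different cells can be compared. *)
Record barycentric T (b : I -> E -> R) : Prop := Barycentric {
  bary_out_ : forall i x, i \notin T -> b i x = 0 ;
  bary_sum1_ : forall x, \sum_i b i x = 1 ;
  bary_point_ : forall x, \sum_i b i x *: vert i = x ;
  bary_affine_ : forall i, exists (c : R) (u : E), forall x, b i x = c + dotp u x }.

Lemma sum_enum_val T (u : 'I_#|T| -> R) (V : lmodType R) (F : I -> V) :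
  \sum_i (\sum_k u k * (enum_val k == i)%:R) *: F i = \sum_k u k *: F (enum_val k).
Proof.
under eq_bigr do rewrite scaler_suml; rewrite exchange_big/=; apply: eq_bigr => k _.
rewrite (bigD1 (enum_val k))//= eqxx mulr1 big1 ?addr0// => i ik.
by rewrite eq_sym (negbTE ik) mulr0 scale0r.
Qed.

Lemma sum_enum_val_out T (u : 'I_#|T| -> R) i : i \notin T ->
  \sum_k u k * (enum_val k == i)%:R = 0.
Proof.
move=> iT; rewrite big1// => k _.
by rewrite (_ : _ == i = false) ?mulr0//; apply: contraNF iT => /eqP <-; exact: enum_valP.
Qed.

(** The square matrix with rows [(1, vertex)] has independent rows by nondegeneracy, hence is
    invertible; the coordinates of [x] are [(1, x)] times its inverse, and so are affine in [x]. *)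
Lemma barycentric_ex T : T \in cells Th -> exists b, barycentric T b.
Proof.
move=> cT; pose A : 'M[R]_(#|T|, 1 + d) :=
  \matrix_(k < #|T|) (row_mx (1%:M : 'M[R]_1) (vert (enum_val k))).
have mulA (u : 'rV[R]_(#|T|)) : u *m A =
    row_mx ((\sum_k u ord0 k)%:M : 'M[R]_1) (\sum_k u ord0 k *: vert (enum_val k)).
  apply/rowP => j; rewrite mxE; have [l ->|l ->] := split_ordP j.
    rewrite row_mxEl (ord1 l) mxE eqxx mulr1n; apply: eq_bigr => k _.
    by rewrite mxE row_mxEl mxE eqxx mulr1n mulr1.
  rewrite row_mxEr summxE; apply: eq_bigr => k _.
  by rewrite mxE row_mxEr mxE.
have sum1E (u : 'I_#|T| -> R) : \sum_i \sum_k u k * (enum_val k == i)%:R = \sum_k u k.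
  have := @sum_enum_val T u R^o (fun=> 1); rewrite /GRing.scale/=.
  by under eq_bigr do rewrite mulr1; under [RHS]eq_bigr do rewrite mulr1.
have Afree : row_free A.
  apply/inj_row_free => u; rewrite mulA => u0.
  pose l (i : I) := \sum_k u ord0 k * (enum_val k == i)%:R.
  have l0 : forall i, l i = 0.
    apply: (mesh_nondegenerate hTh cT); first by move=> i; exact: sum_enum_val_out.
    - rewrite sum1E; have := congr1 (fun M => lsubmx M ord0 ord0) u0.
      by rewrite row_mxKl mxE eqxx mulr1n linear0 mxE.
    - by rewrite sum_enum_val; have := congr1 rsubmx u0; rewrite row_mxKr linear0.
  apply/rowP => k; rewrite mxE -(l0 (enum_val k)) /l (bigD1 k)//= eqxx mulr1 big1 ?addr0// => j jk.
  by rewrite (_ : _ == _ = false) ?mulr0//; apply: contraNF jk => /eqP/enum_val_inj ->.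
have : row_full A by rewrite /row_full (eqP Afree) (mesh_card hTh cT).
move=> /row_fullP[B BA].
pose lam (x : E) := row_mx (1%:M : 'M[R]_1) x *m B.
have lamA x : lam x *m A = row_mx (1%:M : 'M[R]_1) x by rewrite -mulmxA BA mulmx1.
exists (fun i x => \sum_k lam x ord0 k * (enum_val k == i)%:R); split.
- by move=> i x; exact: sum_enum_val_out.
- move=> x; rewrite sum1E; have := congr1 (fun M => lsubmx M ord0 ord0) (lamA x).
  by rewrite mulA !row_mxKl !mxE eqxx !mulr1n.
- by move=> x; rewrite sum_enum_val; have := congr1 rsubmx (lamA x); rewrite mulA !row_mxKr.
- move=> i.
  exists (\sum_k (usubmx B) ord0 k * (enum_val k == i)%:R).
  exists (\row_j \sum_k (dsubmx B) j k * (enum_val k == i)%:R) => x.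
  rewrite /dotp (eq_bigr (fun k => (usubmx B) ord0 k * (enum_val k == i)%:R +
     \sum_j x ord0 j * (dsubmx B) j k * (enum_val k == i)%:R)); last first.
    move=> k _; rewrite /lam -[B in LHS]vsubmxK mul_row_col mul1mx mxE mulrDl; congr (_ + _).
    by rewrite mxE mulr_suml.
  rewrite big_split/=; congr (_ + _); rewrite exchange_big/=; apply: eq_bigr => j _.
  rewrite mxE mulr_suml; apply: eq_bigr => k _; ring.
Qed.

Definition bary T : I -> E -> R := xget (fun _ _ => 0) [set b | barycentric T b].

Lemma baryP T : T \in cells Th -> barycentric T (bary T).
Proof.
by move=> /barycentric_ex [b Tb]; exact: (@xgetPex _ _ [set b | barycentric T b] (ex_intro _ b Tb)).
Qed.

Lemma bary_out T i x : T \in cells Th -> i \notin T -> bary T i x = 0.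
Proof. by move=> /baryP; move: (bary T) => b Tb; exact: (bary_out_ Tb). Qed.

Lemma bary_sum1 T x : T \in cells Th -> \sum_i bary T i x = 1.
Proof. by move=> /baryP; move: (bary T) => b Tb; exact: (bary_sum1_ Tb). Qed.

Lemma bary_point T x : T \in cells Th -> \sum_i bary T i x *: vert i = x.
Proof. by move=> /baryP; move: (bary T) => b Tb; exact: (bary_point_ Tb). Qed.

Lemma bary_affine T i : T \in cells Th ->
  exists (c : R) (u : E), forall x, bary T i x = c + dotp u x.
Proof. by move=> /baryP; move: (bary T) => b Tb; exact: (bary_affine_ Tb). Qed.

Lemma bary_unique T (l : I -> R) : T \in cells Th ->
  (forall i, i \notin T -> l i = 0) -> \sum_i l i = 1 ->
  forall i, bary T i (\sum_j l j *: vert j) = l i.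
Proof.
move=> cT lT l1 i; set x := \sum_j _; apply/eqP; rewrite -subr_eq0; apply/eqP.
apply: (mesh_nondegenerate hTh cT (l := fun i => bary T i x - l i)).
- by move=> j jT; rewrite bary_out// lT// subrr.
- by rewrite sumrB bary_sum1// l1 subrr.
- by under eq_bigr do rewrite scalerBl; rewrite sumrB bary_point// subrr.
Qed.

Lemma dotpBl (x y z : E) : dotp (x - y) z = dotp x z - dotp y z.
Proof. by rewrite -(scaleN1r y) dotpDl dotpZl mulN1r. Qed.

Lemma bary_line T i x y t : T \in cells Th ->
  bary T i (x + t *: (y - x)) = bary T i x + t * (bary T i y - bary T i x).
Proof.
move=> /(bary_affine i)[c [u bE]]; rewrite !bE !(dotpC u) dotpDl dotpZl.
by rewrite dotpBl; ring.
Qed.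

Lemma bary_continuous T i : T \in cells Th -> continuous (bary T i).
Proof.
move=> /(bary_affine i)[c [u bE]]; apply: (@lip_on_continuous _ _ (\sum_j `|u ord0 j|)).
move=> x y _ _; rewrite !bE opprD addrACA subrr add0r !(dotpC u) -dotpBl /dotp.
rewrite mulr_suml (le_trans (ler_norm_sum _ _ _))//; apply: ler_sum => j _.
by rewrite normrM mulrC ler_wpM2l// coord_le_norm.
Qed.

Lemma simplexP T x : T \in cells Th ->
  simplex T x <-> forall i, 0 <= bary T i x.
Proof.
move=> cT; split=> [[l [l0 lT l1 ->]] i|b0]; first by rewrite bary_unique.
by exists (bary T ^~ x); split=> //; [move=> i; exact: bary_out|exact: bary_sum1|rewrite bary_point].
Qed.

Lemma simplex_closed T : T \in cells Th -> closed (simplex T).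
Proof.
move=> cT; rewrite (_ : simplex T = \bigcap_(i in [set: I]) bary T i @^-1` [set t | 0 <= t]).
  apply: closed_bigI => i _; apply: closed_comp; last exact: closed_ge.
  by move=> x _; exact: bary_continuous.
by apply/seteqP; split=> [x /(simplexP _ cT) x0 i _|x x0]; [exact: x0|apply/(simplexP _ cT) => i; exact: x0].
Qed.

Lemma simplex_measurable T : T \in cells Th -> measurable (simplex T).
Proof. by move=> cT; apply: rV_closed_measurable; exact: simplex_closed. Qed.

(** The open cell is given by strict inequalities instead of a topological interior, so that its
    properties reduce to signs of coordinates. *)
Definition inner_cell T : set E := [set x | forall i, i \in T -> 0 < bary T i x].

Lemma inner_cell_open T : T \in cells Th -> open (inner_cell T).
Proof.
move=> cT; rewrite openE => x Tx; rewrite /interior.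
apply: (@filter_forall E I (fun i y => i \in T -> 0 < bary T i y) (nbhs x)) => i.
have [iT|iT] := boolP (i \in T); last exact: nearW.
have H : nbhs x (bary T i @^-1` [set t | 0 < t]).
  by apply: (bary_continuous cT); exact: lt_nbhsr (Tx i iT).
by apply: (@filterS E (nbhs x) (nbhs_filter x) _ _ _ H) => y.
Qed.

Lemma inner_cell_sub T : T \in cells Th -> inner_cell T `<=` simplex T.
Proof.
move=> cT x Tx; apply/(simplexP _ cT) => i.
by have [/Tx/ltW//|iT] := boolP (i \in T); rewrite bary_out.
Qed.

Lemma bary_vertex T i j : T \in cells Th -> i \in T -> bary T j (vert i) = (j == i)%:R.
Proof.
move=> cT iT; pose l (j : I) : R := (j == i)%:R.
have -> : vert i = \sum_j l j *: vert j.
  rewrite (bigD1 i)//= /l eqxx scale1r big1 ?addr0// => k ki.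
  by rewrite (negbTE ki) scale0r.
apply: bary_unique => //.
  by move=> k kT; rewrite /l (_ : _ == _ = false)//; apply: contraNF kT => /eqP ->.
by rewrite (bigD1 i)//= /l eqxx big1 ?addr0// => k /negbTE ->.
Qed.

Lemma inner_cell_nonempty T : T \in cells Th -> inner_cell T !=set0.
Proof.
move=> cT; pose l (i : I) : R := (i \in T)%:R / d.+1%:R.
exists (\sum_j l j *: vert j) => i iT; rewrite bary_unique//.
- by rewrite /l iT mul1r.
- by move=> j /negbTE jT; rewrite /l jT mul0r.
- rewrite -mulr_suml -natr_sum -big_mkcond/= sum1_card (mesh_card hTh cT).
  by rewrite mulfV// pnatr_eq0.
Qed.

Lemma simplex_line_inner T x c t : T \in cells Th -> simplex T x -> inner_cell T c ->
  0 < t -> t <= 1 -> inner_cell T (x + t *: (c - x)).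
Proof.
move=> cT /(simplexP _ cT) x0 c0 t0 t1 i iT; rewrite bary_line//.
have := x0 i; have := c0 i iT; set a := bary T i x; set b := bary T i c => b0 a0.
have -> : a + t * (b - a) = (1 - t) * a + t * b by ring.
by rewrite ltr_wpDl ?mulr_gt0// mulr_ge0// subr_ge0.
Qed.

(** Along the direction from a zero [x] towards the vertex [i], the affine coordinate grows at rate
    1, so its zero set is disjoint from its translates. *)
Lemma bary_neq0_ae T i : T \in cells Th -> i \in T ->
  {ae mu, forall x, bary T i x != 0}.
Proof.
move=> cT iT; have m0 : measurable [set x | bary T i x = 0].
  apply: rV_closed_measurable; rewrite (_ : mkset _ = bary T i @^-1` [set 0])//.
  by apply: closed_comp; [move=> x _; exact: bary_continuous|exact: closed_eq].
exists [set x | bary T i x = 0]; split=> //; last by move=> x /= /negP; rewrite negbK => /eqP.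
apply: locally_shiftfree_null => //= x bx; exists 1, (vert i - x); split=> // y t t0 _ _ by0.
have [c [u bE]] := bary_affine i cT.
have := bary_vertex i cT iT; rewrite eqxx mulr1n.
move: bx by0; rewrite !bE !(dotpC u) dotpDl dotpZl dotpBl => bx by0 b1.
have -> : dotp (vert i) u - dotp x u = 1 by lra.
by rewrite mulr1; lra.
Qed.

Lemma inner_cell_ae T : T \in cells Th ->
  {ae mu, forall x, simplex T x -> inner_cell T x}.
Proof.
move=> cT; have H i : {ae mu, forall x, i \in T -> bary T i x != 0}.
  have [iT|iT] := boolP (i \in T); last exact: aeW.
  by apply: filterS (bary_neq0_ae cT iT) => x.
apply: filterS (filter_forall _ H) => x Hx /(simplexP _ cT) x0 i iT.
by rewrite lt_def Hx// x0.
Qed.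

Lemma cell_extra_vertex T T' : T \in cells Th -> T' \in cells Th -> T != T' ->
  exists2 i, i \in T & i \notin T'.
Proof.
move=> cT cT' TT'; have /subsetPn[i iT iT'] : ~~ (T \subset T'); last by exists i.
apply: contra TT' => sTT'; rewrite eqEcard sTT'/=.
by rewrite (mesh_card hTh cT) (mesh_card hTh cT').
Qed.

(** The two simplices meet in the simplex on their common vertices, so [x] is a combination of these
    alone, and coordinates are unique. The matching of the mesh enters through this fact. *)
Lemma simplexI_bary0 T T' i x : T \in cells Th -> T' \in cells Th ->
  simplex T x -> simplex T' x -> i \notin T' -> bary T i x = 0.
Proof.
move=> cT cT' Tx T'x iT'.
have : simplex (T :&: T') x by rewrite -(mesh_matching hTh).
move=> [l [l0 lT l1 ->]]; rewrite bary_unique//; last first.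
  by move=> j jT; apply: lT; rewrite inE negb_and jT.
by apply: lT; rewrite inE negb_and iT' orbT.
Qed.

Lemma inner_cell_disjoint T T' x : T \in cells Th -> T' \in cells Th ->
  inner_cell T x -> simplex T' x -> T = T'.
Proof.
move=> cT cT' Tx T'x; apply/eqP; apply: contraT => /(cell_extra_vertex cT cT')[i iT iT'].
have := Tx i iT; rewrite (simplexI_bary0 cT cT' (inner_cell_sub cT Tx) T'x iT').
by rewrite ltxx.
Qed.

Section domain.
Hypotheses (oO : open Omega) (rO : (closure Omega)° `<=` Omega).

Lemma cell_sub_closure T : T \in cells Th -> simplex T `<=` closure Omega.
Proof. by move=> cT x Tx; rewrite (mesh_cover hTh); exists T. Qed.

Lemma closure_in_cell x : closure Omega x -> exists2 T, T \in cells Th & simplex T x.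
Proof. by rewrite (mesh_cover hTh) => -[T cT Tx]; exists T. Qed.

Lemma inner_cell_Omega T : T \in cells Th -> inner_cell T `<=` Omega.
Proof.
move=> cT; apply: subset_trans rO.
rewrite -open_subsetE; last exact: inner_cell_open.
exact: subset_trans (inner_cell_sub cT) (cell_sub_closure cT).
Qed.

Lemma patch_open a : open (@Defs.patch R d Th a).
Proof. exact: open_interior. Qed.

Lemma patch_sub_cells a x : @Defs.patch R d Th a x ->
  exists T, [/\ T \in cells Th, a \in T & simplex T x].
Proof. by move=> /interior_subset[T [cT aT] Tx]; exists T. Qed.

Lemma patch_sub_Omega a : @Defs.patch R d Th a `<=` Omega.
Proof.
apply: subset_trans rO; apply: interiorS => x [T [cT _] Tx].
exact: (cell_sub_closure cT).
Qed.

Lemma inner_cell_patch a T : T \in cells Th -> a \in T -> inner_cell T `<=` @Defs.patch R d Th a.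
Proof.
move=> cT aT; rewrite /patch -open_subsetE; last exact: inner_cell_open.
by move=> x /(inner_cell_sub cT) Tx; exists T.
Qed.

Lemma inner_cell_not_patch a T x : T \in cells Th -> a \notin T ->
  inner_cell T x -> ~ @Defs.patch R d Th a x.
Proof.
move=> cT aT Tx /patch_sub_cells[T' [cT' aT' T'x]].
by move: aT; rewrite (inner_cell_disjoint cT cT' Tx T'x) aT'.
Qed.

Lemma Omega_inner_ae : {ae mu, forall x, Omega x -> exists2 T, T \in cells Th & inner_cell T x}.
Proof.
have H T : {ae mu, forall x, T \in cells Th -> simplex T x -> inner_cell T x}.
  have [cT|cT] := boolP (T \in cells Th); last exact: aeW.
  by apply: filterS (inner_cell_ae cT) => x Hx _.
apply: filterS (filter_forall _ H) => x Hx Ox.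
have /closure_in_cell[T cT Tx] : closure Omega x by exact: subset_closure.
by exists T => //; exact: Hx.
Qed.

Lemma simplex_bary_eq T T' x i : T \in cells Th -> T' \in cells Th ->
  simplex T x -> simplex T' x -> bary T' i x = bary T i x.
Proof.
move=> cT cT' Tx T'x; rewrite -{1}(bary_point x cT); apply: bary_unique => //.
  by move=> j jT'; exact: (simplexI_bary0 cT cT' Tx T'x).
exact: bary_sum1.
Qed.

(* The homothety of centre [vert a] and small ratio [t] maps [x] into [Omega];
   as the cells containing its image are cones with apex [vert a] near [x], they
   cover a neighbourhood of [x]. *)
Lemma interior_vertex_bary a T x : Omega (vert a) -> T \in cells Th ->
  simplex T x -> 0 < bary T a x -> Omega x.
Proof.
move=> Oa cT Tx bax; have aT : a \in T.
  by apply: contraTT bax => aT; rewrite bary_out// ltxx.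
pose H t (y : E) := vert a + t *: (y - vert a).
have [t [t0 t1 Oz]] : exists t, [/\ 0 < t, t <= 1 & Omega (H t x)].
  have /nbhs_ballP[e /= e0 eO] : nbhs (vert a) Omega by exact: open_nbhs_nbhs.
  pose c := `|x - vert a| + 1; have c0 : 0 < c by rewrite ltr_wpDl.
  exists (Num.min 1 (e / c)); split; [by rewrite lt_min ltr01 divr_gt0|by rewrite ge_min lexx|].
  apply: eO; apply/ball_norm_rV; rewrite /H opprD addNKr normrN normrZ.
  rewrite ger0_norm ?le_min ?ler01 ?divr_ge0 ?(ltW e0) ?(ltW c0)//.
  rewrite (@le_lt_trans _ _ (e / c * `|x - vert a|))//.
    by rewrite ler_wpM2r// ge_min lexx orbT.
  by rewrite mulrAC ltr_pdivrMr// ltr_pM2l// ltrDl.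
set z := H t x in Oz.
have bH T' i y : T' \in cells Th -> bary T' i (H t y) =
    (1 - t) * bary T' i (vert a) + t * bary T' i y.
  by move=> cT'; rewrite /H bary_line//; ring.
have Tz : simplex T z.
  apply/(simplexP _ cT) => i; rewrite bH// bary_vertex//.
  by rewrite addr_ge0// mulr_ge0 ?subr_ge0 ?(ltW t0)//; move/(simplexP _ cT): Tx.
(* The coordinate of [z] at [a] is positive, so by matching every cell through [z] has the vertex
   [a]. The two cells give [z] the same coordinates and [H t] is affine with fixed point [vert a],
   so they also give [x] the same coordinate at [a]. *)
have cellz T' : T' \in cells Th -> simplex T' z -> a \in T' /\ 0 < bary T' a x.
  move=> cT' T'z; have baz : 0 < bary T a z.
    by rewrite bH// bary_vertex// eqxx mulr1 ltr_wpDl ?mulr_gt0// subr_ge0.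
  have aT' : a \in T'.
    by apply: contraTT baz => aT'; rewrite (simplexI_bary0 cT cT' Tz T'z aT') ltxx.
  split=> //; have := simplex_bary_eq a cT cT' Tz T'z.
  rewrite !bH// !bary_vertex// => /addrI /mulfI ->//; exact: lt0r_neq0.
apply: rO; rewrite /interior.
have cH : {for x, continuous (H t)}.
  move=> A /nbhs_ballP[e /= e0 eA]; apply/nbhs_ballP; exists e => // y /ball_norm_rV xy.
  apply: eA; apply/ball_norm_rV; rewrite /H opprD addrACA subrr add0r -scalerBr.
  rewrite opprB addrA subrK normrZ ger0_norm ?(ltW t0)//.
  by rewrite (le_lt_trans _ xy)// ler_piMl.
have N1 : nbhs x [set y | forall T', T' \in cells Th -> simplex T' z -> 0 < bary T' a y].
  apply: (@filter_forall E _ (fun T' y => T' \in cells Th -> simplex T' z -> 0 < bary T' a y)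
    (nbhs x) (nbhs_filter x)) => T'.
  have [cT'|cT'] := boolP (T' \in cells Th); last exact: nearW.
  have [T'z|T'z] := pselect (simplex T' z); last exact: nearW.
  have B : nbhs x (bary T' a @^-1` [set s | 0 < s]).
    by apply: (bary_continuous cT'); apply: lt_nbhsr; have [] := cellz T' cT' T'z.
  by apply: (@filterS E (nbhs x) (nbhs_filter x) _ _ _ B) => y.
have N2 : nbhs x (H t @^-1` Omega) by apply: cH; exact: open_nbhs_nbhs.
have N3 : nbhs x (H t @^-1` [set y | forall T', T' \in cells Th -> simplex T' y -> simplex T' z]).
  apply: cH.
  apply: (@filter_forall E _ (fun T' y => T' \in cells Th -> simplex T' y -> simplex T' z)
    (nbhs z) (nbhs_filter z)) => T'.
  have [cT'|cT'] := boolP (T' \in cells Th); last exact: nearW.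
  have [T'z|T'z] := pselect (simplex T' z); first exact: nearW.
  have B : nbhs z (~` simplex T').
    by apply: open_nbhs_nbhs; split=> //; apply/closed_openC/simplex_closed.
  by apply: (@filterS E (nbhs z) (nbhs_filter z) _ _ _ B) => y.
apply: (@filterS3 E (nbhs x) (nbhs_filter x) _ _ _ _ _ N1 N2 N3) => y y1 y2 y3.
have /closure_in_cell[T' cT' T'Hy] : closure Omega (H t y) by exact: subset_closure.
have T'z := y3 T' cT' T'Hy; have [aT' _] := cellz T' cT' T'z.
(* The point [y] lies in the cell of [H t y]: its coordinate at [a] is positive by the choice of the
   neighbourhood, and every other one is that of [H t y] divided by [t]. *)
apply: (cell_sub_closure cT'); apply/(simplexP _ cT') => i.
have [->|ia] := eqVneq i a; first by apply/ltW/y1.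
move/(simplexP _ cT'): T'Hy => /(_ i); rewrite bH// bary_vertex// (negbTE ia) mulr0 add0r.
by rewrite pmulr_rge0.
Qed.

End domain.

End mesh_geometry.

(** * Polynomials *)

Section polynomials.
Context {R : realType} {d : nat}.
Local Notation E := 'rV[R]_d.
Local Notation e_ i := (delta_mx ord0 i : 'rV[R]_d).
Local Notation poly := (mpoly d R).
Local Notation X_ j := (mpolyX R (mnm1 j) : poly).
Implicit Types (P Q : poly) (x y : E).

Lemma pevalD P Q x : peval (P + Q) x = peval P x + peval Q x.
Proof. exact: mevalD. Qed.

Lemma pevalN P x : peval (- P) x = - peval P x.
Proof. exact: mevalN. Qed.

Lemma pevalM P Q x : peval (P * Q) x = peval P x * peval Q x.
Proof. exact: mevalM. Qed.

Lemma pevalZ c P x : peval (c *: P) x = c * peval P x.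
Proof. exact: mevalZ. Qed.

Lemma pevalX j x : peval (X_ j) x = x ord0 j.
Proof. exact: mevalXU. Qed.

Lemma peval1 x : peval (1 : poly) x = 1.
Proof. exact: meval1. Qed.

Lemma peval0 x : peval (0 : poly) x = 0.
Proof. exact: meval0. Qed.

Lemma peval_sum (J : Type) (s : seq J) (F : J -> poly) x :
  peval (\sum_(j <- s) F j) x = \sum_(j <- s) peval (F j) x.
Proof. by elim/big_rec2: _ => [|j u v _ <-]; rewrite ?peval0// pevalD. Qed.

(** Building polynomials from 1 by sums, scalings and multiplication by one variable spares a
    separate treatment of monomials in proofs about regularity and derivatives. *)
Lemma mpoly_ring_ind (S : poly -> Prop) : S 1 -> (forall P Q, S P -> S Q -> S (P + Q)) ->
  (forall c P, S P -> S (c *: P)) -> (forall j P, S P -> S (X_ j * P)) ->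
  forall P, S P.
Proof.
move=> S1 SD SZ SX; have S0 : S 0 by rewrite -(scale0r (1 : poly)); exact: SZ.
elim/mpolyind => // c m P _ _ SP; apply: SD => //; apply: SZ.
rewrite mpolyXE_id; elim/big_rec: _ => // j Q _ SQ.
by elim: (fun_of_multinom m j) => [|k IH]; rewrite ?expr0 ?mul1r// exprS -mulrA; exact: SX.
Qed.

Lemma Ck_peval k P : Ck k (peval P).
Proof.
elim/mpoly_ring_ind: P => [|P Q CP CQ|c P CP|j P CP].
- by rewrite (_ : peval _ = cst 1); [exact: Ck_cst|apply/funext => x; exact: peval1].
- rewrite (_ : peval _ = fun x => peval P x + peval Q x); first exact: Ck_add.
  by apply/funext => x; exact: pevalD.
- rewrite (_ : peval _ = fun x => cst c x * peval P x).
    by apply: Ck_mul => //; exact: Ck_cst.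
  by apply/funext => x; exact: pevalZ.
- rewrite (_ : peval _ = fun x => x ord0 j * peval P x).
    apply: Ck_mul => //; apply: (@Ck_coord _ _ k id) => l; elim: l => [|l _] /=.
      by move=> x; exact: cvg_id.
    exists (cst 1); first by move=> t; exact: is_derive_id.
    elim: l => [|l IH] /=; first by move=> x; exact: cvg_cst.
    exists (cst 0); first by move=> t; exact: is_derive_cst.
    elim: l {IH} => [|l IH] /=; first by move=> x; exact: cvg_cst.
    by exists (cst 0) => // t; exact: is_derive_cst.
  by apply/funext => x; rewrite pevalM pevalX.
Qed.

Lemma mderivXU (i j : 'I_d) : mderiv i (X_ j) = (i == j)%:R :> poly.
Proof.
rewrite mderivX mnm1E eq_sym; case: eqVneq => [->|_]; last by rewrite scale0r.
rewrite scale1r (_ : mnm_sub _ _ = mnm0) ?mpolyX0//.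
by apply/mnmP => k; rewrite mnmBE subnn mnm0E.
Qed.

Lemma is_derive_peval i P x : is_derive x (e_ i) (peval P) (peval (mderiv i P) x).
Proof.
elim/mpoly_ring_ind: P => [|P Q dP dQ|c P dP|j P dP].
- rewrite mderivC peval0 (_ : peval _ = cst 1); last by apply/funext => y; exact: peval1.
  exact: is_derive_cst.
- rewrite mderivD pevalD (_ : peval _ = peval P + peval Q); first exact: is_deriveD.
  by apply/funext => y; exact: pevalD.
- rewrite mderivZ pevalZ (_ : peval _ = c *: peval P); first exact: is_deriveZ.
  by apply/funext => y; exact: pevalZ.
- rewrite mderivM pevalD !pevalM mderivXU pevalX.
  have E0 : peval (X_ j * P) = (fun y : E => y ord0 j) * peval P.
    by apply/funext => y; rewrite pevalM pevalX.
  have dc := @is_derive_coord R d id j i x 1 (is_derive_id _ _).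
  rewrite E0; apply: is_derive_eq; rewrite /GRing.scale/= mulr1.
  by rewrite addrC; congr (_ + _); rewrite mulrC; congr (_ * _); case: eqP => _; rewrite ?peval1 ?peval0.
Qed.

Lemma deg_leD p P Q : deg_le p P -> deg_le p Q -> deg_le p (P + Q).
Proof.
move=> dP dQ; apply: (leq_trans (mmeasureD_le _ _ _)).
by rewrite geq_max; apply/andP.
Qed.

Lemma deg_leZ p c P : deg_le p P -> deg_le p (c *: P).
Proof. exact/leq_trans/mmeasureZ_le. Qed.

Lemma deg_leN p P : deg_le p P -> deg_le p (- P).
Proof. by rewrite /deg_le mmeasureN. Qed.

Lemma deg_le1 p : deg_le p (1 : poly).
Proof. by rewrite /deg_le mmeasure1. Qed.

Lemma deg_le0 p : deg_le p (0 : poly).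
Proof. by rewrite /deg_le mmeasure0. Qed.

Lemma deg_leW p q P : (p <= q)%N -> deg_le p P -> deg_le q P.
Proof. by move=> pq dP; exact: leq_trans dP _. Qed.

Lemma deg_le_sum p (J : Type) (s : seq J) (F : J -> poly) :
  (forall j, deg_le p (F j)) -> deg_le p (\sum_(j <- s) F j).
Proof.
by move=> dF; elim/big_rec: _ => [|j P _ dP]; [exact: deg_le0|exact: deg_leD].
Qed.

Lemma mmeasure_mderiv i P : (mmeasure mdeg (mderiv i P) <= (mmeasure mdeg P).-1)%N.
Proof.
rewrite mmeasureE big_seq; elim/big_ind: _ => // [a b ha hb|m].
  by rewrite geq_max ha.
rewrite -[_ \in _]negbK -mcoeff_eq0 mcoeff_deriv => nz.
have /(mmeasure_mnm_lt mdeg) : (mnm_add m (mnm1 i)) \in msupp P.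
  by rewrite -[_ \in _]negbK -mcoeff_eq0; apply: contra_neq nz => ->; rewrite mul0rn.
by rewrite /= mdegD mdeg1 addn1; case: (mmeasure _ _).
Qed.

Lemma deg_le_mderiv p i P : deg_le p P -> deg_le p (mderiv i P).
Proof.
move=> dP; apply: (leq_trans (mmeasure_mderiv i P)).
by apply: leq_trans dP; exact: leq_pred.
Qed.

(** Multiplying by a variable raises the degree by one and differentiating lowers it again; this
    keeps the divergence of a Raviart-Thomas field within degree [p]. The zero polynomial is treated
    apart, since the size of a product is computed for nonzero factors. *)
Lemma deg_le_mderivXM p i P : deg_le p P -> deg_le p (mderiv i (X_ i * P)).
Proof.
move=> dP; have [->|Xn0] := eqVneq P 0; first by rewrite mulr0 mderiv0; exact: deg_le0.
apply: (leq_trans (mmeasure_mderiv i _)).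
have X0 : X_ i != 0 by rewrite -(@mmeasure_poly_eq0 _ _ mdeg) mmeasureX.
move: dP; rewrite /deg_le (msizeM X0 Xn0) mmeasureX /= mdeg1.
by rewrite add1n.
Qed.

(** The monomials involved are 1 and the coordinates: the former uses that the weights add up to 1,
    the latter are linear. *)
Lemma peval_affine (J : finType) (l : J -> R) (v : J -> E) P : deg_le 1 P ->
  \sum_j l j = 1 -> peval P (\sum_j l j *: v j) = \sum_j l j * peval P (v j).
Proof.
move=> dP l1.
have lin (F : E -> R) : (forall x y, F (x + y) = F x + F y) -> (forall c x, F (c *: x) = c * F x) ->
    F (\sum_j l j *: v j) = \sum_j l j * F (v j).
  move=> FD FZ; elim/big_rec2: _ => [|j a b _ <-]; last by rewrite FD FZ.
  by rewrite -(scale0r (0 : E)) FZ mul0r.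
have mon (m : multinom d) : (mdeg m <= 1)%N -> peval (mpolyX R m) (\sum_j l j *: v j) =
    \sum_j l j * peval (mpolyX R m) (v j).
  rewrite leq_eqVlt ltnS leqn0 mdeg_eq0 => /orP[|/eqP ->]; last first.
    rewrite mpolyX0 peval1 -[LHS]l1; apply: eq_bigr => j _.
    by rewrite peval1 mulr1.
  move=> /mdeg1P[i /eqP ->].
  have -> : peval (mpolyX R (mnm1 i)) = (fun x => x ord0 i) by apply/funext => x; exact: pevalX.
  by apply: (lin (fun x : E => x ord0 i)) => [x y|c x]; rewrite mxE.
rewrite [P in LHS]mpolyE peval_sum.
transitivity (\sum_j l j * \sum_(m <- msupp P) mcoeff m P * peval (mpolyX R m) (v j)).
  under [RHS]eq_bigr do rewrite mulr_sumr.
  rewrite exchange_big/= big_seq [RHS]big_seq; apply: eq_bigr => m mP.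
  rewrite pevalZ mon; last by have := leq_trans (mmeasure_mnm_lt mdeg mP) dP.
  by rewrite mulr_sumr; apply: eq_bigr => j _; rewrite mulrCA.
apply: eq_bigr => j _; rewrite [P in RHS]mpolyE peval_sum.
by congr (_ * _); apply: eq_bigr => m _; rewrite pevalZ.
Qed.

End polynomials.

(** * Piecewise polynomial functions *)

Section piecewise_polynomials.
Context {R : realType} {d : nat}.
Local Notation E := 'rV[R]_d.
Local Notation mu := (@lebesgue_rV R d).
Local Notation e_ i := (delta_mx ord0 i : 'rV[R]_d).
Variables (Omega : set E) (Th : mesh R d).
Hypothesis hTh : simplicial_mesh Omega Th.
Hypotheses (oO : open Omega) (bO : bounded_set Omega).
Local Notation I := 'I_(nvertices Th).
Local Notation vert := (@vertex R d Th).
Local Notation poly := (mpoly d R).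
Implicit Types (T : {set I}) (a : I) (x y : E) (v : E -> R) (P : {set I} -> poly).

Let mO : measurable Omega. Proof. exact: rV_open_measurable. Qed.
Let Ooo : (mu Omega < +oo)%E. Proof. exact: lebesgue_rV_bounded_lty. Qed.
Let OcO : Omega `<=` closure Omega. Proof. exact: subset_closure. Qed.

Lemma within_continuous_normP (A : set E) v : {within A, continuous v} ->
  forall x, A x -> forall e, 0 < e ->
    exists2 r, 0 < r & forall y, A y -> `|x - y| < r -> `|v x - v y| < e.
Proof.
move=> /subspace_continuousP cv x Ax e e0.
have /cvgrPdist_lt /(_ _ e0) := cv x Ax.
move=> /nbhs_ballP[r /= r0 xr]; exists r => // y Ay xy.
by apply: xr => //; apply/ball_norm_rV.
Qed.

Lemma within_continuous_measurable v : {within closure Omega, continuous v} ->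
  measurable_fun Omega v.
Proof.
move=> cv; apply: rV_open_continuous_measurable => // x Ox; apply/rV_continuous_atP => e e0.
have [r r0 xr] := within_continuous_normP cv (OcO Ox) e0.
have /nbhs_ballP[s /= s0 xs] : nbhs x Omega by exact: open_nbhs_nbhs.
exists (Num.min r s); first by rewrite lt_min r0.
move=> y; rewrite lt_min => /andP[xyr xys]; apply: xr => //.
by apply: OcO; apply: xs; apply/ball_norm_rV.
Qed.

Lemma boundary_zero_extension v x : (forall y, boundary Omega y -> v y = 0) ->
  closure Omega x -> (v \_ Omega) x = v x.
Proof.
move=> v0 cx; rewrite patchE; case: ifPn => // /negP nO; rewrite v0//; split=> //.
by move/interior_subset => Ox; apply: nO; rewrite inE.
Qed.

Lemma continuous_zero_extension v : {within closure Omega, continuous v} ->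
  (forall x, boundary Omega x -> v x = 0) -> continuous (v \_ Omega).
Proof.
move=> cv v0; pose g := v \_ Omega.
have gO x : closure Omega x -> g x = v x by exact: boundary_zero_extension.
have gN x : ~ Omega x -> g x = 0.
  by move=> nO; rewrite /g patchE ifN//; apply/negP; rewrite inE.
move=> x; apply/rV_continuous_atP => e e0; rewrite -/g.
have near (U : set E) : open U -> U x -> exists2 r, 0 < r & forall y, `|x - y| < r -> U y.
  move=> oU Ux; have /nbhs_ballP[r /= r0 xr] : nbhs x U by exact: open_nbhs_nbhs.
  by exists r => // y xy; apply: xr; apply/ball_norm_rV.
have [cx|ncx] := pselect (closure Omega x); last first.
  have [r r0 xr] := near (~` closure Omega) (closed_openC (@closed_closure _ _)) ncx.
  by exists r => // y /xr ny; rewrite !gN ?subrr ?normr0// => /OcO.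
have [r r0 xr] := within_continuous_normP cv cx e0.
have [Ox|nOx] := pselect (Omega x).
  have [s s0 xs] := near Omega oO Ox.
  exists (Num.min r s); first by rewrite lt_min r0.
  move=> y; rewrite lt_min => /andP[xyr /xs Oy].
  by rewrite !gO//; [apply: xr => //; exact: OcO|exact: OcO].
exists r => // y xy; have [cy|ncy] := pselect (closure Omega y).
  by rewrite !gO//; exact: xr.
by rewrite (gN x)// (gN y) ?subrr ?normr0// => /OcO.
Qed.

(** Any point of the closed cell, faces included, has arbitrarily close to it a nonempty open piece
    of the inner cell, reached by moving slightly towards an inner point. Such a piece has positive
    measure, so a discrepancy at the point would persist by continuity on a non-null set. *)
Lemma cell_polynomial_eq v T Q : {within closure Omega, continuous v} -> T \in cells Th ->
  {ae mu, forall x, simplex T x -> v x = peval Q x} ->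
  forall x, simplex T x -> v x = peval Q x.
Proof.
move=> cv cT vQ x Tx; apply: contrapT => /eqP; rewrite -subr_eq0 -normr_gt0 => ne.
set e := `|_| in ne; have e3 : 0 < e / 3 by rewrite divr_gt0.
have cx := cell_sub_closure hTh cT Tx.
have [r r0 xr] := within_continuous_normP cv cx e3.
have [s s0 xs] := (rV_continuous_atP _ x).1 (@Ck_continuous _ _ _ _ (Ck_peval 0 Q) x) _ e3.
pose m := Num.min r s; have m0 : 0 < m by rewrite lt_min r0.
pose U := inner_cell T `&` ball x m.
have oU : open U.
  by apply: openI; [exact: (inner_cell_open hTh cT)|exact: ball_open].
have [c Tc] := inner_cell_nonempty hTh cT.
have U0 : U !=set0.
  pose t := Num.min 1 (m / (`|c - x| + 1)).
  have t0 : 0 < t by rewrite lt_min ltr01 divr_gt0// ltr_wpDl.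
  exists (x + t *: (c - x)); split.
    by apply: (simplex_line_inner hTh) => //; rewrite ge_min lexx.
  apply/ball_norm_rV; rewrite opprD addrA subrr add0r normrN normrZ gtr0_norm//.
  have : t * (`|c - x| + 1) <= m.
    by rewrite -ler_pdivlMr ?ltr_wpDl// ge_min lexx orbT.
  by apply: lt_le_trans; rewrite ltr_pM2l// ltrDl.
have := lebesgue_rV_open_gt0 oU U0; rewrite measure_negligible ?eqxx//.
  exact: rV_open_measurable.
apply: negligibleS vQ => y [Ty /ball_norm_rV]; rewrite lt_min => /andP[xyr xys] /= H.
have Sy := inner_cell_sub hTh cT Ty.
have := xr _ (cell_sub_closure hTh cT Sy) xyr; have := xs _ xys.
rewrite (H Sy) distrC => h1 h2.
have : e <= `|v x - peval Q y| + `|peval Q y - peval Q x|.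
  by rewrite /e (le_trans _ (ler_normD _ _))// addrA subrK.
by lra.
Qed.

Lemma piecewise_polynomial p v : {within closure Omega, continuous v} ->
  (forall T, T \in cells Th -> poly_on p (simplex T) v) ->
  exists P, forall T, T \in cells Th ->
    deg_le p (P T) /\ forall x, simplex T x -> v x = peval (P T) x.
Proof.
move=> cv vp; suff /choice[P HP] : forall T, exists Q, T \in cells Th ->
  deg_le p Q /\ forall x, simplex T x -> v x = peval Q x by exists P.
move=> T; have [cT|cT] := boolP (T \in cells Th); last by exists 0.
have [Q dQ vQ] := vp T cT; exists Q => _; split=> //.
exact: cell_polynomial_eq.
Qed.

(* By the mean value theorem, the zeros of [Q] at which the derivative does not
   vanish form a set locally disjoint from its translates along [e_ i]. *)
Lemma critical_level0 (Q : poly) i :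
  {ae mu, forall x, peval Q x = 0 -> peval (mderiv i Q) x = 0}.
Proof.
pose S := [set x | peval Q x = 0 /\ peval (mderiv i Q) x != 0].
have mf U : measurable_fun setT (peval U).
  by apply: rV_continuous_measurable; exact: Ck_continuous (Ck_peval 0 U).
have mS : measurable S.
  rewrite (_ : S = (peval Q @^-1` [set 0]) `&` (peval (mderiv i Q) @^-1` (~` [set 0]))).
    apply: measurableI; rewrite -[X in measurable X]setTI; apply: mf => //.
    by apply: measurableC.
  by apply/seteqP; split=> x [Qx /eqP dx]; split=> //; apply/eqP.
exists S; split=> //; last first.
  by move=> x /= /not_implyP[Qx /eqP dx]; split.
apply: locally_shiftfree_null => // x [Qx dx].
have e0 : 0 < `|peval (mderiv i Q) x| by rewrite normr_gt0.
have [r r0 xr] := (rV_continuous_atP _ x).1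
  (@Ck_continuous _ _ _ _ (Ck_peval 0 (mderiv i Q)) x) _ e0.
exists r, (e_ i); split=> // y t t0 xy xyt [Qy _] [Qyt _].
have [s /andP[s0 s1]] := line_MVT y t (fun z => is_derive_peval i Q z).
rewrite Qy Qyt subrr => /esym/eqP; rewrite mulf_eq0 gt_eqF//= => /eqP dz.
suff /xr : `|x - (y + (s * t) *: e_ i)| < r by rewrite dz subr0 ltxx.
have -> : x - (y + (s * t) *: e_ i) = (1 - s) *: (x - y) + s *: (x - (y + t *: e_ i)).
  by apply/rowP => k; rewrite !mxE; ring.
move: xy xyt => /ball_norm_rV xy /ball_norm_rV xyt.
apply: (le_lt_trans (ler_normD _ _)); rewrite !normrZ !ger0_norm ?subr_ge0//.
have [->|s0'] := eqVneq s 0; first by rewrite mul0r addr0 subr0 mul1r.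
have h1 : s * `|x - (y + t *: e_ i)| < s * r by rewrite ltr_pM2l// lt_def s0'.
have h2 : (1 - s) * `|x - y| <= (1 - s) * r by apply: ler_wpM2l; [rewrite subr_ge0|exact: ltW].
lra.
Qed.

Lemma simplex_bounded : exists2 r, 0 < r & forall T, T \in cells Th -> simplex T `<=` ccube 0 r.
Proof.
have [r r0 Or] := bounded_set_cube bO; exists r => // T cT x /(cell_sub_closure hTh cT) cx.
have : closure (ccube 0 r) x.
  by apply: closure_subset cx => y /Or yr i; exact: ltW.
by apply: closed_ccube.
Qed.

Lemma lip_piecewise P : exists2 L, 0 <= L &
  forall T, T \in cells Th -> lip_on (simplex T) L (peval (P T)) /\
    forall x, simplex T x -> `|peval (P T) x| <= L.
Proof.
have [r r0 Tr] := simplex_bounded.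
have /choice[M HM] (j : {set I} * 'I_d) : exists M, 0 <= M /\
    forall x, ccube 0 r x -> `|peval (mderiv j.2 (P j.1)) x| <= M.
  have [M M0 HM] := continuous_bounded_ccube 0 r (Ck_continuous (Ck_peval 0 (mderiv j.2 (P j.1)))).
  by exists M.
have /choice[N HN] (T : {set I}) : exists N, 0 <= N /\
    forall x, ccube 0 r x -> `|peval (P T) x| <= N.
  have [N N0 HN] := continuous_bounded_ccube 0 r (Ck_continuous (Ck_peval 0 (P T))).
  by exists N.
pose K := \sum_j M j; have K0 : 0 <= K by apply: sumr_ge0 => j _; exact: (HM j).1.
exists (d%:R * K + \sum_T N T).
  by rewrite addr_ge0 ?mulr_ge0//; apply: sumr_ge0 => T _; exact: (HN T).1.
move=> T cT; split; last first.
  move=> x /(Tr T cT) /(HN T).2 h; apply: (le_trans h).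
  rewrite (bigD1 T)//= addrCA lerDl addr_ge0 ?mulr_ge0//.
  by apply: sumr_ge0 => T' _; exact: (HN T').1.
have : lip_on (ccube 0 r) (d%:R * K) (peval (P T)).
  apply: (@lip_on_partial _ _ _ (fun i => peval (mderiv i (P T)))) => //.
    by move=> i x; exact: is_derive_peval.
  move=> i x /(HM (T, i)).2 h; apply: (le_trans h).
  rewrite /K (bigD1 (T, i))//= lerDl; apply: sumr_ge0 => j _; exact: (HM j).1.
move=> H x y Tx Ty; apply: (le_trans (H x y (Tr T cT x Tx) (Tr T cT y Ty))).
rewrite ler_wpM2r// lerDl; apply: sumr_ge0 => T' _; exact: (HN T').1.
Qed.

(** The closed cover to be glued consists of the cells and of the complement of [Omega], encoded by
    [None], on which [v] is constant. *)
Lemma cellwise_lip v L : 0 <= L -> continuous v -> (forall x, ~ Omega x -> v x = 0) ->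
  (forall T, T \in cells Th -> lip_on (simplex T) L v) -> lip_on setT L v.
Proof.
move=> L0 cv v0 vL.
pose F (j : option {set I}) := if j is Some T then
  (if T \in cells Th then simplex T else set0) else ~` Omega.
apply: (lip_on_glue (F := F)) => //.
- case=> [T|] /=; last exact: open_closedC.
  by case: ifPn => [cT|_]; [exact: (simplex_closed hTh)|exact: closed0].
- move=> x; have [Ox|nO] := pselect (Omega x); last by exists None.
  have [T cT Tx] := closure_in_cell hTh (OcO Ox).
  by exists (Some T); rewrite /F cT.
- case=> [T|] /=; first by case: ifPn => [cT|_]; [exact: vL|by []].
  by move=> x y /v0 -> /v0 ->; rewrite subrr normr0 mulr_ge0.
Qed.

(** Indicators of the inner cells avoid overlaps; the value 0 on the faces concerns a null set. *)
Definition cellwise {V : lmodType R} (F : {set I} -> E -> V) (x : E) : V :=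
  \sum_(T in cells Th) \1_(inner_cell T) x *: F T x.

Lemma cellwiseE (V : lmodType R) (F : {set I} -> E -> V) T x : T \in cells Th ->
  inner_cell T x -> cellwise F x = F T x.
Proof.
move=> cT Tx; rewrite /cellwise (bigD1 T)//= big1 ?addr0.
  by rewrite indicE mem_set// scale1r.
move=> T' /andP[cT' TT']; rewrite indicE memNset ?scale0r// => T'x.
have := inner_cell_disjoint hTh cT' cT T'x (inner_cell_sub hTh cT Tx).
by move/eqP; rewrite (negbTE TT').
Qed.

Definition pgrad (Q : poly) (x : E) : E := \row_i peval (mderiv i Q) x.

Lemma peval_L2 (D : set E) Q : measurable D -> bounded_set D -> L2 D (peval Q).
Proof.
move=> mD bD; have [r r0 Dr] := bounded_set_cube bD.
have [M M0 HM] := continuous_bounded_ccube 0 r (Ck_continuous (Ck_peval 0 Q)).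
apply: (@L2_bounded _ _ _ _ M) => //; first exact: lebesgue_rV_bounded_lty.
  apply: measurable_funTS; apply: rV_continuous_measurable.
  exact: Ck_continuous (Ck_peval 0 Q).
by move=> x /Dr xr; apply: HM => i; exact: ltW.
Qed.

Lemma cellwise_L2 (F : {set I} -> E -> R) :
  (forall T, T \in cells Th -> L2 Omega (F T)) -> L2 Omega (cellwise (V := R^o) F).
Proof.
move=> LF; rewrite /cellwise; under eq_fun do rewrite big_mkcond.
apply: L2_sum => // T; have [cT|_] := boolP (T \in cells Th); last exact: L2_cst.
apply: (@L2_mulb _ _ _ _ _ 1) => //; last exact: LF.
  by apply: measurable_indic; apply: rV_open_measurable; exact: (inner_cell_open hTh cT).
by move=> x _; rewrite indicE; case: (_ \in _); rewrite ?normr1 ?normr0.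
Qed.

Lemma cellwise_coord (F : {set I} -> E -> E) x i :
  cellwise F x ord0 i = cellwise (V := R^o) (fun T x => F T x ord0 i) x.
Proof. by rewrite /cellwise summxE; apply: eq_bigr => T _; rewrite mxE. Qed.

Lemma cellwise_L2v (F : {set I} -> E -> E) :
  (forall T, T \in cells Th -> L2v Omega (F T)) -> L2v Omega (cellwise F).
Proof.
move=> LF i; under eq_fun do rewrite cellwise_coord.
by apply: cellwise_L2 => T cT; exact: LF.
Qed.

Lemma pgrad_L2 Q : L2v Omega (pgrad Q).
Proof.
by move=> i; apply: L2_eq (peval_L2 (mderiv i Q) mO bO) => // x _; rewrite mxE.
Qed.

Lemma inner_cell_near T x : T \in cells Th -> inner_cell T x ->
  \forall y \near x, inner_cell T y.
Proof. by move=> cT Tx; apply: open_nbhs_nbhs; split=> //; exact: (inner_cell_open hTh cT). Qed.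

Lemma is_derive_cell v (Q : poly) T x i : T \in cells Th ->
  (forall y, simplex T y -> v y = peval Q y) ->
  inner_cell T x -> is_derive x (e_ i) v (pgrad Q x ord0 i).
Proof.
move=> cT vQ Tx; rewrite mxE.
apply: (near_eq_is_derive _ (is_derive_peval i Q x)).
apply: (@filterS E (nbhs x) (nbhs_filter x) _ _ _ (inner_cell_near cT Tx)) => y Ty.
by rewrite vQ//; exact: (inner_cell_sub hTh cT).
Qed.

Section gradient.
Variables (v : E -> R) (P : {set I} -> poly).
Hypothesis cv : {within closure Omega, continuous v}.
Hypothesis vP : forall T, T \in cells Th -> forall x, simplex T x -> v x = peval (P T) x.

(** Inside a cell the polynomial gradient is the classical one. Continuity of [v] across faces makes
    its products with test functions globally Lipschitz, which excludes surface terms. *)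
Lemma is_wgrad_piecewise : is_wgrad Omega v (cellwise (fun T => pgrad (P T))).
Proof.
apply: is_wgrad_intro => //.
- exact: within_continuous_measurable.
- by apply: cellwise_L2v => T _; exact: pgrad_L2.
- move=> phi tphi; have [L L0 HL] := lip_piecewise P.
  have [K K0 HK] := test_lip tphi; have [M M0 HM] := test_bounded tphi.
  exists (L * K + M * L); first by rewrite addr_ge0 ?mulr_ge0.
  apply: cellwise_lip.
  + by rewrite addr_ge0 ?mulr_ge0.
  + rewrite (_ : (fun _ => _) = (fun x => v x * phi x) \_ Omega); last first.
      apply/funext => x; rewrite patchE; case: ifPn => // /negP nO.
      by rewrite (test_out tphi _).1 ?mulr0// => Ox; apply: nO; rewrite inE.
    apply: continuous_zero_extension.
      move=> x; apply: continuousM; first exact: cv.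
      apply: continuous_subspaceT; apply: smooth_continuous; by case: tphi.
    move=> x [cx nx]; rewrite (test_out tphi _).1 ?mulr0// => Ox.
    by apply: nx; rewrite (interior_id _).1.
  + by move=> x nO; rewrite (test_out tphi nO).1 mulr0.
  move=> T cT x y Tx Ty; have [HLl HLb] := HL T cT.
  have -> : v x * phi x - v y * phi y = v x * (phi x - phi y) + phi y * (v x - v y) by ring.
  apply: (le_trans (ler_normD _ _)); rewrite !normrM mulrDl -!mulrA; apply: lerD.
    by apply: ler_pM => //; [rewrite (vP cT Tx); exact: HLb|exact: HK].
  by apply: ler_pM => //; [exact: (HM y).1|rewrite (vP cT Tx) (vP cT Ty); exact: HLl].
- move=> i; apply: filterS (Omega_inner_ae hTh) => x Hx /Hx[T cT Tx].
  by rewrite (cellwiseE _ cT Tx); apply: is_derive_cell Tx; last exact: vP.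
Qed.

Lemma wgrad_piecewise : {ae mu, forall x, Omega x ->
  forall T, T \in cells Th -> inner_cell T x -> wgrad Omega v x = pgrad (P T) x}.
Proof.
apply: filterS (wgrad_ae oO Ooo is_wgrad_piecewise) => x Hx Ox T cT Tx.
by rewrite Hx// (cellwiseE _ cT Tx).
Qed.

(** The extension by zero is Lipschitz by gluing and coincides with a polynomial near almost every
    point of [Omega], which gives strict partial derivatives. At almost every zero of the function,
    [critical_level0] makes the gradient vanish. *)
Lemma H10_piecewise : (forall x, boundary Omega x -> v x = 0) -> H10 Omega v.
Proof.
move=> v0; pose g := v \_ Omega.
have gv x : closure Omega x -> g x = v x by exact: boundary_zero_extension.
have gN x : ~ Omega x -> g x = 0.
  by move=> nO; rewrite /g patchE ifN//; apply/negP; rewrite inE.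
have cg : continuous g by exact: continuous_zero_extension.
have [L L0 HL] := lip_piecewise P.
have gP T x : T \in cells Th -> simplex T x -> g x = peval (P T) x.
  by move=> cT Tx; rewrite gv ?(vP cT)//; exact: (cell_sub_closure hTh cT Tx).
apply: (@H10_ext _ _ _ g) => //; first by move=> x /OcO/gv.
pose w := cellwise (fun T => pgrad (P T)).
apply: (@H10_lipschitz _ _ _ _ w L) => //.
- apply: cellwise_lip => // T cT x y Tx Ty; rewrite !(gP T)//.
  exact: (HL T cT).1.
- have := is_wgrad_ext (fun x Ox => esym (gv x (OcO Ox))).
  by move/(congr1 (fun X => X w)) => /= <-; exact: is_wgrad_piecewise.
- apply: filterS (Omega_inner_ae hTh) => x Hx /Hx[T cT Tx] i e e0.
  rewrite /w (cellwiseE _ cT Tx) mxE.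
  have /nbhs_ballP[s /= s0 xs] := inner_cell_near cT Tx.
  have [r r0 xr] := (rV_continuous_atP _ x).1
    (@Ck_continuous _ _ _ _ (Ck_peval 0 (mderiv i (P T))) x) _ e0.
  pose m := Num.min r s; have m0 : 0 < m by rewrite lt_min r0.
  (* Half of the radius keeps the whole segment from [z] to [z + h *: e_ i] within distance [m] of
     [x]. *)
  exists (m / 2); first by rewrite divr_gt0.
  move=> z h xz /andP[_ hm].
  have in_m t : 0 <= t -> t <= 1 -> `|x - (z + (t * h) *: e_ i)| < m.
    move=> t0 t1; rewrite opprD addrA; apply: (le_lt_trans (ler_normB _ _)).
    rewrite [m]splitr; apply: ltrD => //; apply: le_lt_trans hm.
    apply: (le_trans (norm_scale_delta _ _)).
    by rewrite normrM ger0_norm// ler_piMl.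
  have gz t : 0 <= t -> t <= 1 -> g (z + (t * h) *: e_ i) = peval (P T) (z + (t * h) *: e_ i).
    move=> t0 t1; apply: gP => //; apply: (inner_cell_sub hTh cT); apply: xs.
    apply/ball_norm_rV; apply: (lt_le_trans (in_m t t0 t1)).
    by rewrite ge_min lexx orbT.
  have := gz 0 (lexx _) ler01; rewrite mul0r scale0r addr0 => ->.
  have := gz 1 ler01 (lexx _); rewrite mul1r => ->.
  have [t /andP[t0 t1] ->] := line_MVT z h (fun y => is_derive_peval i (P T) y).
  rewrite -mulrBr normrM mulrC ler_wpM2r// ltW// distrC; apply: xr.
  by apply: (lt_le_trans (in_m t t0 t1)); rewrite ge_min lexx.
- have H T i : {ae mu, forall x, T \in cells Th -> inner_cell T x ->
      peval (P T) x = 0 -> peval (mderiv i (P T)) x = 0}.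
    by apply: filterS (critical_level0 (P T) i) => x Hx _ _.
  have H' : {ae mu, forall x, forall T i, T \in cells Th -> inner_cell T x ->
      peval (P T) x = 0 -> peval (mderiv i (P T)) x = 0}.
    by apply: filter_forall => T; apply: filter_forall => i; exact: H.
  apply: filterS2 (Omega_inner_ae hTh) H' => x Hx Hx' /[dup] Ox /Hx[T cT Tx].
  rewrite /w (cellwiseE _ cT Tx) gv; last exact: OcO.
  rewrite (vP cT (inner_cell_sub hTh cT Tx)) => Px.
  by apply/rowP => i; rewrite !mxE; exact: Hx'.
Qed.

End gradient.

End piecewise_polynomials.

(** * Hat functions *)

Section hat_functions.
Context {R : realType} {d : nat}.
Local Notation E := 'rV[R]_d.
Local Notation mu := (@lebesgue_rV R d).
Local Notation e_ i := (delta_mx ord0 i : 'rV[R]_d).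
Variables (Omega : set E) (Th : mesh R d).
Hypothesis hTh : simplicial_mesh Omega Th.
Hypotheses (oO : open Omega) (bO : bounded_set Omega)
  (rO : (closure Omega)° `<=` Omega).
Local Notation I := 'I_(nvertices Th).
Local Notation vert := (@vertex R d Th).
Local Notation poly := (mpoly d R).
Variable psi : I -> E -> R.
Hypothesis hpsi : forall a, hat_function Omega a (psi a).
Implicit Types (T : {set I}) (a : I) (x y : E).

Lemma hat_polynomial a : exists P : {set I} -> poly, forall T, T \in cells Th ->
  deg_le 1 (P T) /\ forall x, simplex T x -> psi a x = peval (P T) x.
Proof. by have [cp pp _] := hpsi a; exact: (piecewise_polynomial hTh). Qed.

(** On a cell the hat function has degree at most one, so it is determined by its values at the
    vertices, which are those of the barycentric coordinate. *)
Lemma hat_bary a T x : T \in cells Th -> simplex T x -> psi a x = bary T a x.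
Proof.
move=> cT Tx; have [P /(_ T cT)[dP psiP]] := hat_polynomial a.
have [_ _ pv] := hpsi a.
rewrite psiP// -[X in peval _ X](bary_point hTh x cT) peval_affine ?(bary_sum1 hTh)//.
have H i : bary T i x * peval (P T) (vert i) = (i == a)%:R * bary T a x.
  have [iT|iT] := boolP (i \in T); last first.
    rewrite (bary_out hTh)// mul0r; have [<-|_] := eqVneq i a; last by rewrite mul0r.
    by rewrite (bary_out hTh)// mulr0.
  rewrite -psiP ?pv; last first.
    by apply/(simplexP hTh) => // j; rewrite (bary_vertex hTh).
  by have [->|_] := eqVneq i a; rewrite mulrC ?mul0r.
under eq_bigr do rewrite H.
by rewrite (bigD1 a)//= eqxx mul1r big1 ?addr0// => i /negbTE ->; rewrite mul0r.
Qed.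

Lemma hat_out a T x : T \in cells Th -> simplex T x -> a \notin T -> psi a x = 0.
Proof. by move=> cT Tx aT; rewrite (hat_bary a cT Tx) (bary_out hTh). Qed.

Lemma hat_ge0 a x : closure Omega x -> 0 <= psi a x.
Proof.
move=> /(closure_in_cell hTh)[T cT Tx]; rewrite (hat_bary a cT Tx).
by have /(simplexP hTh x cT) := Tx.
Qed.

Lemma hat_sum1 x : closure Omega x -> \sum_a psi a x = 1.
Proof.
move=> /(closure_in_cell hTh)[T cT Tx].
by under eq_bigr do rewrite (hat_bary _ cT Tx); exact: (bary_sum1 hTh).
Qed.

Lemma hat_le1 a x : closure Omega x -> `|psi a x| <= 1.
Proof.
move=> cx; rewrite ger0_norm ?hat_ge0// -(hat_sum1 cx) (bigD1 a)//= lerDl.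
by apply: sumr_ge0 => b _; exact: hat_ge0.
Qed.

(** The cells without the vertex [a] form a closed set on which the hat function vanishes; near [x],
    therefore, [Omega] is covered by cells that contain [a]. *)
Lemma hat_patch a x : Omega x -> psi a x != 0 -> @Defs.patch R d Th a x.
Proof.
move=> Ox nz.
pose C := \bigcup_(T in [set T | T \in cells Th /\ a \notin T]) simplex T.
have cC : closed C.
  apply: closed_bigcup; first exact: finite_finset.
  by move=> T [cT _]; exact: (simplex_closed hTh).
have nC : ~ C x by move=> [T [cT aT] Tx]; move: nz; rewrite (hat_out cT Tx aT) eqxx.
have : nbhs x (Omega `&` ~` C).
  by apply: open_nbhs_nbhs; split=> //; apply: openI => //; exact: closed_openC.
apply: filterS => y [Oy nCy].
have [T cT Ty] := closure_in_cell hTh (subset_closure Oy).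
exists T => //; split=> //; apply: contrapT => /negP aT; apply: nCy.
by exists T.
Qed.

(** A nonzero value would be a positive coordinate at an interior vertex, and [interior_vertex_bary]
    would put the point in [Omega]. Hats of interior vertices are thereby admissible in the discrete
    problem. *)
Lemma hat_boundary a x : Omega (vert a) -> boundary Omega x -> psi a x = 0.
Proof.
move=> Oa [cx nx]; have [T cT Tx] := closure_in_cell hTh cx.
rewrite (hat_bary a cT Tx); apply: contrapT => /eqP nz; apply: nx.
rewrite (interior_id _).1//; apply: (interior_vertex_bary hTh oO rO Oa cT Tx).
by rewrite lt_def nz/=; have /(simplexP hTh x cT) := Tx; exact.
Qed.

Lemma hat_patch_boundary a x : boundary (@Defs.patch R d Th a) x -> psi a x != 0 ->
  boundary Omega x.
Proof.
move=> [cx nx] nz; split.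
  by apply: closure_subset cx; exact: (patch_sub_Omega hTh).
rewrite (interior_id _).1// => Ox; apply: nx.
by rewrite (interior_id _).1; [exact: hat_patch|exact: patch_open].
Qed.

Lemma hat_measurable a : measurable_fun Omega (psi a).
Proof. by apply: within_continuous_measurable => //; have [] := hpsi a. Qed.

Lemma hat_L2 a : L2 Omega (psi a).
Proof.
apply: (@L2_bounded _ _ _ _ 1); first exact: rV_open_measurable.
- by apply: lebesgue_rV_bounded_lty => //; exact: rV_open_measurable.
- exact: hat_measurable.
- by move=> x Ox; apply: hat_le1; exact: subset_closure.
Qed.

Lemma hat_Vh0 p a : (1 <= p)%N -> Omega (vert a) -> Vh0 Omega Th p (psi a).
Proof.
move=> p1 Oa; have [cp pp _] := hpsi a; split=> //; last by move=> x; exact: hat_boundary.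
split=> [|T cT]; first exact: hat_L2.
by have [P dP psiP] := pp T cT; exists P => //; exact: deg_leW dP.
Qed.

(** In an inner cell these are classical gradients: the hats of vertices outside the cell are
    locally zero, and the sum of all hats is locally the constant 1. *)
Lemma wgrad_hat_ae : {ae mu, forall x, Omega x ->
  (forall a, ~ @Defs.patch R d Th a x -> wgrad Omega (psi a) x = 0) /\
  \sum_a wgrad Omega (psi a) x = 0}.
Proof.
have [P HP] := choice hat_polynomial.
have H a : {ae mu, forall x, Omega x -> forall T, T \in cells Th -> inner_cell T x ->
    wgrad Omega (psi a) x = pgrad (P a T) x}.
  have [cp _ _] := hpsi a.
  apply: (wgrad_piecewise hTh) => // T cT x; exact: (HP a T cT).2.
apply: filterS2 (Omega_inner_ae hTh) (filter_forall _ H) => x Hx Hg /[dup] Ox /Hx[T cT Tx].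
have dpsi a i : is_derive x (e_ i) (psi a) (wgrad Omega (psi a) x ord0 i).
  rewrite (Hg a Ox T cT Tx).
  exact: (is_derive_cell hTh i cT (HP a T cT).2 Tx).
have near0 (g : E -> R) i l : is_derive x (e_ i) g l -> (forall y, inner_cell T y -> g y = 0) -> l = 0.
  move=> dg g0; have : is_derive x (e_ i) g 0.
    apply: is_derive_locally0.
    by apply: (@filterS E (nbhs x) (nbhs_filter x) _ _ _ (inner_cell_near hTh cT Tx)).
  by move=> d0; rewrite -(@derive_val _ _ _ _ _ _ _ dg) (@derive_val _ _ _ _ _ _ _ d0).
split=> [a npa|].
  apply/rowP => i; rewrite [RHS]mxE; apply: (near0 _ _ _ (dpsi a i)) => y Ty.
  apply: (hat_out cT (inner_cell_sub hTh cT Ty)).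
  by apply: contra_notN npa => aT; exact: (inner_cell_patch hTh cT aT).
apply/rowP => i; rewrite [RHS]mxE summxE.
have ds : is_derive x (e_ i) (\sum_a psi a - cst 1) (\sum_a wgrad Omega (psi a) x ord0 i).
  rewrite -[X in is_derive _ _ _ X]subr0.
  by have ds := is_derive_sum (fun a => dpsi a i); apply: is_deriveB.
apply: (near0 _ _ _ ds) => y Ty; rewrite !fctE fct_sumE hat_sum1 ?subrr//.
exact: (cell_sub_closure hTh cT (inner_cell_sub hTh cT Ty)).
Qed.

End hat_functions.

(** * Weak divergence and density *)

Section almost_everywhere_integrals.
Context {R : realType} {d : nat}.
Local Notation E := 'rV[R]_d.
Local Notation mu := (@lebesgue_rV R d).
Implicit Types (D : set E) (f g h phi v : E -> R) (w z : E -> E).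

Lemma Rintegral_sub_ae D D' h : D' `<=` D ->
  {ae mu, forall x, D x -> ~ D' x -> h x = 0} ->
  \int[mu]_(x in D) h x = \int[mu]_(x in D') h x.
Proof.
move=> DD h0; rewrite Rintegral_mkcond [RHS]Rintegral_mkcond.
apply: Rintegral_eq_ae; apply: filterS h0 => x hx _; rewrite !patchE.
have [xD'|xD'] := pselect (D' x); first by rewrite !mem_set//; exact: DD.
rewrite (memNset xD'); have [xD|xD] := pselect (D x); last by rewrite memNset.
by rewrite mem_set// hx.
Qed.

Lemma inner_eq_ae D f f' g g' : {ae mu, forall x, D x -> f x = f' x} ->
  {ae mu, forall x, D x -> g x = g' x} -> inner D f g = inner D f' g'.
Proof.
move=> ff gg; apply: Rintegral_eq_ae; apply: filterS2 ff gg => x ff gg Dx.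
by rewrite ff// gg.
Qed.

Lemma innerv_eq_ae D w w' z z' : {ae mu, forall x, D x -> w x = w' x} ->
  {ae mu, forall x, D x -> z x = z' x} -> innerv D w z = innerv D w' z'.
Proof.
move=> ff gg; apply: Rintegral_eq_ae; apply: filterS2 ff gg => x ff gg Dx.
by rewrite ff// gg.
Qed.

Lemma inner_sum D (J : finType) (F : J -> E -> R) h : measurable D ->
  (forall j, L2 D (F j)) -> L2 D h ->
  inner D (fun x => \sum_j F j x) h = \sum_j inner D (F j) h.
Proof.
move=> mD LF Lh; elim: (index_enum J) => [|j s IH].
  rewrite big_nil; under [X in inner D X]eq_fun do rewrite big_nil.
  by rewrite /inner; under eq_Rintegral do rewrite mul0r; rewrite Rintegral_cst// mul0r.
rewrite big_cons -IH -innerDl//; last exact: L2_sum.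
by under [X in inner D X]eq_fun do rewrite big_cons.
Qed.

Lemma L2v_sum D (J : finType) (F : J -> E -> E) : measurable D ->
  (forall j, L2v D (F j)) -> L2v D (fun x => \sum_j F j x).
Proof.
move=> mD LF i; under eq_fun do rewrite summxE.
by apply: L2_sum => // j; exact: LF.
Qed.

Lemma innerv_sum D (J : finType) (F : J -> E -> E) z : measurable D ->
  (forall j, L2v D (F j)) -> L2v D z ->
  innerv D (fun x => \sum_j F j x) z = \sum_j innerv D (F j) z.
Proof.
move=> mD LF Lz; rewrite innervE//; last exact: L2v_sum.
transitivity (\sum_i \sum_j inner D (fun x => F j x ord0 i) (fun x => z x ord0 i)).
  apply: eq_bigr => i _; rewrite -inner_sum// => [|j]; last exact: LF.
  by under [X in inner D X]eq_fun do rewrite summxE.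
by rewrite exchange_big; apply: eq_bigr => j _; rewrite innervE.
Qed.

Lemma L2_indic D D' f : measurable D -> measurable D' -> D' `<=` D ->
  L2 D' f -> L2 D (fun x => \1_D' x * f x).
Proof.
move=> mD mD' DD Lf; apply: (@L2_eq _ _ _ (f \_ D')) => //.
  move=> x _; rewrite patchE indicE.
  by case: (x \in D'); rewrite ?mul1r ?mul0r.
by apply: L2_restrict => //; rewrite setIidr.
Qed.

Lemma L2v_indic D D' w : measurable D -> measurable D' -> D' `<=` D ->
  L2v D' w -> L2v D (fun x => \1_D' x *: w x).
Proof.
by move=> mD mD' DD Lw i; under eq_fun do rewrite mxE; exact: L2_indic.
Qed.

Lemma inner_indic D D' f h : D' `<=` D ->
  inner D (fun x => \1_D' x * f x) h = inner D' f h.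
Proof.
move=> DD; rewrite /inner (Rintegral_sub_ae DD); last first.
  by apply: aeW => x _ nx; rewrite indicE memNset// !mul0r.
by apply: eq_Rintegral => x xD; rewrite indicE xD mul1r.
Qed.

Lemma innerv_indic D D' w z : D' `<=` D ->
  innerv D (fun x => \1_D' x *: w x) z = innerv D' w z.
Proof.
move=> DD; rewrite /innerv (Rintegral_sub_ae DD); last first.
  by apply: aeW => x _ nx; rewrite indicE memNset// dotpZl mul0r.
by apply: eq_Rintegral => x xD; rewrite indicE xD scale1r.
Qed.

Lemma inner_self_eq0_ae D f : measurable D -> L2 D f -> inner D f f = 0 ->
  {ae mu, forall x, D x -> f x = 0}.
Proof.
move=> mD Lf ff0; have Lff := L2_mul_integrable mD Lf Lf.
have mf := measurable_int _ Lff.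
have : (\int[mu]_(x in D) `|(f x * f x)%:E| = 0)%E.
  under eq_integral do rewrite gee0_abs ?lee_fin -?expr2 ?sqr_ge0//.
  under eq_integral do rewrite expr2.
  have fn : (\int[mu]_(x in D) (f x * f x)%:E \is a fin_num)%E.
    exact: integrable_fin_num.
  by rewrite -(fineK fn); congr EFin.
move/(ae_eq_integral_abs mu mD mf); apply: filterS => x fx Dx.
by have /eqP := fx Dx; rewrite eqe mulf_eq0 orbb => /eqP.
Qed.

Lemma normv_H1norm D v : normv D (wgrad D v) <= H1norm D v.
Proof.
apply: ler_wsqrtr; rewrite lerDr; apply: Rintegral_ge0 => x _.
by rewrite -expr2 sqr_ge0.
Qed.

End almost_everywhere_integrals.

Section density.
Context {R : realType} {d : nat}.
Local Notation E := 'rV[R]_d.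
Local Notation mu := (@lebesgue_rV R d).
Variable D : set E.
Hypotheses (oD : open D) (bD : bounded_set D).
Implicit Types (f g h phi v : E -> R) (w z : E -> E).

Let mD : measurable D. Proof. exact: rV_open_measurable. Qed.
Let Doo : (mu D < +oo)%E. Proof. exact: lebesgue_rV_bounded_lty. Qed.

Lemma test_H10 phi : test_function D phi -> H10 D phi.
Proof.
move=> tphi; have gphi := is_wgrad_test oD bD tphi; have [Lphi _] := test_L2 mD Doo tphi.
split; first by split=> //; exists (classical_grad phi).
move=> eps e0; exists phi; split=> //.
have g0 := is_wgradB mD Doo Lphi Lphi gphi gphi.
rewrite /H1norm (_ : _ + _ = 0) ?sqrtr0//.
rewrite (@inner_eq_ae _ _ _ _ (cst 0) _ (cst 0)); try by apply: aeW => x _; rewrite subrr.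
have z : {ae mu, forall x, D x -> wgrad D (fun x => phi x - phi x) x = 0}.
  by apply: filterS (wgrad_ae oD Doo g0) => x H Dx; rewrite H// subrr.
rewrite (@innerv_eq_ae _ _ _ _ (cst 0) _ (cst 0))//.
rewrite /inner /innerv; under eq_Rintegral do rewrite mul0r.
under [X in _ + X]eq_Rintegral do rewrite -(scale0r (0 : E)) dotpZl mul0r.
by rewrite !Rintegral_cst// mul0r addr0.
Qed.

(** By orthogonality to test functions, [v] may be replaced by [v - phi] with a small norm, and
    Cauchy-Schwarz concludes. Adding 1 to the norm of [z] avoids a division by zero. *)
Lemma H10_orthogonal z v : L2v D z ->
  (forall phi, test_function D phi -> innerv D z (classical_grad phi) = 0) ->
  H10 D v -> innerv D z (wgrad D v) = 0.
Proof.
move=> Lz z0 [[Lv [w vw]] dv]; have [Lw _] := wgradP vw.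
apply/eqP; rewrite -normr_le0; apply/ler_addgt0Pl => eps e0; rewrite addr0.
have e1 : 0 < eps / (normv D z + 1) by rewrite divr_gt0// ltr_wpDl// normv_ge0.
have [phi [tphi vphi]] := dv _ e1; have gphi := is_wgrad_test oD bD tphi.
have [Lphi _] := test_L2 mD Doo tphi; have [Lg _] := gphi.
have gB := is_wgradB mD Doo Lv Lphi (wgradP vw) gphi.
have LNg : L2v D (fun x => -1 *: classical_grad phi x) by exact: L2vZ.
have -> : innerv D z (wgrad D v) = innerv D z (wgrad D (fun x => v x - phi x)).
  rewrite (@innerv_eq_ae _ _ _ _ z _ _ (aeW _ (fun x _ => erefl)) (wgrad_ae oD Doo gB)).
  rewrite innervC [RHS]innervC.
  under [X in _ = innerv D X _]eq_fun do rewrite -scaleN1r.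
  by rewrite innervDl// innervZl// [X in _ + _ * X]innervC z0// mulr0 addr0.
have LB := (wgradP gB).1.
apply: (le_trans (cauchy_schwarz_innerv mD Lz LB)).
apply: (@le_trans _ _ ((normv D z + 1) * (eps / (normv D z + 1)))).
  apply: ler_pM; rewrite ?normv_ge0// ?lerDl//.
  exact: le_trans (normv_H1norm _ _) (ltW vphi).
by rewrite mulrC divfK// gt_eqF// ltr_wpDl// normv_ge0.
Qed.

End density.

Section divergence.
Context {R : realType} {d : nat}.
Local Notation E := 'rV[R]_d.
Local Notation mu := (@lebesgue_rV R d).
Implicit Types (D : set E) (f g h phi v : E -> R) (w z : E -> E).

Lemma is_wdiv_sub D D' w v : measurable D -> measurable D' -> D' `<=` D ->
  is_wdiv D w v -> is_wdiv D' w v.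
Proof.
move=> mD mD' DD [Lv wv]; split; first exact: L2_sub Lv.
move=> phi tphi; rewrite -(innerv_test_sub _ mD mD' DD) => [|x nx]; last first.
  by apply/rowP => i; rewrite !mxE (test_out tphi nx).2.
rewrite -(inner_test_sub _ mD mD' DD) => [|x nx]; last exact: (test_out tphi nx).1.
by apply: wv; exact: test_function_sub tphi.
Qed.

Lemma is_wdiv_eq_ae D w w' v : {ae mu, forall x, D x -> w x = w' x} ->
  is_wdiv D w v -> is_wdiv D w' v.
Proof.
move=> ww [Lv wv]; split=> // phi tphi; rewrite -wv//.
apply: innerv_eq_ae; last exact: aeW.
by apply: filterS ww => x ww /ww.
Qed.

Lemma is_wgrad_peval D (Q : mpoly d R) : open D -> bounded_set D ->
  is_wgrad D (peval Q) (pgrad Q).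
Proof.
move=> oD bD; apply: is_wgrad_C1 => // [i x|i|].
- by rewrite mxE; exact: is_derive_peval.
- by under eq_fun do rewrite mxE; exact: Ck_continuous (Ck_peval 0 _).
- exact: Ck_continuous (Ck_peval 0 Q).
Qed.

Lemma is_wdiv_polynomial D (W : 'I_d -> mpoly d R) : open D -> bounded_set D ->
  is_wdiv D (fun x => \row_i peval (W i) x) (fun x => \sum_i peval (mderiv i (W i)) x).
Proof.
move=> oD bD; have mD := rV_open_measurable oD.
have Doo : (mu D < +oo)%E by exact: lebesgue_rV_bounded_lty.
split; first by apply: L2_sum => // i; exact: peval_L2.
move=> phi tphi; have [Lphi Ldphi] := test_L2 mD Doo tphi.
rewrite innervE//; last 2 first.
- by move=> i; apply: L2_eq (peval_L2 (W i) mD bD) => // x _; rewrite mxE.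
- by move=> i; apply: L2_eq (Ldphi i) => // x _; rewrite mxE.
rewrite inner_sum//; last by move=> i; exact: peval_L2.
rewrite -sumrN; apply: eq_bigr => i _.
have [_ /(_ phi tphi i)] : is_wgrad D (peval (W i)) (pgrad (W i)).
  exact: is_wgrad_peval.
under [X in _ = - inner _ X _ -> _]eq_fun do rewrite mxE.
by move=> <-; apply: inner_eq => x _; rewrite mxE.
Qed.

End divergence.

(** * The equilibrated flux *)

Section equilibrated_flux.
Context {R : realType} {d : nat}.
Local Notation E := 'rV[R]_d.
Local Notation mu := (@lebesgue_rV R d).
Variables (Omega : set E) (Th : mesh R d).
Hypothesis hTh : simplicial_mesh Omega Th.
Hypotheses (oO : open Omega) (bO : bounded_set Omega)
  (rO : (closure Omega)° `<=` Omega).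
Local Notation I := 'I_(nvertices Th).
Local Notation vert := (@vertex R d Th).
Local Notation poly := (mpoly d R).
Local Notation mpatch := (@Defs.patch R d Th).
Implicit Types (T : {set I}) (a : I) (x y : E) (q v h : E -> R) (w z : E -> E).

Let mO : measurable Omega. Proof. exact: rV_open_measurable. Qed.
Let Ooo : (mu Omega < +oo)%E. Proof. exact: lebesgue_rV_bounded_lty. Qed.
Let mT T : T \in cells Th -> measurable (inner_cell T).
Proof. by move=> cT; apply: rV_open_measurable; exact: (inner_cell_open hTh cT). Qed.
Let pO a : mpatch a `<=` Omega. Proof. exact: (patch_sub_Omega hTh). Qed.
Let mP a : measurable (mpatch a).
Proof. by apply: rV_open_measurable; exact: patch_open. Qed.
Let Poo a : (mu (mpatch a) < +oo)%E.
Proof. by apply: le_lt_trans Ooo; apply: le_measure; rewrite ?inE. Qed.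

(** On an inner cell the classical divergence of the polynomial field is also a weak one, and weak
    divergences are unique almost everywhere. So divergences of fluxes are legitimate members of the
    test space [Qh]. *)
Lemma raviart_thomas_divergence p w v : is_wdiv Omega w v ->
  (forall T, T \in cells Th -> raviart_thomas_on p (simplex T) w) ->
  forall T, T \in cells Th -> poly_on p (simplex T) v.
Proof.
move=> wv RT T cT; have [P [Q [dP dQ wPQ]]] := RT T cT.
pose W i : poly := P i + (mpolyX R (mnm1 i) : poly) * Q.
have oT := inner_cell_open hTh cT; have TO := inner_cell_Omega hTh rO cT.
have bT : bounded_set (inner_cell T).
  by have [M [rM HM]] := bO; exists M; split=> // y My x /TO Ox; exact: HM Ox.
have vW : {ae mu, forall x, inner_cell T x -> v x = \sum_i peval (mderiv i (W i)) x}.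
  apply: (@wdiv_unique _ _ _ w) => //.
  - by apply: le_lt_trans Ooo; apply: le_measure; rewrite ?inE//; exact: mT.
  - by apply: is_wdiv_sub wv => //; exact: mT.
  apply: is_wdiv_eq_ae (is_wdiv_polynomial W oT bT).
  apply: filterS wPQ => x wx /(inner_cell_sub hTh cT)/wx ->.
  by apply/rowP => i; rewrite !mxE pevalD pevalM pevalX mulrC.
exists (\sum_i mderiv i (W i)).
  apply: deg_le_sum => i; rewrite mderivD; apply: deg_leD; last exact: deg_le_mderivXM.
  exact: deg_le_mderiv.
by apply: filterS2 (inner_cell_ae hTh cT) vW => x h1 h2 /h1/h2 ->; rewrite peval_sum.
Qed.

(** A product of square integrable fields is in general only integrable; here the gradient is
    polynomial, hence bounded, on each cell, which provides a square integrable representative. *)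
Lemma dotp_piecewise_L2 v (P : {set I} -> poly) w : {within closure Omega, continuous v} ->
  (forall T, T \in cells Th -> forall x, simplex T x -> v x = peval (P T) x) ->
  L2v Omega w ->
  exists2 h, L2 Omega h & {ae mu, forall x, Omega x -> dotp (wgrad Omega v x) (w x) = h x}.
Proof.
move=> cv vP Lw; exists (cellwise (V := R^o) (fun T x => dotp (pgrad (P T) x) (w x))).
  apply: (cellwise_L2 hTh oO bO) => T cT; apply: L2_sum => // i.
  have [r r0 Or] := bounded_set_cube bO.
  have [M M0 HM] := continuous_bounded_ccube 0 r (Ck_continuous (Ck_peval 0 (mderiv i (P T)))).
  apply: (@L2_mulb _ _ _ _ _ M) => //.
    exact: (pgrad_L2 oO bO (P T) i).1.
  by move=> x /Or xr; rewrite mxE; apply: HM => j; exact: ltW.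
apply: filterS2 (Omega_inner_ae hTh) (wgrad_piecewise hTh oO bO cv vP) => x Hx Hg Ox.
by have [T cT Tx] := Hx Ox; rewrite (Hg Ox T cT Tx) (cellwiseE hTh _ cT Tx).
Qed.

Variables (p : nat) (f : E -> R) (psi : I -> E -> R) (kappa0 u0h : E -> R).
Hypotheses (hp : (1 <= p)%N) (hf : Qh Omega Th p f)
  (hpsi : forall a, hat_function Omega a (psi a)).
Let G x := kappa0 x *: wgrad Omega u0h x.
Hypothesis LG : L2v Omega G.
Hypothesis hdis : forall v, Vh0 Omega Th p v -> innerv Omega G (wgrad Omega v) = inner Omega f v.
Variables (sigma : I -> E -> E) (lambda : I -> E -> R).
Hypothesis hloc : forall a, local_flux_problem Omega p f kappa0 u0h psi a (sigma a) (lambda a).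

Lemma Qh_cst c : Qh Omega Th p (cst c).
Proof.
split=> [|T cT]; first exact: L2_cst.
exists (c *: (1 : poly)); first by apply: deg_leZ; exact: deg_le1.
by apply: aeW => x _; rewrite pevalZ peval1 mulr1.
Qed.

Lemma QhD q q' : Qh Omega Th p q -> Qh Omega Th p q' -> Qh Omega Th p (fun x => q x + q' x).
Proof.
move=> [Lq pq] [Lq' pq']; split=> [|T cT]; first exact: L2D.
have [P dP qP] := pq T cT; have [Q dQ qQ] := pq' T cT.
exists (P + Q); first exact: deg_leD.
by apply: filterS2 qP qQ => x h1 h2 Tx; rewrite h1// h2// pevalD.
Qed.

Lemma QhN q : Qh Omega Th p q -> Qh Omega Th p (fun x => - q x).
Proof.
move=> [Lq pq]; split=> [|T cT]; first exact: L2N.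
have [P dP qP] := pq T cT; exists (- P); first exact: deg_leN.
by apply: filterS qP => x h1 Tx; rewrite h1// pevalN.
Qed.

(** A local flux matters only almost everywhere on its patch: [g] is a field on all of [Omega] that
    it restricts, and [v] is the divergence of [g]. *)
Lemma local_flux_rep a : exists g v, [/\ L2v Omega g,
  {ae mu, forall x, mpatch a x -> sigma a x = g x}, Qh Omega Th p v,
  {ae mu, forall x, mpatch a x -> wdiv (mpatch a) (sigma a) x = v x} &
  L2 (mpatch a) (wdiv (mpatch a) (sigma a))].
Proof.
have [[[g [[Lg [v gv]] RT] sg] _] _ _ _] := hloc a; exists g, v.
have sv : is_wdiv (mpatch a) (sigma a) v.
  apply: (@is_wdiv_eq_ae _ _ _ g); last exact: is_wdiv_sub gv.
  by apply: filterS sg => x h /h.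
split=> //; last exact: (wdivP sv).1.
  by split; [exact: gv.1|exact: raviart_thomas_divergence RT].
by apply: wdiv_unique (wdivP sv) sv => //; exact: patch_open.
Qed.

(* The local problem only tests with mean free functions when [a] is interior;
   the constants satisfy the same identity, by the Green formula on the left and
   by the discrete problem tested with [psi a] on the right. *)
Lemma local_divergence a h q : L2 Omega h ->
  {ae mu, forall x, Omega x -> dotp (wgrad Omega (psi a) x) (G x) = h x} ->
  Qh Omega Th p q ->
  inner (mpatch a) (wdiv (mpatch a) (sigma a)) q =
  inner Omega (fun x => psi a x * f x) q - inner Omega h q.
Proof.
move=> Lh hh Qq; have [Msig _ _ eq2] := hloc a.
have [_ [_ [_ _ _ _ Lwd]]] := local_flux_rep a.
have psi0 : {ae mu, forall x, Omega x -> ~ mpatch a x -> psi a x = 0 /\ h x = 0}.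
  apply: filterS2 (wgrad_hat_ae hTh oO bO hpsi) hh => x H1 H2 Ox nP.
  have [/(_ a nP) H _] := H1 Ox; split.
    apply: contrapT => /eqP nz; apply: nP; exact: (hat_patch hTh oO hpsi).
  by rewrite -H2// H -(scale0r (0 : E)) dotpZl mul0r.
have onP (F : E -> R) : {ae mu, forall x, Omega x -> ~ mpatch a x -> F x = 0} ->
    forall q', inner Omega F q' = inner (mpatch a) F q'.
  move=> F0 q'; apply: Rintegral_sub_ae; first exact: pO.
  by apply: filterS F0 => x F0 Ox nP; rewrite F0// mul0r.
rewrite !onP; last 2 first.
- by apply: filterS psi0 => x H Ox nP; rewrite (H Ox nP).2.
- by apply: filterS psi0 => x H Ox nP; rewrite (H Ox nP).1 mul0r.
have hpatch : {ae mu, forall x, mpatch a x ->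
    dotp (wgrad Omega (psi a) x) (G x) = h x}.
  by apply: filterS hh => x H /pO/H.
have Qha_eq q' : Qha Omega p a q' ->
    inner (mpatch a) (wdiv (mpatch a) (sigma a)) q' =
    inner (mpatch a) (fun x => psi a x * f x) q' - inner (mpatch a) h q'.
  by move=> /eq2 ->; congr (_ - _); apply: inner_eq_ae hpatch _; exact: aeW.
have Rq q' : Qh Omega Th p q' -> restrictions (Qh Omega Th p) (mpatch a) q'.
  by move=> Qq'; exists q' => //; exact: aeW.
(* A vertex outside [Omega] imposes no mean value constraint, so [q] itself is admissible. *)
have [Oa|nOa] := pselect (Omega (vert a)); last by apply: Qha_eq; split=> //; exact: Rq.
have [T cT aT] := mesh_vertex_used hTh a.
have m0 : 0 < fine (mu (mpatch a)).
  apply: fine_gt0; rewrite Poo andbT lt0e measure_ge0 andbT.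
  apply: lebesgue_rV_open_gt0; first exact: patch_open.
  have [c Tc] := inner_cell_nonempty hTh cT; exists c.
  exact: (inner_cell_patch hTh cT aT).
(* Subtracting this mean value makes [q - c] admissible; what remains is the identity for
   constants. *)
pose c := inner (mpatch a) q (fun=> 1) / fine (mu (mpatch a)).
have Lsub F : L2 Omega F -> L2 (mpatch a) F by move=> LF; exact: L2_sub LF.
have Lc k : L2 (mpatch a) (cst k) by exact: L2_cst.
have Lq : L2 (mpatch a) q by apply: Lsub; case: Qq.
have mean0 : inner (mpatch a) (fun x => q x - c) (fun=> 1) = 0.
  rewrite (@innerDl _ _ _ _ (cst (- c)))//; try exact: (Lc).
  by rewrite {2}/inner; under [X in _ + X]eq_Rintegral do rewrite mulr1;
    rewrite Rintegral_cst// mulNr divfK ?subrr// gt_eqF.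
have Qc : Qha Omega p a (fun x => q x - c).
  by split=> // ; apply: Rq; exact: QhD Qq (Qh_cst (- c)).
have divide F : L2 (mpatch a) F -> inner (mpatch a) F q =
    inner (mpatch a) F (fun x => q x - c) + c * inner (mpatch a) F (fun=> 1).
  move=> LF; rewrite innerC [in RHS]innerC [X in _ + _ * X]innerC -(@innerZl _ _ _ (cst 1))//.
  rewrite -innerDl//; last 2 first.
  - exact: (L2D (mP a) Lq (Lc (- c))).
  - by apply: L2Z => //; exact: (Lc 1).
  by apply: inner_eq => // x _; rewrite mulr1 subrK.
have Lpf : L2 Omega (fun x => psi a x * f x).
  apply: (@L2_mulb _ _ _ _ _ 1) => //; [exact: (hat_measurable oO hpsi a)|..|by case: hf].
  by move=> x Ox; apply: (hat_le1 hTh hpsi); exact: subset_closure.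
rewrite (divide _ Lwd) (divide _ (Lsub _ Lpf)) (divide _ (Lsub _ Lh)) (Qha_eq _ Qc).
have -> : inner (mpatch a) (wdiv (mpatch a) (sigma a)) (fun=> 1) = 0.
  have [_ /(_ (cst 1))] := Msig => tr.
  have /tr : @smooth R d (cst 1) by apply: Ck_smooth => k; exact: Ck_cst.
  (* For an interior vertex the hat function vanishes on the whole boundary of the patch. No
     boundary part is left where the test function must vanish, so the constant 1 may be used in
     [normal_trace0]. *)
  have zero x : boundary (mpatch a) x -> psi a x = 0.
    move=> bx; apply: contrapT => /eqP nz.
    have bOx := hat_patch_boundary hTh oO rO hpsi bx nz.
    by move: nz; rewrite (hat_boundary hTh oO rO hpsi Oa bOx) eqxx.
  have gap x : (boundary (mpatch a) `\` [set x | boundary (mpatch a) x /\ psi a x = 0]) x ->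
      cst (1 : R) x = 0.
    by move=> [bx nx]; exfalso; apply: nx; split=> //; exact: zero.
  move=> /(_ gap).
  rewrite (_ : innerv _ _ _ = 0) ?add0r//.
  rewrite /innerv; transitivity (\int[mu]_(x in mpatch a) (0 : R)).
    apply: eq_Rintegral => x _; rewrite dotpC (_ : classical_grad _ x = 0).
      by rewrite -(scale0r (0 : E)) dotpZl mul0r.
    by apply/rowP => i; rewrite !mxE /partial derive_cst.
  by rewrite Rintegral_cst// mul0r.
have -> : inner (mpatch a) (fun x => psi a x * f x) (fun=> 1) = inner (mpatch a) h (fun=> 1).
  have := hdis (hat_Vh0 hTh oO bO rO hpsi hp Oa).
  have -> : innerv Omega G (wgrad Omega (psi a)) = inner Omega h (fun=> 1).
    apply: Rintegral_eq_ae; apply: filterS hh => x H /H <-.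
    by rewrite mulr1 dotpC.
  rewrite onP; last by apply: filterS psi0 => x H Ox nP; rewrite (H Ox nP).2.
  have -> : inner Omega f (psi a) = inner Omega (fun x => psi a x * f x) (fun=> 1).
    by apply: eq_Rintegral => x _; rewrite mulr1 mulrC.
  rewrite onP => [->//|].
  by apply: filterS psi0 => x H Ox nP; rewrite (H Ox nP).1 mul0r.
by rewrite mulr0; ring.
Qed.

(** The field [s] is a square integrable representative of the possibly nonmeasurable sum of the
    local fluxes. The divergence identity is stated against test functions, since density extends
    its consequences to H^1_0. *)
Lemma equilibration : exists s, [/\ L2v Omega s,
  {ae mu, forall x, sum_patches sigma x = s x} &
  forall phi, test_function Omega phi ->
    innerv Omega s (classical_grad phi) = - inner Omega f phi].
Proof.
have /choice[gv Hgv] a : exists gv : (E -> E) * (E -> R), [/\ L2v Omega gv.1,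
    {ae mu, forall x, mpatch a x -> sigma a x = gv.1 x}, Qh Omega Th p gv.2 &
    {ae mu, forall x, mpatch a x -> wdiv (mpatch a) (sigma a) x = gv.2 x}].
  by have [g [v []]] := local_flux_rep a; exists (g, v).
have /choice[h Hh] a : exists h, L2 Omega h /\
    {ae mu, forall x, Omega x -> dotp (wgrad Omega (psi a) x) (G x) = h x}.
  have [P HP] := hat_polynomial hTh hpsi a; have [cp _ _] := hpsi a.
  have [h Lh hh] := dotp_piecewise_L2 cp (fun T cT => (HP T cT).2) LG.
  by exists h.
pose g a := (gv a).1; pose v a := (gv a).2.
have Lg a : L2v Omega (g a) by case: (Hgv a).
have sg a : {ae mu, forall x, mpatch a x -> sigma a x = g a x} by case: (Hgv a).
have Qv a : Qh Omega Th p (v a) by case: (Hgv a).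
have dv a : {ae mu, forall x, mpatch a x -> wdiv (mpatch a) (sigma a) x = v a x}.
  by case: (Hgv a).
have Lvi a : L2 Omega (fun x => \1_(mpatch a) x * v a x).
  by apply: L2_indic => //; apply: L2_sub (Qv a).1.
have Lgi a : L2v Omega (fun x => \1_(mpatch a) x *: g a x).
  by apply: L2v_indic => //; apply: L2v_sub (Lg a).
pose D x := \sum_a \1_(mpatch a) x * v a x.
have QD : Qh Omega Th p D.
  split=> [|T cT]; first exact: L2_sum.
  have /choice[Q HQ] a : exists Q, deg_le p Q /\
      {ae mu, forall x, simplex T x -> v a x = peval Q x}.
    by have [Q dQ vQ] := (Qv a).2 T cT; exists Q.
  (* An inner cell is contained in the patch of each of its vertices and disjoint from all other
     patches, so the sum runs over the vertices of [T]. *)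
  exists (\sum_a if a \in T then Q a else 0).
    by apply: deg_le_sum => a; case: ifP => _; [exact: (HQ a).1|exact: deg_le0].
  apply: filterS2 (inner_cell_ae hTh cT) (filter_forall _ (fun a => (HQ a).2)).
  move=> x iT H Tx; rewrite /D peval_sum; apply: eq_bigr => a _; have [aT|aT] := boolP (a \in T).
    rewrite indicE mem_set ?mul1r ?H//; apply: (inner_cell_patch hTh cT aT); exact: iT.
  rewrite indicE memNset ?mul0r ?peval0//.
  by apply: (inner_cell_not_patch hTh cT aT); exact: iT.
have Df q : Qh Omega Th p q -> inner Omega D q = inner Omega f q.
  move=> Qq; have Lq := Qq.1; rewrite /D inner_sum//.
  have Lpf a : L2 Omega (fun x => psi a x * f x).
    apply: (@L2_mulb _ _ _ _ _ 1) => //; [exact: (hat_measurable oO hpsi a)|..|by case: hf].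
    by move=> x Ox; apply: (hat_le1 hTh hpsi); exact: subset_closure.
  transitivity (\sum_a (inner Omega (fun x => psi a x * f x) q - inner Omega (h a) q)).
    apply: eq_bigr => a _; rewrite inner_indic//.
    rewrite -(local_divergence (Hh a).1 (Hh a).2 Qq); apply: inner_eq_ae; last exact: aeW.
    by apply: filterS (dv a) => x H /H.
  rewrite big_split/= sumrN -inner_sum// -inner_sum//; last by move=> a; exact: (Hh a).1.
  have -> : inner Omega (fun x => \sum_a h a x) q = 0.
    rewrite (@inner_eq_ae _ _ _ _ (cst 0) _ q); last exact: aeW.
      by rewrite /inner; under eq_Rintegral do rewrite mul0r; rewrite Rintegral_cst// mul0r.
    apply: filterS2 (wgrad_hat_ae hTh oO bO hpsi) (filter_forall _ (fun a => (Hh a).2)).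
    move=> x H1 H2 Ox; have [_ s0] := H1 Ox.
    have -> : \sum_a h a x = dotp (\sum_a wgrad Omega (psi a) x) (G x).
      transitivity (\sum_a dotp (wgrad Omega (psi a) x) (G x)).
        by apply: eq_bigr => a _; rewrite H2.
      elim/big_rec2: _ => [|a y z _ ->]; last by rewrite dotpDl.
      by rewrite -(scale0r (0 : E)) dotpZl mul0r.
    by rewrite s0 -(scale0r (0 : E)) dotpZl mul0r.
  rewrite subr0; apply: inner_eq => // x Ox.
  by rewrite -mulr_suml (hat_sum1 hTh hpsi) ?mul1r//; exact: subset_closure.
have DfE : {ae mu, forall x, Omega x -> D x = f x}.
  have Qd : Qh Omega Th p (fun x => D x + - f x) by apply: QhD QD (QhN hf).
  have := inner_self_eq0_ae mO Qd.1.
  rewrite {1}(innerDl mO QD.1 (QhN hf).1 Qd.1) (Df _ Qd).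
  have -> : inner Omega (fun x => - f x) (fun x => D x + - f x) =
      -1 * inner Omega f (fun x => D x + - f x).
    by rewrite -innerZl//; [apply: inner_eq => // x _; rewrite mulN1r|exact: hf.1|exact: Qd.1].
  rewrite mulN1r subrr => /(_ erefl).
  by apply: filterS => x H Ox; apply/eqP; rewrite -subr_eq0 H.
exists (fun x => \sum_a \1_(mpatch a) x *: g a x); split; first exact: L2v_sum.
  apply: filterS (filter_forall _ sg) => x H; apply: eq_bigr => a _.
  have [ax|ax] := pselect (mpatch a x); first by rewrite H.
  by rewrite indicE memNset// !scale0r.
move=> phi tphi; have [Lphi Ldphi] := test_L2 mO Ooo tphi.
have Lgphi : L2v Omega (classical_grad phi).
  by move=> i; apply: L2_eq (Ldphi i) => // x _; rewrite mxE.
rewrite innerv_sum//.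
have -> : inner Omega f phi = inner Omega D phi.
  by apply: inner_eq_ae; [apply: filterS DfE => x H /H|exact: aeW].
rewrite /D inner_sum// -sumrN; apply: eq_bigr => a _.
rewrite innerv_indic// inner_indic//.
have [[_ tr] _ _ _] := hloc a.
have -> : innerv (mpatch a) (g a) (classical_grad phi) =
    innerv (mpatch a) (sigma a) (classical_grad phi).
  by apply: innerv_eq_ae; [apply: filterS (sg a) => x H /H|exact: aeW].
have -> : inner (mpatch a) (v a) phi = inner (mpatch a) (wdiv (mpatch a) (sigma a)) phi.
  by apply: inner_eq_ae; [apply: filterS (dv a) => x H /H|exact: aeW].
(* The zero normal trace applies to [phi]: a boundary point of the patch where the hat function is
   nonzero lies on the boundary of [Omega], where [phi] vanishes. *)
apply/eqP; rewrite -addr_eq0; apply/eqP; apply: tr; first by case: tphi.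
move=> x [bx nx]; have [|nz] := eqVneq (psi a x) 0.
  by move=> z; exfalso; apply: nx.
have [_ nO] := hat_patch_boundary hTh oO rO hpsi bx nz.
by apply: (test_out tphi _).1 => Ox; apply: nO; rewrite (interior_id _).1.
Qed.

End equilibrated_flux.

(** * The energy estimate *)

Section lipschitz_boundary_null.
Context {R : realType} {d : nat}.
Local Notation E := 'rV[R]_d.
Local Notation mu := (@lebesgue_rV R d).
Implicit Types (D : set E) (x y z : E).

Lemma dotp_le_norm x y : `|dotp x y| <= d%:R * (`|x| * `|y|).
Proof.
apply: (le_trans (ler_norm_sum _ _ _)).
rewrite -[X in X%:R](card_ord d) mulr_natl -sumr_const; apply: ler_sum => i _.
by rewrite normrM; apply: ler_pM => //; exact: coord_le_norm.
Qed.

(* Locally the boundary is a graph over the orthogonal of [nu], so that it is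
   disjoint from its translates along [nu]. *)
Lemma lipschitz_boundary_ae D : open D -> lipschitz_boundary D ->
  {ae mu, forall x, closure D x -> D x}.
Proof.
move=> oD lD; have mD : measurable (boundary D).
  apply: measurableD; first by apply: rV_closed_measurable; exact: closed_closure.
  by apply: rV_open_measurable; exact: open_interior.
exists (boundary D); split=> //; last first.
- move=> x /= /not_implyP[cx nx]; split=> //.
  by rewrite (interior_id _).1.
- apply: locally_shiftfree_null => //.
  move=> x bx; have [nu [g [r [nu1 [M [_ gM]] gnu r0 Dg]]]] := lD x bx.
  pose L := `|M| + 1; have L0 : 0 < L by rewrite ltr_wpDl.
  have gL y z : `|g y - g z| <= L * `|y - z|.
    apply: (gM L _ (y, z)) => //; apply: le_lt_trans (ler_norm M) _.
    by rewrite ltrDl.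
  have graph y : ball x r y -> boundary D y -> g y = dotp y nu.
    move=> xy [cy ny]; have nDy : ~ D y by rewrite (interior_id _).1 in ny.
    apply/eqP; rewrite eq_le; apply/andP; split; last first.
      by rewrite leNgt; apply/negP => /(Dg y xy).2.
    rewrite leNgt; apply/negP => lt_dot.
    have c0 : 0 < L + d%:R * `|nu| by rewrite ltr_pwDl// mulr_ge0.
    (* Moving by less than [e] changes [g] and the height along [nu] by too little to close the gap
       between them, so no point of [D] would be near [y], contrary to [y] being in the closure. *)
    pose e := (g y - dotp y nu) / (L + d%:R * `|nu|).
    have e0 : 0 < e by rewrite divr_gt0// subr_gt0.
    have : nbhs y (ball y e `&` ball x r).
      apply: open_nbhs_nbhs; split; last by split=> //; exact: ballxx.
      by apply: openI; exact: ball_open.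
    move=> /cy[z [Dz [/ball_norm_rV yz xz]]].
    have gz := (Dg z xz).1 Dz.
    have h1 : g y - g z <= L * `|y - z| by exact: le_trans (ler_norm _) (gL y z).
    have h2 : dotp z nu - dotp y nu <= d%:R * (`|y - z| * `|nu|).
      rewrite -dotpBl (distrC y); exact: le_trans (ler_norm _) (dotp_le_norm _ _).
    have h3 : (L + d%:R * `|nu|) * `|y - z| < g y - dotp y nu.
      by rewrite mulrC -ltr_pdivlMr.
    have : g y - dotp y nu <= (L + d%:R * `|nu|) * `|y - z|.
      rewrite mulrDl; nra.
    by rewrite leNgt h3.
  exists r, nu; split=> // y t t0 xy xyt by_ byt.
  have := graph _ xyt byt; rewrite gnu (graph _ xy by_) dotpDl dotpZl nu1 mulr1.
  by move/eqP; rewrite -subr_eq0 opprD addrA subrr sub0r oppr_eq0 gt_eqF.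
Qed.

End lipschitz_boundary_null.

(** * Splitting norms over the cells, and the bound on the error *)

Section final_estimate.
Context {R : realType} {d : nat}.
Local Notation E := 'rV[R]_d.
Local Notation mu := (@lebesgue_rV R d).
Implicit Types (D : set E) (x y : E) (w z : E -> E).

Lemma innerv_subset_le D D' z : measurable D -> measurable D' -> D' `<=` D ->
  L2v D z -> innerv D' z z <= innerv D z z.
Proof.
move=> mD mD' DD Lz; rewrite -(innerv_indic _ _ DD).
have Li : L2v D (fun x => \1_D' x *: z x).
  by apply: L2v_indic => //; exact: L2v_sub Lz.
apply: le_Rintegral => //; try exact: dotp_integrable.
move=> x _; rewrite dotpZl indicE.
by case: (x \in D'); rewrite ?mul1r ?mul0r ?dotp_ge0.
Qed.

Section cell_sums.
Variables (Omega : set E) (Th : mesh R d).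
Hypothesis hTh : simplicial_mesh Omega Th.
Hypotheses (oO : open Omega) (rO : (closure Omega)° `<=` Omega).

Let mO : measurable Omega. Proof. exact: rV_open_measurable. Qed.

(** The inner cells split [D] up to a null set. Additivity is used for the square integrable [z],
    while the cell norms are those of [z'], which may fail to be measurable. *)
Lemma innerv_cells D z z' : measurable D -> D `<=` Omega -> L2v D z ->
  {ae mu, forall x, D x -> z' x = z x} ->
  innerv D z z = \sum_(T in cells Th) normv (simplex T `&` D) z' ^+ 2.
Proof.
move=> mD DO Lz zz.
have mi T : T \in cells Th -> measurable (inner_cell T `&` D).
  move=> cT; apply: measurableI => //; apply: rV_open_measurable.
  exact: (inner_cell_open hTh cT).
pose F (T : {set 'I_(nvertices Th)}) x :=
  if T \in cells Th then \1_(inner_cell T `&` D) x *: z x else 0.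
have LF T : L2v D (F T).
  rewrite /F; have [cT|cT] := boolP (T \in cells Th).
    apply: L2v_indic => //; first exact: mi.
    by apply: L2v_sub Lz => //; exact: mi.
  by move=> i; apply: L2_eq (L2Z 0 mD (Lz i)) => // x _; rewrite mxE mul0r.
rewrite [LHS](@innerv_eq_ae _ _ _ _ (fun x => \sum_T F T x) _ z); last exact: aeW.
  rewrite innerv_sum// [RHS]big_mkcond; apply: eq_bigr => T _; rewrite /F.
  have [cT|cT] := boolP (T \in cells Th); last first.
    rewrite /innerv; transitivity (\int[mu]_(x in D) (0 : R)).
      by apply: eq_Rintegral => x _; rewrite -(scale0r (0 : E)) dotpZl mul0r.
    by rewrite Rintegral_cst// mul0r.
  rewrite innerv_indic// sqr_normv /innerv.
  rewrite [RHS](@Rintegral_sub_ae _ _ _ (inner_cell T `&` D)).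
  - apply: Rintegral_eq_ae; apply: filterS zz => x H [_ Dx].
    by rewrite H.
  - by move=> x [Tx Dx]; split=> //; exact: (inner_cell_sub hTh cT).
  - by apply: filterS (inner_cell_ae hTh cT) => x H [/H Tx Dx] [].
apply: filterS (Omega_inner_ae hTh) => x Hx Dx.
have [T cT Tx] := Hx (DO x Dx).
rewrite (bigD1 T)//= {1}/F cT indicE mem_set// scale1r big1 ?addr0// => T' TT'.
rewrite /F; case: ifP => // cT'; rewrite indicE memNset ?scale0r// => -[T'x _].
move: TT'; rewrite (inner_cell_disjoint hTh cT' cT T'x) ?eqxx//.
exact: (inner_cell_sub hTh cT).
Qed.

(** The cells left out meet [omega] in a null set, where the integral is zero whatever the
    integrand. *)
Lemma innerv_feature_cells (omega : set E) z z' : measurable omega -> omega `<=` Omega ->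
  L2v omega z -> {ae mu, forall x, omega x -> z' x = z x} ->
  innerv omega z z =
  \sum_(T in feature_cells Th omega) normv (simplex T `&` omega) z' ^+ 2.
Proof.
move=> mo oOm Lz zz; rewrite (innerv_cells mo oOm Lz zz) [LHS](bigID (mem (feature_cells Th omega)))/=.
rewrite [X in _ + X]big1 ?addr0 => [|T /andP[cT]]; last first.
  rewrite inE cT/= negbK => /eqP T0; rewrite sqr_normv /innerv.
  have mTo : measurable (simplex T `&` omega).
    by apply: measurableI => //; exact: (simplex_measurable hTh).
  rewrite (@Rintegral_eq_ae _ _ _ _ _ _ (cst 0)).
    by rewrite Rintegral_cst// mul0r.
  exists (simplex T `&` omega); split=> // x /= H.
  by apply: contrapT => nx; apply: H => /nx.
by apply: eq_bigl => T; rewrite inE; case: (T \in cells Th).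
Qed.

(** A closed cell may touch the boundary of [Omega], but its inner cell lies in [Omega] and the rest
    of it is null. *)
Lemma innerv_all_cells z z' : L2v Omega z -> {ae mu, forall x, Omega x -> z' x = z x} ->
  innerv Omega z z = \sum_(T in cells Th) normv (simplex T) z' ^+ 2.
Proof.
move=> Lz zz; rewrite (innerv_cells mO (@subset_refl _ _) Lz zz).
apply: eq_bigr => T cT; rewrite !sqr_normv; apply/esym/Rintegral_sub_ae.
  by move=> x [].
apply: filterS (inner_cell_ae hTh cT) => x H /[dup] Tx /H iTx [].
by split=> //; exact: (inner_cell_Omega hTh rO cT).
Qed.

End cell_sums.

Lemma measurable_coefficient D (A : set E) (a b : R) : measurable A ->
  measurable_fun D (coefficient a b A).
Proof.
move=> mA; rewrite (_ : coefficient a b A = (fun x => b + \1_A x * (a - b))); last first.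
  apply/funext => x; rewrite /coefficient indicE.
  by case: (x \in A); rewrite ?mul1r ?mul0r ?addr0// addrC subrK.
by apply: measurable_funD => //; apply: measurable_funM => //; exact: measurable_indic.
Qed.

Lemma coefficient_L2v D (A : set E) (a b : R) (h : R -> R) z : measurable D -> measurable A ->
  L2v D z -> L2v D (fun x => h (coefficient a b A x) *: z x).
Proof.
move=> mD mA Lz; apply: (@L2v_mulb _ _ _ _ _ (`|h a| + `|h b|)) => //.
  rewrite (_ : (fun _ => _) = coefficient (h a) (h b) A); first exact: measurable_coefficient.
  by apply/funext => x; rewrite /coefficient; case: ifP.
by move=> x _; rewrite /coefficient; case: ifP => _; rewrite ?lerDl ?lerDr.
Qed.

(** The algebraic core, free of the mesh: [s] stands for the flux, [a] for the gradient of [u0h] and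
    [w] for that of the error. The vanishing inner product says that the flux plus [kappa] times the
    exact gradient is orthogonal to [w]. *)
Lemma energy_bound D omega A1 A01 (k1 k2 : R) s a w :
  0 < k1 -> 0 < k2 -> measurable D -> measurable omega -> omega `<=` D ->
  measurable A1 -> measurable A01 ->
  let kappa := coefficient k1 k2 A1 in let kappa0 := coefficient k1 k2 A01 in
  {ae mu, forall x, D x -> ~ omega x -> kappa x = kappa0 x} ->
  (forall x, omega x -> kappa x = k2 /\ kappa0 x = k1) ->
  L2v D s -> L2v D a -> L2v D w ->
  innerv D (fun x => s x + kappa x *: a x + kappa x *: w x) w = 0 ->
  let s0 x := (Num.sqrt (kappa0 x))^-1 *: s x + Num.sqrt (kappa0 x) *: a x in
  L2v D s0 /\
  Num.sqrt (innerv D (fun x => kappa x *: w x) w) <=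
    `|k2 / k1 - 1| * (Num.sqrt k2)^-1 * normv omega s
    + (normv D s0 + `|Num.sqrt (k2 / k1) - 1| * normv omega s0).
Proof.
move=> k1_0 k2_0 mD mo oD mA1 mA01 kappa kappa0 kk0 ko Ls La Lw orth s0.
have q1 : 0 < Num.sqrt k1 by rewrite sqrtr_gt0.
have q2 : 0 < Num.sqrt k2 by rewrite sqrtr_gt0.
have s1 : Num.sqrt k1 ^+ 2 = k1 by rewrite sqr_sqrtr// ltW.
have s2 : Num.sqrt k2 ^+ 2 = k2 by rewrite sqr_sqrtr// ltW.
have Ls0 : L2v D s0.
  apply: L2vD => //; last exact: (coefficient_L2v _ _ Num.sqrt).
  exact: (coefficient_L2v _ _ (fun t => (Num.sqrt t)^-1)).
split=> //.
pose B x := Num.sqrt (kappa x) *: w x.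
have LB : L2v D B by exact: (coefficient_L2v _ _ Num.sqrt).
have kpos x : 0 < kappa x by rewrite /kappa /coefficient; case: ifP.
have -> : innerv D (fun x => kappa x *: w x) w = innerv D B B.
  apply: eq_Rintegral => x _; rewrite !dotpZl dotpC dotpZl mulrA -expr2.
  by rewrite sqr_sqrtr// ltW// kpos.
rewrite -/(normv D B); set A := normv D B.
(* With [rho = k2 / k1], on [omega] one has [sqrt k2 a = sqrt rho (s0 - s / sqrt k1)]. Hence
   [s / sqrt k2 + sqrt k2 a] equals [sqrt rho s0 + (1 - rho) s / sqrt k2], and [c1], [c2] are the
   coefficients left after removing [s0]. *)
pose c1 := Num.sqrt (k2 / k1) - 1; pose c2 := (1 - k2 / k1) / Num.sqrt k2.
pose z x := c1 *: s0 x + c2 *: s x.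
pose S x := s0 x + \1_omega x *: z x.
have sub z' : L2v D z' -> L2v omega z' by move=> Lz; exact: L2v_sub Lz.
have Lz : L2v D z by apply: L2vD => //; exact: L2vZ.
have Liz : L2v D (fun x => \1_omega x *: z x) by apply: L2v_indic => //; exact: sub.
have LS : L2v D S by exact: L2vD.
have Ssplit : {ae mu, forall x, D x -> Num.sqrt (kappa x) *: S x = s x + kappa x *: a x}.
  apply: filterS kk0 => x H Dx; rewrite /S indicE.
  have [ox|nox] := pselect (omega x).
    have [kx k0x] := ko x ox; rewrite mem_set// scale1r /z /s0 kx k0x.
    apply/rowP => i; rewrite !mxE /c1 /c2 sqrtrM ?ltW// sqrtrV ?ltW//.
    move: (Num.sqrt k1) (Num.sqrt k2) s1 s2 q1 q2 => t1 t2 <- <- t1_0 t2_0.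
    by field; rewrite !gt_eqF.
  rewrite memNset// scale0r addr0 /s0 -H//.
  have qk : 0 < Num.sqrt (kappa x) by rewrite sqrtr_gt0.
  rewrite scalerDr !scalerA divff ?gt_eqF// scale1r -expr2 sqr_sqrtr//.
  exact: ltW (kpos x).
have AS : A ^+ 2 = - innerv D S B.
  have Lka : L2v D (fun x => kappa x *: a x) by exact: (coefficient_L2v _ _ id).
  have Lkw : L2v D (fun x => kappa x *: w x) by exact: (coefficient_L2v _ _ id).
  have : innerv D S B = innerv D (fun x => s x + kappa x *: a x) w.
    apply: Rintegral_eq_ae; apply: filterS Ssplit => x H Dx.
    by rewrite -H// dotpZl dotpC dotpZl dotpC.
  move: orth; rewrite innervDl//; last exact: L2vD.
  rewrite /A sqr_normv => /eqP; rewrite addr_eq0 => /eqP -> ->.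
  rewrite opprK; apply: eq_Rintegral => x _; rewrite !dotpZl dotpC dotpZl mulrA -expr2.
  by rewrite sqr_sqrtr// ltW// kpos.
have A0 : 0 <= A by exact: normv_ge0.
have Ao : normv omega B <= A.
  by apply: ler_wsqrtr; exact: innerv_subset_le.
have SB : innerv D S B = innerv D s0 B + (c1 * innerv omega s0 B + c2 * innerv omega s B).
  rewrite (innervDl mD Ls0 Liz LB) innerv_indic//; congr (_ + _).
  have L1 := L2vZ c1 mo (sub _ Ls0); have L2 := L2vZ c2 mo (sub _ Ls).
  by rewrite (innervDl mo L1 L2 (sub _ LB)) !innervZl//; exact: sub.
have cs z' : L2v D z' -> `|innerv omega z' B| <= normv omega z' * A.
  move=> Lz'; apply: (le_trans (cauchy_schwarz_innerv mo (sub _ Lz') (sub _ LB))).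
  by apply: ler_wpM2l => //; exact: normv_ge0.
set rhs := _ + _.
have c2E : `|k2 / k1 - 1| * (Num.sqrt k2)^-1 = `|c2|.
  by rewrite /c2 normrM distrC normfV (gtr0_norm q2).
have rhs0 : 0 <= rhs by rewrite !addr_ge0 ?mulr_ge0 ?normv_ge0 ?invr_ge0 ?sqrtr_ge0.
have : A ^+ 2 <= rhs * A.
  have cs0 := cauchy_schwarz_innerv mD Ls0 LB; rewrite -/A in cs0.
  rewrite AS SB; apply: (le_trans (ler_norm _)); rewrite normrN.
  have -> : rhs * A = normv D s0 * A +
      (`|c1| * (normv omega s0 * A) + `|c2| * (normv omega s * A)).
    by rewrite /rhs c2E; ring.
  apply: (le_trans (ler_normD _ _)); apply: lerD => //.
  apply: (le_trans (ler_normD _ _)).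
  by rewrite (normrM c1) (normrM c2); apply: lerD; apply: ler_wpM2l => //; exact: cs.
have [->//|An0] := eqVneq A 0.
by rewrite expr2 ler_pM2r// lt_def An0.
Qed.

End final_estimate.

Theorem proposition3p1 (R : realType) (d : nat) (hd : d = 2%N \/ d = 3%N)
  (Omega Omega1 Omega2 Gamma Gamma0 Omega01 Omega02 omega : set 'rV[R]_d)
  (hgeo : defeatured_geometry
            Omega Omega1 Omega2 Gamma Gamma0 Omega01 Omega02 omega)
  (kappa1 kappa2 : R) (hkappa1 : 0 < kappa1) (hkappa2 : 0 < kappa2)
  (Th : mesh R d) (hTh : simplicial_mesh Omega Th)
  (hconf : conforming_to Gamma0 Th)
  (p : nat) (hp : (1 <= p)%N)
  (f : 'rV[R]_d -> R) (hf : Qh Omega Th p f)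
  (psi : 'I_(nvertices Th) -> 'rV[R]_d -> R)
  (hpsi : forall a, hat_function Omega a (psi a))
  (u u0h : 'rV[R]_d -> R)
  (sigma : 'I_(nvertices Th) -> 'rV[R]_d -> 'rV[R]_d)
  (lambda : 'I_(nvertices Th) -> 'rV[R]_d -> R) :
  let kappa := coefficient kappa1 kappa2 Omega1 in
  let kappa0 := coefficient kappa1 kappa2 Omega01 in
  exact_solution Omega kappa f u ->
  discrete_solution Omega Th p kappa0 f u0h ->
  (forall a, local_flux_problem Omega p f kappa0 u0h psi a
               (sigma a) (lambda a)) ->
  let sigma_h := sum_patches sigma in
  let s0 := fun x => (Num.sqrt (kappa0 x))^-1 *: sigma_h x
                     + Num.sqrt (kappa0 x) *: wgrad Omega u0h x in
  let rho := kappa2 / kappa1 in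
  let e := fun x => u x - u0h x in
  let Wh := feature_cells Th omega in
  let C := `|rho - 1| * (Num.sqrt kappa2)^-1 in
  let Ctilde := `|Num.sqrt rho - 1| in
  let Ed := C * Num.sqrt (\sum_(T in Wh) normv (simplex T `&` omega) sigma_h ^+ 2) in
  let En := Num.sqrt (\sum_(T in cells Th) normv (simplex T) s0 ^+ 2)
    + Ctilde * Num.sqrt (\sum_(T in Wh) normv (simplex T `&` omega) s0 ^+ 2) in
  energy_norm Omega kappa e <= Ed + En.
Proof.
move=> kappa kappa0 [Hu Hexact] [Vu0h Hdis] Hloc; cbv zeta.
set sigma_h := sum_patches sigma.
set s0 := fun x => _ *: sigma_h x + _; set e := fun x => u x - u0h x.
have [[oO _ _ bO _] [op1 _ _ _ l1] _ disj uO _ _ _ _ _ [oo _ _ _ lo] _ om2 O01 _] := hgeo.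
have mO := rV_open_measurable oO; have Ooo := lebesgue_rV_bounded_lty mO bO.
(* [Omega] is the interior of a closed set, so that set contains its closure, and taking interiors
   gives the inclusion. *)
have rO : (closure Omega)° `<=` Omega.
  rewrite {2}uO; apply: interiorS.
  have cl : closed (closure Omega1 `|` closure Omega2) by apply: closedU; exact: closed_closure.
  rewrite [X in _ `<=` X]((closure_id _).1 cl); apply: closure_subset.
  by rewrite uO; exact: interior_subset.
have m1 := rV_open_measurable op1; have mo := rV_open_measurable oo.
have m01 : measurable Omega01 by rewrite O01; apply: rV_open_measurable; exact: open_interior.
have oOm : omega `<=` Omega.
  rewrite uO -open_subsetE//; apply: (subset_trans om2).
  by apply: subset_trans (@subset_closure _ _) _; exact: subsetUr.
have kappa_omega x : omega x -> kappa x = kappa2 /\ kappa0 x = kappa1.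
  move=> ox; rewrite /kappa /kappa0 /coefficient memNset; last first.
    by move=> x1; rewrite -[False]/(set0 x) -disj; split=> //; exact: om2.
  rewrite mem_set// O01; apply: filterS (open_nbhs_nbhs (conj oo ox)) => y oy.
  by right; exact: subset_closure.
(* A point outside [omega] that is interior to the union of the two closures belongs to [Omega1],
   unless it lies on the boundary of [Omega1] or of [omega]; both are null. *)
have kappaE : {ae lebesgue_rV d, forall x, Omega x -> ~ omega x -> kappa x = kappa0 x}.
  apply: filterS2 (lipschitz_boundary_ae op1 l1) (lipschitz_boundary_ae oo lo).
  move=> x H1 Ho _ nox; rewrite /kappa /kappa0 /coefficient.
  have [x1|nx1] := pselect (Omega1 x).
    rewrite !mem_set// O01; apply: filterS (open_nbhs_nbhs (conj op1 x1)) => y y1.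
    by left; exact: subset_closure.
  rewrite !memNset// O01 => /interior_subset[/H1//|/Ho//].
have [cu0 [Lu0 pu0] bu0] := Vu0h.
have [P HP] := piecewise_polynomial hTh cu0 pu0.
have vP T cT := (HP T cT).2.
have Hu0 : H10 Omega u0h by exact: (H10_piecewise hTh oO bO cu0 vP bu0).
have [[Lu [wu /wgradP gu]] _] := Hu; have [[_ [w0 /wgradP gu0]] _] := Hu0.
have LG : L2v Omega (fun x => kappa0 x *: wgrad Omega u0h x).
  by apply: (coefficient_L2v _ _ id) => //; exact: gu0.1.
have [s [Ls sE sdiv]] := equilibration hTh oO bO rO hp hf hpsi LG Hdis Hloc.
have Lku : L2v Omega (fun x => kappa x *: wgrad Omega u x).
  by apply: (coefficient_L2v _ _ id) => //; exact: gu.1.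
pose z x := s x + kappa x *: wgrad Omega u x.
have Lz : L2v Omega z by exact: L2vD.
(* Against a test function, the exact equation and the equilibration produce opposite terms; density
   then gives orthogonality for both [u] and [u0h]. *)
have orth v : H10 Omega v -> innerv Omega z (wgrad Omega v) = 0.
  apply: (H10_orthogonal oO bO Lz) => phi tphi.
  have gphi := is_wgrad_test oO bO tphi.
  rewrite innervDl//; last exact: gphi.1.
  have := Hexact _ (test_H10 oO bO tphi).
  rewrite (innerv_eq_ae (aeW _ (fun x _ => erefl)) (wgrad_ae oO Ooo gphi)) => ->.
  by rewrite sdiv// addNr.
pose w x := wgrad Omega u x - wgrad Omega u0h x.
have ge := is_wgradB mO Ooo Lu Lu0 gu gu0.
have Lw : L2v Omega w := ge.1.
have we := wgrad_ae oO Ooo ge.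
have zw : innerv Omega (fun x => s x + kappa x *: wgrad Omega u0h x + kappa x *: w x) w = 0.
  transitivity (innerv Omega z w).
    by apply: eq_Rintegral => x _; rewrite -addrA -scalerDr /w [X in kappa x *: X]addrC subrK.
  have LN : L2v Omega (fun x => -1 *: wgrad Omega u0h x) by apply: L2vZ => //; exact: gu0.1.
  rewrite innervC /w; under [X in innerv _ X _]eq_fun do rewrite -scaleN1r.
  rewrite innervDl//; last exact: gu.1.
  rewrite innervZl//; last exact: gu0.1.
  by rewrite innervC orth// innervC orth// mulr0 addr0.
have [Lt] := energy_bound hkappa1 hkappa2 mO mo oOm m1 m01 kappaE kappa_omega Ls gu0.1 Lw zw.
have -> : energy_norm Omega kappa e =
    Num.sqrt (innerv Omega (fun x => kappa x *: w x) w).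
  congr Num.sqrt; apply: innerv_eq_ae => //.
  by apply: filterS we => x H Ox; rewrite H.
move/le_trans; apply.
(* The estimators integrate [sigma_h] itself, so its almost everywhere equality with [s] is handed
   to the cell sums. *)
have sE' D : {ae lebesgue_rV d, forall x, D x -> sigma_h x = s x}.
  by apply: filterS sE => x.
have s0E D : {ae lebesgue_rV d, forall x, D x -> s0 x =
    (Num.sqrt (kappa0 x))^-1 *: s x + Num.sqrt (kappa0 x) *: wgrad Omega u0h x}.
  by apply: filterS sE => x H _; rewrite /s0 /sigma_h H.
have Lso := L2v_sub mO mo oOm Ls; have Lto := L2v_sub mO mo oOm Lt.
rewrite /normv (innerv_feature_cells hTh mo oOm Lso (sE' omega)).
rewrite (innerv_feature_cells hTh mo oOm Lto (s0E omega)).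
by rewrite (innerv_all_cells hTh oO rO Lt (s0E Omega)).
Qed.
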